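(* Let $r\ge1$ and ${\bm 1}=(1,\dots,1)\in\mathbb{F}_2^r$. The sum $\sum_{({\bm a},{\bm j})\in\mathcal{P}^r}\mathcal{U}_rB^{({\bm 1})}({\bm a},{\bm j})$ is the socle of the (left regular) $\mathcal{U}_r$-module $\mathcal{U}_r$.
   Context: **Hyperalgebra.** $k$ is an algebraically closed field of characteristic $p>0$. Let $X,Y,H$ be the standard basis of $\mathfrak{sl}_2(\mathbb{C})$ ($X=E_{12}$, $Y=E_{21}$, $H=E_{11}-E_{22}$). $\mathcal{U}_{\mathbb{Z}}$ is the subring of the universal enveloping algebra of $\mathfrak{sl}_2(\mathbb{C})$ generated by all $X^{(m)}=X^m/m!$ and $Y^{(m)}=Y^m/m!$, $m\ge0$; it contains $\binom{H+c}{m}=\frac{(H+c)(H+c-1)\cdots(H+c-m+1)}{m!}$ for $c\in\mathbb{Z}$, $m\ge 0$. Put $\mathcal{U}=\mathcal{U}_{\mathbb{Z}}\otimes_{\mathbb{Z}}k$ (the hyperalgebra of ${\rm SL}_2$), with the same symbols for images in $\mathcal{U}$; it has $k$-basis $Y^{(m)}\binom{H}{n}X^{(m')}$, $m,n,m'\ge0$. For $r\ge1$, $\mathcal{U}_r$ is the subalgebra of $\mathcal{U}$ generated by $X^{(n)},Y^{(n)}$ with $0\le n\le p^r-1$ (finite-dimensional). Modules are finite-dimensional left modules; the socle is the largest semisimple submodule. **Elements $B^{(\varepsilon)}(a,j)$.** For $a\in\mathbb{Z}$ put $\mu_a=\binom{H-a-1}{p-1}\in\mathcal{U}_1$ (depends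 only on $a$ mod $p$). Regard $\mathbb{F}_2=\{0,1\}$. If $p$ is odd: $\mathcal{S}=\{0,1,\dots,(p-1)/2\}$, $\mathcal{P}_{\mathbb{Z}}=\mathbb{Z}\times\mathcal{S}$; in $\mathbb{F}_p[x]$ put $\psi_0^{(0)}(x)=\psi_0^{(1)}(x)=\prod_{i\in\mathcal{S}\setminus\{0\}}(x-i^2)^2$ and, for $s\in\mathcal{S}\setminus\{0\}$, $\psi_s^{(0)}(x)=2x(x+s^2)\prod_{i\in\mathcal{S}\setminus\{0,s\}}(x-i^2)^2$, $\psi_s^{(1)}(x)=x(x-s^2)\prod_{i\in\mathcal{S}\setminus\{0,s\}}(x-i^2)^2$ (integers read mod $p$); and $B^{(\varepsilon)}(a,j)=\psi_j^{(\varepsilon)}\left(\mu_aYX+\left(\frac{a+1}{2}\right)^2\right)\cdot\mu_a$ for $\varepsilon\in\mathbb{F}_2$, $(a,j)\in\mathcal{P}_{\mathbb{Z}}$. If $p=2$: $\mathcal{P}_{\mathbb{Z}}=\{(2i,\frac12),(1+2i,0),(1+2i,1)\mid i\in\mathbb{Z}\}$ and $B^{(0)}(2i,\frac12)=\mu_0$, $B^{(1)}(2i,\frac12)=\mu_0YX$, $B^{(0)}(1+2i,0)=B^{(1)}(1+2i,0)=\mu_1YX$, $B^{(0)}(1+2i,1)=B^{(1)}(1+2i,1)=\mu_1YX+\mu_1$. In both cases $\mathcal{P}=\{(a,j)\in\mathcal{P}_{\mathbb{Z}}\mid 0\le a\le p-1\}$. **Conditions on $(a,j)\in\mathcal{P}_{\mathbb{Z}}$.**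 Let $\widehat a\in\{0,\dots,p-1\}$, $\widehat a\equiv a$ mod $p$. (A): $\widehat a$ even and $(p-\widehat a+1)/2\le j\le(p-1)/2$. (B): $\widehat a$ even and $0\le j\le(p-\widehat a-1)/2$. (C): $\widehat a$ odd and $0\le j\le(\widehat a-1)/2$. (D): $\widehat a$ odd and $(\widehat a+1)/2\le j\le(p-1)/2$. For $p=2$, by convention $(2i,\frac12),(1+2i,0),(1+2i,1)$ satisfy (B),(C),(D) respectively. **Integers $n^{(\varepsilon)}(a,j)$** (the pair $(n^{(0)},n^{(1)})$ at $(a,j)$): (A): $\left(\frac{p-\widehat a-1}{2}+j,\ \frac{3p-\widehat a-1}{2}-j\right)$; (B): $\left(\frac{p-\widehat a-1}{2}-j,\ \frac{p-\widehat a-1}{2}+j\right)$; (C): $\left(\frac{2p-\widehat a-1}{2}-j,\ \frac{2p-\widehat a-1}{2}+j\right)$; (D): $\left(j-\frac{\widehat a+1}{2},\ \frac{2p-\widehat a-1}{2}-j\right)$. It is known that $B^{(\varepsilon)}(a,j)=\mu_a\sum_{m=n^{(\varepsilon)}(a,j)}^{p-1}c_m^{(\varepsilon)}(a,j)Y^mX^m$ for (unique) $c_m^{(\varepsilon)}(a,j)\in\mathbb{F}_p$. **Maps $Z^{(\varepsilon)}$ and elements $B^{({\bm\varepsilon})}({\bm a},{\bm j})$.** ${\rm Fr}':\mathcal{U}\to\mathcal{U}$ is the $k$-linear map with $Y^{(m)}\binom{H}{n}X^{(m')}\mapsto Y^{(mp)}\binom{H}{np}X^{(m'p)}$. If $(a,j)$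 satisfies (A) or (C), let $s(a,j)=(p-\widehat a+1)/2$ if $p$ is odd and $\widehat a$ even, $s(a,j)=(p-\widehat a)/2$ if $p$ and $\widehat a$ are odd, $s(a,j)=1$ if $p=2$. For $z\in\mathcal{U}$: $Z^{(\varepsilon)}(z;(a,j))=\mu_a\sum_{m=n^{(\varepsilon)}(a,j)}^{p-1}c_m^{(\varepsilon)}(a,j)Y^mX^{m-s(a,j)}{\rm Fr}'(z)X^{s(a,j)}$ in cases (A),(C), and $Z^{(\varepsilon)}(z;(a,j))={\rm Fr}'(z)B^{(\varepsilon)}(a,j)$ in cases (B),(D). An element of $\mathcal{P}_{\mathbb{Z}}^r$ is written $({\bm a},{\bm j})=((a_i,j_i))_{i=0}^{r-1}$, ${\bm a}=(a_0,\dots,a_{r-1})$, ${\bm j}=(j_0,\dots,j_{r-1})$. For ${\bm\varepsilon}=(\varepsilon_0,\dots,\varepsilon_{r-1})\in\mathbb{F}_2^r$ define inductively $B^{({\bm\varepsilon})}({\bm a},{\bm j})=B^{(\varepsilon_0)}(a_0,j_0)$ if $r=1$, and $B^{({\bm\varepsilon})}({\bm a},{\bm j})=Z^{(\varepsilon_0)}\left(B^{(\varepsilon_1,\dots,\varepsilon_{r-1})}((a_1,\dots,a_{r-1}),(j_1,\dots,j_{r-1}));(a_0,j_0)\right)$ if $r\ge2$. These lie in $\mathcal{U}_r$. *)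

(* Defs.v *)
From HB Require Import structures.
From mathcomp Require Import all_boot all_order all_algebra.
From mathcomp Require Import boolp classical_sets reals complex.

Set Implicit Arguments.
Unset Strict Implicit.
Unset Printing Implicit Defensive.

Import Order.TTheory GRing.Theory Num.Theory.
Local Open Scope classical_set_scope.
Local Open Scope ring_scope.
Local Open Scope quotient_scope.

(** * Universal enveloping algebras *)

Inductive ueaTerm (K : fieldType) (L : lmodType K) : Type :=
| uScal of K
| uGen of L
| uAdd of ueaTerm L & ueaTerm L
| uMul of ueaTerm L & ueaTerm L.
Arguments uScal {K} L _.

HB.instance Definition _ (K : fieldType) (L : lmodType K) :=
  gen_eqMixin (ueaTerm L).
HB.instance Definition _ (K : fieldType) (L : lmodType K) :=
  gen_choiceMixin (ueaTerm L).

Section UEA.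
Variables (K : fieldType) (L : lmodType K) (br : L -> L -> L).
Implicit Types (t u v : ueaTerm L).

(* The least congruence for which terms form a unital associative K-algebra,
   L -> terms is K-linear and xy - yx = [x, y]: the quotient is the tensor
   algebra of L modulo the relations x (x) y - y (x) x - [x, y]. *)
Inductive ueaEq : ueaTerm L -> ueaTerm L -> Prop :=
| ueaEq_refl t : ueaEq t t
| ueaEq_sym t u : ueaEq t u -> ueaEq u t
| ueaEq_trans t u v : ueaEq t u -> ueaEq u v -> ueaEq t v
| ueaEq_add t t' u u' :
    ueaEq t t' -> ueaEq u u' -> ueaEq (uAdd t u) (uAdd t' u')
| ueaEq_mul t t' u u' :
    ueaEq t t' -> ueaEq u u' -> ueaEq (uMul t u) (uMul t' u')
| ueaEq_addA t u v : ueaEq (uAdd t (uAdd u v)) (uAdd (uAdd t u) v)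
| ueaEq_addC t u : ueaEq (uAdd t u) (uAdd u t)
| ueaEq_add0 t : ueaEq (uAdd (uScal L 0) t) t
| ueaEq_mulA t u v : ueaEq (uMul t (uMul u v)) (uMul (uMul t u) v)
| ueaEq_mul1 t : ueaEq (uMul (uScal L 1) t) t
| ueaEq_mul0 t : ueaEq (uMul (uScal L 0) t) (uScal L 0)
| ueaEq_mulDl t u v : ueaEq (uMul (uAdd t u) v) (uAdd (uMul t v) (uMul u v))
| ueaEq_mulDr t u v : ueaEq (uMul t (uAdd u v)) (uAdd (uMul t u) (uMul t v))
| ueaEq_scalD c d : ueaEq (uScal L (c + d)) (uAdd (uScal L c) (uScal L d))
| ueaEq_scalM c d : ueaEq (uScal L (c * d)) (uMul (uScal L c) (uScal L d))
| ueaEq_scalC c t : ueaEq (uMul (uScal L c) t) (uMul t (uScal L c))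
| ueaEq_genD x y : ueaEq (uGen (x + y)) (uAdd (uGen x) (uGen y))
| ueaEq_genZ c x : ueaEq (uGen (c *: x)) (uMul (uScal L c) (uGen x))
| ueaEq_genB x y :
    ueaEq (uMul (uGen x) (uGen y))
          (uAdd (uMul (uGen y) (uGen x)) (uGen (br x y))).

Definition ueaEqb t u : bool := `[< ueaEq t u >].

Fact ueaEqb_refl : reflexive ueaEqb.
Proof. by move=> t; apply/asboolP/ueaEq_refl. Qed.
Fact ueaEqb_sym : symmetric ueaEqb.
Proof. by move=> t u; apply/asboolP/asboolP; apply: ueaEq_sym. Qed.
Fact ueaEqb_trans : transitive ueaEqb.
Proof.
by move=> t u v /asboolP h1 /asboolP h2; apply/asboolP/(ueaEq_trans h1 h2).
Qed.

Canonical ueaEquiv := EquivRel ueaEqb ueaEqb_refl ueaEqb_sym ueaEqb_trans.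

Definition uea := {eq_quot ueaEquiv}.
HB.instance Definition _ := Choice.on uea.
HB.instance Definition _ := EqQuotient.on uea.

Definition uea_pi (t : ueaTerm L) : uea := \pi_uea t.

Lemma uea_piP t u : uea_pi t = uea_pi u <-> ueaEq t u.
Proof.
split; first by move/eqmodP => /= /asboolP.
by move=> h; apply/eqmodP => /=; apply/asboolP.
Qed.

Lemma uea_reprP t : ueaEq (repr (uea_pi t)) t.
Proof. by apply/uea_piP; rewrite /uea_pi reprK. Qed.

Lemma uea_piW (P : uea -> Prop) : (forall t, P (uea_pi t)) -> forall x, P x.
Proof. by move=> h x; rewrite -[x]reprK; apply: h. Qed.

Definition uea_add (x y : uea) : uea := uea_pi (uAdd (repr x) (repr y)).
Definition uea_mul (x y : uea) : uea := uea_pi (uMul (repr x) (repr y)).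
Definition uea_opp (x : uea) : uea := uea_pi (uMul (uScal L (-1)) (repr x)).
Definition uea_scale (c : K) (x : uea) : uea :=
  uea_pi (uMul (uScal L c) (repr x)).

Lemma uea_addE t u : uea_add (uea_pi t) (uea_pi u) = uea_pi (uAdd t u).
Proof. by apply/uea_piP/ueaEq_add; apply: uea_reprP. Qed.
Lemma uea_mulE t u : uea_mul (uea_pi t) (uea_pi u) = uea_pi (uMul t u).
Proof. by apply/uea_piP/ueaEq_mul; apply: uea_reprP. Qed.
Lemma uea_oppE t : uea_opp (uea_pi t) = uea_pi (uMul (uScal L (-1)) t).
Proof. by apply/uea_piP/ueaEq_mul; [apply: ueaEq_refl|apply: uea_reprP]. Qed.
Lemma uea_scaleE c t : uea_scale c (uea_pi t) = uea_pi (uMul (uScal L c) t).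
Proof. by apply/uea_piP/ueaEq_mul; [apply: ueaEq_refl|apply: uea_reprP]. Qed.

Fact uea_addA : associative uea_add.
Proof.
elim/uea_piW=> t; elim/uea_piW=> u; elim/uea_piW=> v.
by rewrite !uea_addE; apply/uea_piP/ueaEq_addA.
Qed.
Fact uea_addC : commutative uea_add.
Proof.
elim/uea_piW=> t; elim/uea_piW=> u.
by rewrite !uea_addE; apply/uea_piP/ueaEq_addC.
Qed.
Fact uea_add0 : left_id (uea_pi (uScal L 0)) uea_add.
Proof. by elim/uea_piW=> t; rewrite uea_addE; apply/uea_piP/ueaEq_add0. Qed.
Fact uea_addN : left_inverse (uea_pi (uScal L 0)) uea_opp uea_add.
Proof.
elim/uea_piW=> t; rewrite uea_oppE uea_addE; apply/uea_piP.
apply: ueaEq_trans (ueaEq_mul0 t).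
apply: (@ueaEq_trans _ (uMul (uAdd (uScal L (-1)) (uScal L 1)) t)).
  apply: ueaEq_sym; apply: ueaEq_trans (ueaEq_mulDl _ _ _) _.
  by apply: ueaEq_add; [apply: ueaEq_refl|apply: ueaEq_mul1].
apply: ueaEq_mul; last exact: ueaEq_refl.
by rewrite -(addNr (1 : K)); apply/ueaEq_sym/ueaEq_scalD.
Qed.

HB.instance Definition _ :=
  GRing.isZmodule.Build uea uea_addA uea_addC uea_add0 uea_addN.

Fact uea_mulA : associative uea_mul.
Proof.
elim/uea_piW=> t; elim/uea_piW=> u; elim/uea_piW=> v.
by rewrite !uea_mulE; apply/uea_piP/ueaEq_mulA.
Qed.
Fact uea_mul1l : left_id (uea_pi (uScal L 1)) uea_mul.
Proof. by elim/uea_piW=> t; rewrite uea_mulE; apply/uea_piP/ueaEq_mul1. Qed.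
Fact uea_mul1r : right_id (uea_pi (uScal L 1)) uea_mul.
Proof.
elim/uea_piW=> t; rewrite uea_mulE; apply/uea_piP.
exact: ueaEq_trans (ueaEq_sym (ueaEq_scalC _ _)) (ueaEq_mul1 _).
Qed.
Fact uea_mulDl : left_distributive uea_mul uea_add.
Proof.
elim/uea_piW=> t; elim/uea_piW=> u; elim/uea_piW=> v.
rewrite !(uea_mulE, uea_addE).
exact/uea_piP/ueaEq_mulDl.
Qed.
Fact uea_mulDr : right_distributive uea_mul uea_add.
Proof.
elim/uea_piW=> t; elim/uea_piW=> u; elim/uea_piW=> v.
rewrite !(uea_mulE, uea_addE).
exact/uea_piP/ueaEq_mulDr.
Qed.

HB.instance Definition _ := GRing.Zmodule_isPzRing.Build uea
  uea_mulA uea_mul1l uea_mul1r uea_mulDl uea_mulDr.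

Fixpoint ueaTerm_counit t : K :=
  match t with
  | uScal c => c
  | uGen _ => 0
  | uAdd t u => ueaTerm_counit t + ueaTerm_counit u
  | uMul t u => ueaTerm_counit t * ueaTerm_counit u
  end.

Lemma ueaTerm_counitP t u : ueaEq t u -> ueaTerm_counit t = ueaTerm_counit u.
Proof.
elim=> //= *; try congruence.
all: by rewrite ?(addrA, add0r, mul0r, mulr0, addr0, mul1r, mulrA, mulrDl,
  mulrDr) // (addrC, mulrC).
Qed.

Definition uea_counit (x : uea) : K := ueaTerm_counit (repr x).

Lemma uea_counitE t : uea_counit (uea_pi t) = ueaTerm_counit t.
Proof. exact/ueaTerm_counitP/uea_reprP. Qed.

Fact uea_counit_is_zmod : zmod_morphism uea_counit.
Proof.
elim/uea_piW=> t; elim/uea_piW=> u.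
rewrite {1}/GRing.opp /= uea_oppE {1}/GRing.add /= uea_addE !uea_counitE /=.
by rewrite mulN1r.
Qed.
HB.instance Definition _ :=
  GRing.isZmodMorphism.Build uea K uea_counit uea_counit_is_zmod.
Fact uea_counit_is_monoid : monoid_morphism uea_counit.
Proof.
split; first by rewrite uea_counitE.
elim/uea_piW=> t; elim/uea_piW=> u.
by rewrite {1}/GRing.mul /= uea_mulE !uea_counitE.
Qed.
HB.instance Definition _ :=
  GRing.isMonoidMorphism.Build uea K uea_counit uea_counit_is_monoid.

Fact uea_oner_neq0 : (1 : uea) != 0.
Proof.
apply/eqP => /(congr1 uea_counit) /eqP.
by rewrite rmorph1 rmorph0 oner_eq0.
Qed.
HB.instance Definition _ :=
  GRing.PzSemiRing_isNonZero.Build uea uea_oner_neq0.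

Fact uea_scaleA a b x : uea_scale a (uea_scale b x) = uea_scale (a * b) x.
Proof.
elim/uea_piW: x => t; rewrite !uea_scaleE; apply/uea_piP.
apply: ueaEq_trans (ueaEq_mulA _ _ _) _.
by apply: ueaEq_mul; [apply/ueaEq_sym/ueaEq_scalM|apply: ueaEq_refl].
Qed.
Fact uea_scale1 : left_id 1 uea_scale.
Proof. by elim/uea_piW=> t; rewrite uea_scaleE; apply/uea_piP/ueaEq_mul1. Qed.
Fact uea_scaleDr : right_distributive uea_scale uea_add.
Proof.
move=> c; elim/uea_piW=> t; elim/uea_piW=> u.
rewrite !(uea_scaleE, uea_addE).
exact/uea_piP/ueaEq_mulDr.
Qed.
Fact uea_scaleDl x : {morph uea_scale^~ x : a b / a + b >-> uea_add a b}.
Proof.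
move=> a b; elim/uea_piW: x => t.
rewrite !uea_scaleE uea_addE; apply/uea_piP.
apply: ueaEq_trans (ueaEq_mulDl _ _ _).
by apply: ueaEq_mul; [apply: ueaEq_scalD|apply: ueaEq_refl].
Qed.
HB.instance Definition _ := GRing.Zmodule_isLmodule.Build K uea
  uea_scaleA uea_scale1 uea_scaleDr uea_scaleDl.

Fact uea_scalerAl (a : K) (x y : uea) : a *: (x * y) = (a *: x) * y.
Proof.
elim/uea_piW: x => t; elim/uea_piW: y => u.
rewrite /GRing.scale /GRing.mul /= !(uea_mulE, uea_scaleE).
exact/uea_piP/ueaEq_mulA.
Qed.
HB.instance Definition _ := GRing.Lmodule_isLalgebra.Build K uea uea_scalerAl.
Fact uea_scalerAr (a : K) (x y : uea) : a *: (x * y) = x * (a *: y).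
Proof.
elim/uea_piW: x => t; elim/uea_piW: y => u.
rewrite /GRing.scale /GRing.mul /= !(uea_mulE, uea_scaleE); apply/uea_piP.
apply: ueaEq_trans (ueaEq_mulA _ _ _) _.
apply: ueaEq_trans (ueaEq_sym (ueaEq_mulA _ _ _)).
by apply: ueaEq_mul; [apply: ueaEq_scalC|apply: ueaEq_refl].
Qed.
HB.instance Definition _ := GRing.Lalgebra_isAlgebra.Build K uea uea_scalerAr.

Definition uea_in (x : L) : uea := uea_pi (uGen x).

End UEA.

(** * Extension of scalars: the tensor product over the integers *)

Section Tensor.
Variables (A : pzRingType) (K : comPzRingType).

(* A sequence of pairs (a, c) stands for the sum of the a (x) c. *)
Inductive tensEq : seq (A * K) -> seq (A * K) -> Prop :=
| tensEq_refl s : tensEq s s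
| tensEq_sym s t : tensEq s t -> tensEq t s
| tensEq_trans s t u : tensEq s t -> tensEq t u -> tensEq s u
| tensEq_cat s s' t t' : tensEq s s' -> tensEq t t' -> tensEq (s ++ t) (s' ++ t')
| tensEq_catC s t : tensEq (s ++ t) (t ++ s)
| tensEq_zero c : tensEq [:: (0, c)] [::]
| tensEq_addl a b c : tensEq [:: (a + b, c)] [:: (a, c); (b, c)]
| tensEq_addr a c d : tensEq [:: (a, c + d)] [:: (a, c); (a, d)].

Definition tensEqb s t : bool := `[< tensEq s t >].

Fact tensEqb_refl : reflexive tensEqb.
Proof. by move=> t; apply/asboolP/tensEq_refl. Qed.
Fact tensEqb_sym : symmetric tensEqb.
Proof. by move=> t u; apply/asboolP/asboolP; apply: tensEq_sym. Qed.
Fact tensEqb_trans : transitive tensEqb.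
Proof.
by move=> t u v /asboolP h1 /asboolP h2; apply/asboolP/(tensEq_trans h1 h2).
Qed.

Canonical tensEquiv := EquivRel tensEqb tensEqb_refl tensEqb_sym tensEqb_trans.

Definition tens := {eq_quot tensEquiv}.
HB.instance Definition _ := Choice.on tens.
HB.instance Definition _ := EqQuotient.on tens.

Definition tens_pi (s : seq (A * K)) : tens := \pi_tens s.

Lemma tens_piP s t : tens_pi s = tens_pi t <-> tensEq s t.
Proof.
split; first by move/eqmodP => /= /asboolP.
by move=> h; apply/eqmodP => /=; apply/asboolP.
Qed.

Lemma tens_reprP s : tensEq (repr (tens_pi s)) s.
Proof. by apply/tens_piP; rewrite /tens_pi reprK. Qed.

Lemma tens_piW (P : tens -> Prop) : (forall s, P (tens_pi s)) -> forall x, P x.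
Proof. by move=> h x; rewrite -[x]reprK; apply: h. Qed.

Definition tens_add (x y : tens) : tens := tens_pi (repr x ++ repr y).
Definition tens_opp (x : tens) : tens :=
  tens_pi [seq (- u.1, u.2) | u <- repr x].

Lemma tens_addE s t : tens_add (tens_pi s) (tens_pi t) = tens_pi (s ++ t).
Proof. by apply/tens_piP/tensEq_cat; apply: tens_reprP. Qed.

Fact tens_addA : associative tens_add.
Proof.
elim/tens_piW=> t; elim/tens_piW=> u; elim/tens_piW=> v.
by rewrite !tens_addE catA.
Qed.
Fact tens_addC : commutative tens_add.
Proof.
elim/tens_piW=> t; elim/tens_piW=> u.
by rewrite !tens_addE; apply/tens_piP/tensEq_catC.
Qed.
Fact tens_add0 : left_id (tens_pi [::]) tens_add.
Proof. by elim/tens_piW=> t; rewrite tens_addE. Qed.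
Fact tens_addN : left_inverse (tens_pi [::]) tens_opp tens_add.
Proof.
move=> x; rewrite -{2}[x]reprK -/(tens_pi _) /tens_opp tens_addE.
elim: (repr x) => [|[a c] s IHs] //=.
set s' := [seq _ | _ <- _] in IHs *.
rewrite -(tens_addE ((- a, c) :: s') ((a, c) :: s)).
rewrite -(tens_addE [:: (- a, c)] s') -(tens_addE [:: (a, c)] s).
rewrite -tens_addA (tens_addA (tens_pi s')) (tens_addC (tens_pi s')).
rewrite -(tens_addA (tens_pi [:: (a, c)])) (tens_addE s') IHs tens_addA !tens_addE /=.
apply/tens_piP/(tensEq_trans _ (tensEq_zero c)).
by rewrite -(addNr a); apply/tensEq_sym/tensEq_addl.
Qed.

HB.instance Definition _ :=
  GRing.isZmodule.Build tens tens_addA tens_addC tens_add0 tens_addN.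

Definition tensor (a : A) (c : K) : tens := tens_pi [:: (a, c)].

Lemma tens_piE s : tens_pi s = \sum_(u <- s) tensor u.1 u.2.
Proof.
elim: s => [|[a c] s IHs]; first by rewrite big_nil.
by rewrite big_cons -IHs {1}/GRing.add /= /tensor tens_addE.
Qed.

Lemma tensorDl a b c : tensor (a + b) c = tensor a c + tensor b c.
Proof.
rewrite {2}/GRing.add /= /tensor tens_addE.
exact/tens_piP/tensEq_addl.
Qed.
Lemma tensorDr a c d : tensor a (c + d) = tensor a c + tensor a d.
Proof.
rewrite {2}/GRing.add /= /tensor tens_addE.
exact/tens_piP/tensEq_addr.
Qed.

Lemma tens_ind (P : tens -> Prop) :
  P 0 -> (forall a c x, P x -> P (tensor a c + x)) -> forall x, P x.
Proof.
move=> P0 PD; elim/tens_piW=> s; rewrite tens_piE.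
by elim: s => [|u s IHs]; rewrite (big_nil, big_cons) //; apply: PD.
Qed.

Definition biadditive (V : zmodType) (f : A -> K -> V) : Prop :=
  (forall a b c, f (a + b) c = f a c + f b c) /\
  (forall a c d, f a (c + d) = f a c + f a d).

Definition tens_lift (V : zmodType) (f : A -> K -> V) (x : tens) : V :=
  \sum_(u <- repr x) f u.1 u.2.

Section Lift.
Variables (V : zmodType) (f : A -> K -> V).
Hypothesis f_bi : biadditive f.

Lemma tensEq_lift s t : tensEq s t ->
  \sum_(u <- s) f u.1 u.2 = \sum_(u <- t) f u.1 u.2.
Proof.
case: f_bi => fl fr; elim=> {s t} //.
- by move=> ? ? ? _ -> _ ->.
- by move=> s1 s2 t1 t2 _ h1 _ h2; rewrite !big_cat /= h1 h2.
- by move=> s1 s2; rewrite !big_cat /= addrC.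
- move=> c; rewrite big_seq1 big_nil /=.
  by apply: (addrI (f 0 c)); rewrite -fl !addr0.
- by move=> a b c; rewrite !(big_cons, big_nil) !addr0 /= fl.
- by move=> a c d; rewrite !(big_cons, big_nil) !addr0 /= fr.
Qed.
Lemma tens_liftE s : tens_lift f (tens_pi s) = \sum_(u <- s) f u.1 u.2.
Proof. exact/tensEq_lift/tens_reprP. Qed.
Lemma tens_lift_tensor a c : tens_lift f (tensor a c) = f a c.
Proof. by rewrite tens_liftE big_seq1. Qed.
Lemma tens_liftD : {morph tens_lift f : x y / x + y}.
Proof.
elim/tens_piW=> s; elim/tens_piW=> t.
by rewrite {1}/GRing.add /= tens_addE !tens_liftE big_cat.
Qed.
Lemma tens_lift0 : tens_lift f 0 = 0.
Proof. by apply: (addrI (tens_lift f 0)); rewrite -tens_liftD !addr0. Qed.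
End Lift.

Definition tens_mul (x y : tens) : tens :=
  tens_lift (fun a c => tens_lift (fun b d => tensor (a * b) (c * d)) y) x.

Definition tens_scale (e : K) : tens -> tens :=
  tens_lift (fun a c => tensor a (e * c)).

Fact tensor_mul_bi a c : biadditive (fun b d => tensor (a * b) (c * d)).
Proof. by split=> *; rewrite mulrDr (tensorDl, tensorDr). Qed.
#[local] Hint Resolve tensor_mul_bi : core.
Fact tens_mul_bi y :
  biadditive (fun a c => tens_lift (fun b d => tensor (a * b) (c * d)) y).
Proof.
by split=> a b c; elim/tens_ind: y => [|a' c' y IHy];
  rewrite ?tens_lift0 ?addr0 // !tens_liftD // IHy !tens_lift_tensor //
    mulrDl (tensorDl, tensorDr) addrACA.
Qed.
#[local] Hint Resolve tens_mul_bi : core.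
Fact tensor_scale_bi e : biadditive (fun a c => tensor a (e * c)).
Proof. by split=> *; rewrite ?mulrDr (tensorDl, tensorDr). Qed.
#[local] Hint Resolve tensor_scale_bi : core.

Lemma tens_mulE a b c d :
  tens_mul (tensor a c) (tensor b d) = tensor (a * b) (c * d).
Proof. by rewrite /tens_mul tens_lift_tensor // tens_lift_tensor. Qed.
Lemma tens_scaleE e a c : tens_scale e (tensor a c) = tensor a (e * c).
Proof. by rewrite /tens_scale tens_lift_tensor. Qed.

Fact tens_mulDl : left_distributive tens_mul +%R.
Proof. by move=> x y z; rewrite /tens_mul tens_liftD. Qed.
Fact tens_mulDr : right_distributive tens_mul +%R.
Proof.
move=> x y z; elim/tens_ind: x => [|a c x IHx].
  by rewrite /tens_mul !tens_lift0 // addr0.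
rewrite !tens_mulDl IHx addrACA; congr (_ + _).
by rewrite /tens_mul !tens_lift_tensor // tens_liftD.
Qed.
Fact tens_mul0l x : tens_mul 0 x = 0.
Proof. by apply: (addrI (tens_mul 0 x)); rewrite -tens_mulDl !addr0. Qed.
Fact tens_mul0r x : tens_mul x 0 = 0.
Proof. by apply: (addrI (tens_mul x 0)); rewrite -tens_mulDr !addr0. Qed.
Fact tens_mulA : associative tens_mul.
Proof.
move=> x y z; elim/tens_ind: x => [|a c x IHx]; first by rewrite !tens_mul0l.
rewrite !tens_mulDl IHx; congr (_ + _).
elim/tens_ind: y {IHx} => [|b d y IHy]; first by rewrite tens_mul0r !tens_mul0l tens_mul0r.
rewrite tens_mulDl !tens_mulDr tens_mulDl IHy; congr (_ + _).
elim/tens_ind: z {IHy} => [|b' d' z IHz]; first by rewrite !tens_mul0r.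
by rewrite !tens_mulDr IHz !tens_mulE !mulrA.
Qed.
Fact tens_mul1l : left_id (tensor 1 1) tens_mul.
Proof.
elim/tens_ind => [|a c x IHx]; first exact: tens_mul0r.
by rewrite tens_mulDr IHx tens_mulE !mul1r.
Qed.
Fact tens_mul1r : right_id (tensor 1 1) tens_mul.
Proof.
elim/tens_ind => [|a c x IHx]; first exact: tens_mul0l.
by rewrite tens_mulDl IHx tens_mulE !mulr1.
Qed.

HB.instance Definition _ := GRing.Zmodule_isPzRing.Build tens
  tens_mulA tens_mul1l tens_mul1r tens_mulDl tens_mulDr.

Fact tens_scaleDr : right_distributive tens_scale +%R.
Proof. by move=> e x y; rewrite /tens_scale tens_liftD. Qed.
Fact tens_scale0 e : tens_scale e 0 = 0.
Proof. exact: tens_lift0. Qed.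
Fact tens_scaleA a b x : tens_scale a (tens_scale b x) = tens_scale (a * b) x.
Proof.
elim/tens_ind: x => [|a' c x IHx]; first by rewrite !tens_scale0.
by rewrite !tens_scaleDr IHx !tens_scaleE mulrA.
Qed.
Fact tens_scale1 : left_id 1 tens_scale.
Proof.
elim/tens_ind => [|a' c x IHx]; first by rewrite !tens_scale0.
by rewrite !tens_scaleDr IHx !tens_scaleE mul1r.
Qed.
Fact tens_scaleDl x : {morph tens_scale^~ x : a b / a + b}.
Proof.
move=> a b; elim/tens_ind: x => [|a' c x IHx]; first by rewrite !tens_scale0 addr0.
by rewrite !tens_scaleDr IHx !tens_scaleE mulrDl tensorDr addrACA.
Qed.
HB.instance Definition _ := GRing.Zmodule_isLmodule.Build K tens
  tens_scaleA tens_scale1 tens_scaleDr tens_scaleDl.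

Lemma tens_scalerAl (e : K) (x y : tens) : e *: (x * y) = (e *: x) * y.
Proof.
elim/tens_ind: x => [|a c x IHx]; first by rewrite !(mul0r, scaler0).
rewrite mulrDl !scalerDr mulrDl IHx; congr (_ + _).
elim/tens_ind: y {IHx} => [|b d y IHy]; first by rewrite !(mulr0, scaler0).
rewrite !mulrDr !scalerDr IHy; congr (_ + _).
by rewrite /GRing.scale /GRing.mul /= !(tens_mulE, tens_scaleE) mulrA.
Qed.
Lemma tens_scalerAr (e : K) (x y : tens) : e *: (x * y) = x * (e *: y).
Proof.
elim/tens_ind: x => [|a c x IHx]; first by rewrite !(mul0r, scaler0).
rewrite !mulrDl scalerDr IHx; congr (_ + _).
elim/tens_ind: y {IHx} => [|b d y IHy]; first by rewrite !(mulr0, scaler0).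
rewrite mulrDr !scalerDr mulrDr IHy; congr (_ + _).
by rewrite /GRing.scale /GRing.mul /= !(tens_mulE, tens_scaleE) mulrCA.
Qed.

End Tensor.

(** * The hyperalgebra of SL_2 *)

Section Sl2.
Variable R : realType.
Local Notation C := (R[i]).

Definition traceless : {pred 'M[C]_2} := fun M => \tr M == 0.

Fact traceless_submod : subsemimod_closed traceless.
Proof.
split; [split|]; rewrite /traceless ?unfold_in ?raddf0 //=.
  by move=> M N; rewrite !unfold_in raddfD /= => /eqP-> /eqP->; rewrite addr0.
by move=> c M; rewrite !unfold_in linearZ /= => /eqP->; rewrite mulr0.
Qed.
HB.instance Definition _ :=
  GRing.isSubmodClosed.Build C 'M[C]_2 traceless traceless_submod.

Record sl2 := Sl2 { sl2_mx :> 'M[C]_2; sl2_mxP : sl2_mx \in traceless }.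
HB.instance Definition _ := [isSub for sl2_mx].
HB.instance Definition _ := [Choice of sl2 by <:].
HB.instance Definition _ := [SubChoice_isSubLmodule of sl2 by <:].

Fact sl2_bracketP (x y : sl2) :
  sl2_mx x *m sl2_mx y - sl2_mx y *m sl2_mx x \in traceless.
Proof. by rewrite unfold_in raddfB /= mxtrace_mulC subrr. Qed.
Definition sl2_bracket (x y : sl2) : sl2 := Sl2 (sl2_bracketP x y).

Fact sl2_XP : delta_mx 0 1 \in traceless.
Proof. by rewrite unfold_in /mxtrace !big_ord_recr big_ord0 /= !mxE /= !addr0. Qed.
Fact sl2_YP : delta_mx 1 0 \in traceless.
Proof. by rewrite unfold_in /mxtrace !big_ord_recr big_ord0 /= !mxE /= !addr0. Qed.
Fact sl2_HP : delta_mx 0 0 - delta_mx 1 1 \in traceless.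
Proof.
rewrite unfold_in /mxtrace !big_ord_recr big_ord0 /= !mxE /=.
by rewrite subr0 !add0r subrr.
Qed.

Definition Usl2 := uea sl2_bracket.
HB.instance Definition _ := GRing.Algebra.on Usl2.

Definition Ux : Usl2 := uea_in sl2_bracket (Sl2 sl2_XP).
Definition Uy : Usl2 := uea_in sl2_bracket (Sl2 sl2_YP).
Definition Uh : Usl2 := uea_in sl2_bracket (Sl2 sl2_HP).

Definition divpow (x : Usl2) (m : nat) : Usl2 := (m`!%:R : C)^-1 *: x ^+ m.
Definition ubinom (x : Usl2) (m : nat) : Usl2 :=
  (m`!%:R : C)^-1 *: \prod_(i < m) (x - i%:R).

Definition UZset : set Usl2 :=
  smallest (fun S : set Usl2 => subring_closed (mem S))
    [set x | exists m, x = divpow Ux m \/ x = divpow Uy m].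
Definition UZpred : {pred Usl2} := mem UZset.

Fact UZpred_subring : subring_closed UZpred.
Proof.
split=> [|x y|x y]; rewrite /UZpred !inE.
- by move=> S [[S1 _ _] _]; have := S1; rewrite inE.
- move=> hx hy S hS; have [[_ SB _] _] := hS.
  by have := SB x y; rewrite !inE; apply; [apply: hx|apply: hy].
- move=> hx hy S hS; have [[_ _ SM] _] := hS.
  by have := SM x y; rewrite !inE; apply; [apply: hx|apply: hy].
Qed.
HB.instance Definition _ :=
  GRing.isSubringClosed.Build Usl2 UZpred UZpred_subring.

Record UZ := MkUZ { UZval :> Usl2; UZvalP : UZval \in UZpred }.
HB.instance Definition _ := [isSub for UZval].
HB.instance Definition _ := [Choice of UZ by <:].
HB.instance Definition _ := [SubChoice_isSubNzRing of UZ by <:].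

Lemma UZ_counit_int (x : UZ) : exists z : int, uea_counit (UZval x) = z%:~R.
Proof.
case: x => x /=; rewrite /UZpred inE => hx.
pose S : set Usl2 := [set x | exists z : int, uea_counit x = z%:~R].
apply: (hx S); split.
  split; first by rewrite inE; exists 1; rewrite rmorph1.
    move=> u v; rewrite !inE => -[a ha] [b hb]; exists (a - b).
    by rewrite rmorphB /= ha hb rmorphB.
  move=> u v; rewrite !inE => -[a ha] [b hb]; exists (a * b).
  by rewrite rmorphM /= ha hb rmorphM.
move=> u [[|m] hu].
  have -> : u = 1 by case: hu => ->; rewrite /divpow fact0 invr1 scale1r.
  by exists 1; rewrite rmorph1.
exists 0; rewrite /divpow in hu.
have [y [hy ->]] : exists y : Usl2, uea_counit y = 0 /\
    u = (m.+1`!%:R : C)^-1 *: y ^+ m.+1.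
  by case: hu => ->; [exists Ux|exists Uy]; split=> //; rewrite uea_counitE.
by rewrite -mulr_algl rmorphM rmorphXn /= hy expr0n mulr0.
Qed.

Variable k : closedFieldType.

Definition hyper := tens UZ k.
HB.instance Definition _ := GRing.PzRing.on hyper.
HB.instance Definition _ := GRing.Lmodule.on hyper.

Fact hyper_oner_neq0 : (1 : hyper) != 0.
Proof.
pose z (x : UZ) : int := sval (cid (UZ_counit_int x)).
have zE x : uea_counit (UZval x) = (z x)%:~R by rewrite /z; case: cid.
have z1 : z 1 = 1.
  by apply: (@intr_inj C); rewrite -zE /= rmorph1.
have zD x y : z (x + y) = z x + z y.
  by apply: (@intr_inj C); rewrite rmorphD /= -!zE /= rmorphD.
pose f (x : UZ) (c : k) : k := (z x)%:~R * c.
have fb : biadditive f.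
  by split=> [x y c|x c d]; rewrite /f ?zD ?intrD (mulrDl, mulrDr).
apply/eqP => /(congr1 (tens_lift f)) /eqP; rewrite tens_lift0 //.
by rewrite /GRing.one /= tens_lift_tensor // /f z1 mulr1 oner_eq0.
Qed.
HB.instance Definition _ :=
  GRing.PzSemiRing_isNonZero.Build hyper hyper_oner_neq0.
HB.instance Definition _ :=
  GRing.Lmodule_isLalgebra.Build k hyper (@tens_scalerAl _ k).
HB.instance Definition _ :=
  GRing.Lalgebra_isAlgebra.Build k hyper (@tens_scalerAr _ k).

(* The image in the hyperalgebra of an element of UZ. The value 0 outside UZ
   is never relevant: all the elements to which [img] is applied below, in
   particular the binomials in H, do lie in UZ. *)
Definition img (x : Usl2) : hyper := tensor (insubd (0 : UZ) x) (1 : k).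

Definition hX (m : nat) : hyper := img (divpow Ux m).
Definition hY (m : nat) : hyper := img (divpow Uy m).
Definition hbinom (c : int) (m : nat) : hyper := img (ubinom (Uh + c%:~R) m).

Variable p : nat.

Definition Urset (r : nat) : set hyper :=
  smallest (fun S : set hyper => subalg_closed (mem S))
    [set x | exists2 n : nat, (n < p ^ r)%N & x = hX n \/ x = hY n].
Definition Urpred (r : nat) : {pred hyper} := mem (Urset r).

Fact Urpred_subalg r : GRing.subsemialg_closed (Urpred r).
Proof.
apply: GRing.subalg_closed_semi; split=> [|c x y|x y]; rewrite /Urpred !inE.
- by move=> S [[S1 _ _] _]; have := S1; rewrite inE.
- move=> hx hy S hS; have [[_ SL _] _] := hS.
  by have := SL c x y; rewrite !inE; apply; [apply: hx|apply: hy].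
- move=> hx hy S hS; have [[_ _ SM] _] := hS.
  by have := SM x y; rewrite !inE; apply; [apply: hx|apply: hy].
Qed.
HB.instance Definition _ r :=
  GRing.isSubalgClosed.Build k hyper (Urpred r) (Urpred_subalg r).

Record Ur (r : nat) := MkUr { Urval :> hyper; UrvalP : Urval \in Urpred r }.
HB.instance Definition _ r := [isSub for @Urval r].
HB.instance Definition _ r := [Choice of Ur r by <:].
HB.instance Definition _ r := [SubChoice_isSubAlgebra of Ur r by <:].

(** * The elements B *)

Definition mu (a : int) : hyper := hbinom (- a - 1) p.-1.

(* Elements of F_p are mapped to k through their representatives in
   0, ..., p - 1; this is the inclusion of F_p in k when k has
   characteristic p. *)
Definition Fp_to (c : 'F_p) : k := (c : nat)%:R.

Definition psi (e : 'F_2) (s : nat) : {poly 'F_p} :=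
  let sq (i : nat) : {poly 'F_p} := ((i ^ 2)%:R)%:P in
  let q : {poly 'F_p} :=
    \prod_(1 <= i < (p.-1./2).+1 | i != s) ('X - sq i) ^+ 2 in
  if s == 0%N then q
  else if e == 0 then 2%:R * 'X * ('X + sq s) * q
  else 'X * ('X - sq s) * q.

(* A pair (a, j) with a integral and j integral or half-integral. *)
Definition PZ : set (int * rat) :=
  if p == 2%N then
    [set aj | exists i : int, [\/ aj = (2 * i, 1 / 2), aj = (1 + 2 * i, 0)
                                | aj = (1 + 2 * i, 1)]]
  else [set aj | exists2 s : nat, (s <= p.-1./2)%N & aj.2 = s%:R].

Definition Pset : set (int * rat) :=
  [set aj | PZ aj /\ 0 <= aj.1 <= p%:Z - 1].

Definition B1 (e : 'F_2) (aj : int * rat) : hyper :=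
  let: (a, j) := aj in
  if p == 2%N then
    if (2 %| a)%Z then (if e == 0 then mu 0 else mu 0 * hY 1 * hX 1)
    else (if j == 0 then mu 1 * hY 1 * hX 1 else mu 1 * hY 1 * hX 1 + mu 1)
  else
    horner_alg (mu a * hY 1 * hX 1 + (((a + 1)%:~R / 2%:R) ^+ 2)%:A)
      (map_poly Fp_to (psi e (Num.truncn j))) * mu a.

Definition hat (a : int) : nat := `|(a %% p%:Z)%Z|%N.

(* When p = 2 the conditions are conventional: (2i, 1/2), (1 + 2i, 0) and
   (1 + 2i, 1) satisfy B, C and D respectively. *)
Definition condA (aj : int * rat) : bool :=
  let: (a, j) := aj in let h : rat := (hat a)%:R in
  [&& p != 2%N, ~~ odd (hat a) &
      (p%:R - h + 1) / 2%:R <= j <= (p%:R - 1) / 2%:R].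
Definition condB (aj : int * rat) : bool :=
  let: (a, j) := aj in let h : rat := (hat a)%:R in
  if p == 2%N then ~~ odd (hat a)
  else ~~ odd (hat a) && (0 <= j <= (p%:R - h - 1) / 2%:R).
Definition condC (aj : int * rat) : bool :=
  let: (a, j) := aj in let h : rat := (hat a)%:R in
  if p == 2%N then odd (hat a) && (j == 0)
  else odd (hat a) && (0 <= j <= (h - 1) / 2%:R).
Definition condD (aj : int * rat) : bool :=
  let: (a, j) := aj in let h : rat := (hat a)%:R in
  if p == 2%N then odd (hat a) && (j == 1)
  else odd (hat a) && ((h + 1) / 2%:R <= j <= (p%:R - 1) / 2%:R).

Definition nrat (e : 'F_2) (aj : int * rat) : rat :=
  let: (a, j) := aj in let h : rat := (hat a)%:R in let q : rat := p%:R in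
  if condA aj then
    if e == 0 then (q - h - 1) / 2%:R + j else (3%:R * q - h - 1) / 2%:R - j
  else if condB aj then
    if e == 0 then (q - h - 1) / 2%:R - j else (q - h - 1) / 2%:R + j
  else if condC aj then
    if e == 0 then (2%:R * q - h - 1) / 2%:R - j
    else (2%:R * q - h - 1) / 2%:R + j
  else if condD aj then
    if e == 0 then j - (h + 1) / 2%:R else (2%:R * q - h - 1) / 2%:R - j
  else 0.
(* [nrat] is a natural number on PZ. *)
Definition nB (e : 'F_2) (aj : int * rat) : nat := Num.truncn (nrat e aj).

(* The coefficients c_m, nB <= m <= p - 1, of the expansion of B1; they exist
   and are unique on PZ, and those with m < nB are never used. *)
Definition coefB (e : 'F_2) (aj : int * rat) : {ffun 'I_p -> 'F_p} :=
  xget [ffun=> 0]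
    [set c : {ffun 'I_p -> 'F_p} | B1 e aj = mu aj.1 *
       \sum_(m < p | (nB e aj <= m)%N) Fp_to (c m) *: (hY 1 ^+ m * hX 1 ^+ m)].

(* The unique k-linear map with these values on the k-basis
   Y^(m) binom(H, n) X^(m') of the hyperalgebra. *)
Definition Fr' : hyper -> hyper :=
  xget (fun=> 0)
    [set f : hyper -> hyper | linear f /\
       forall m n m' : nat, f (hY m * hbinom 0 n * hX m') =
         hY (m * p) * hbinom 0 (n * p) * hX (m' * p)].

Definition sB (aj : int * rat) : nat :=
  if p == 2%N then 1%N
  else if odd (hat aj.1) then ((p - hat aj.1)./2)%N
  else ((p - hat aj.1 + 1)./2)%N.

Definition Zmap (e : 'F_2) (z : hyper) (aj : int * rat) : hyper :=
  if condA aj || condC aj then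
    mu aj.1 * \sum_(m < p | (nB e aj <= m)%N)
      Fp_to (coefB e aj m) *:
        (hY 1 ^+ m * hX 1 ^+ (m - sB aj) * Fr' z * hX 1 ^+ sB aj)
  else Fr' z * B1 e aj.

(* The list of the (eps_i, (a_i, j_i)), i < r; the value at [::] is a dummy. *)
Fixpoint Bmulti (t : seq ('F_2 * (int * rat))) : hyper :=
  match t with
  | [::] => 1
  | [:: (e, aj)] => B1 e aj
  | (e, aj) :: t' => Zmap e (Bmulti t') aj
  end.

Definition Beps (r : nat) (eps : r.-tuple 'F_2) (aj : r.-tuple (int * rat)) :=
  Bmulti (zip eps aj).

End Sl2.

(** * Socles *)

Section Socle.
Variables (A : pzRingType) (V : lmodType A).

Definition submodule (M : set V) : Prop := submod_closed (mem M).

Definition simple_submodule (M : set V) : Prop :=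
  [/\ submodule M, M <> [set 0] &
      forall N, submodule N -> N `<=` M -> N = [set 0] \/ N = M].

Definition sum_submodules (I : Type) (D : set I) (F : I -> set V) : set V :=
  [set x | exists n (v : 'I_n -> V),
     (forall i, exists2 d, D d & F d (v i)) /\ x = \sum_i v i].

Definition semisimple (M : set V) : Prop :=
  submodule M /\
  M = sum_submodules [set N | simple_submodule N /\ N `<=` M] id.

Definition is_socle (S : set V) : Prop :=
  semisimple S /\ forall M, semisimple M -> M `<=` S.

End Socle.

(* Main.v *)
From HB Require Import structures.
Require Import Defs.
From mathcomp Require Import all_boot all_order all_algebra.
From mathcomp Require Import boolp classical_sets reals complex.
From mathcomp Require Import ring lra zify.

Set Implicit Arguments.
Unset Strict Implicit.
Unset Printing Implicit Defensive.

Import Order.TTheory GRing.Theory Num.Theory.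
Local Open Scope classical_set_scope.
Local Open Scope ring_scope.

(** By Kostant's theorem the elements Y^(m) binom(H, n) X^(n') span the
    hyperalgebra, and an action of the enveloping algebra on functions
    (m, n, a) |-> F(m, n, a), which models the left regular representation,
    shows that they are independent. Every function phi of the weight that is
    periodic modulo a power of p defines an element phi(H), and only the values
    of phi matter.

    Put q = p^r and N = q - 1. A simple left ideal of U_r contains a lowest
    weight vector, of weight - lam say. Being killed by all the Y^(i), it is
    Y^(N) mu y with mu a weight idempotent and y a combination of the X^(m).
    Simplicity forces X^(n) to kill it whenever p divides binom(lam, n), and
    this leaves exactly the combinations of the vectors
    f(lam, l) = Y^(N) mu X^(N - l) with p not dividing binom(lam, l).
    Conversely each of these generates a simple left ideal. Hence the socle is
    the sum of the left ideals generated by the elements X^(l) f(lam, l).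

    It remains to see that the B^(1) are, up to nonzero scalars, these elements.
    For r = 1 the Casimir element factors X^(l) f(lam, l) into linear factors,
    namely all the x - i^2 (i in F_p) but one, which is the polynomial
    psi^(1)_j. For the induction, the element e at level 1 commutes with all
    X^(cp) and Y^(bp), and e Fr'(.) respects products when the weight
    2(l + s) - lam on the right of e lies in {0, ..., p - 1} (by Lucas); so
    Z^(1) glues the digits l, lam to the next ones. *)

(** * Binomial coefficients modulo p *)

(** The elements X^(l) f(lam, l) are preferred to the f(lam, l) because they have the same weight 2l
    - lam on both sides: at level one they are therefore a weight idempotent times a polynomial in
    YX, the shape of B^(1). They generate the same left ideals because Y^(l) X^(l) f(lam, l) =
    binom(lam, l) f(lam, l). The obstacle in the induction is that Fr' is not multiplicative. On
    functions of the weight it replaces phi(z) by phi(floor(z / p)), and the floor is not additive;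
    moreover, straightening X^(cp) Y^(bp) creates terms with Y^(bp - j), p not dividing j, which
    have no counterpart in Fr'(X^(c) Y^(b)). The element e has to kill them. This is what the shift
    s(a, j) in the cases (A) and (C) is for: it moves the right weight of e into 0, ..., p - 1,
    where Lucas' theorem makes these terms vanish. Both Fr' and the coefficients c_m are given as
    choices of objects with prescribed properties, so their existence and uniqueness have to be
    proved along the way. *)

Definition binz (z : int) (n : nat) : int :=
  match z with
  | Posz m => 'C(m, n)%:Z
  | Negz m => (-1) ^+ n * 'C(m + n, n)%:Z
  end.

Lemma binz0 z : binz z 0 = 1.
Proof. by case: z => m; rewrite /binz bin0. Qed.

Lemma binz_nat (m n : nat) : binz m%:Z n = 'C(m, n)%:Z.
Proof. by []. Qed.

Lemma binzS z n : binz (z + 1) n.+1 = binz z n.+1 + binz z n.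
Proof.
case: z => [m|[|m]]; first by rewrite -PoszD addn1 /= binS PoszD.
  by rewrite /= !add0n !binn exprS !mulr1 mulN1r addNr.
have -> : Negz m.+1 + 1 = Negz m by rewrite !NegzE; lia.
rewrite /= exprS addSn binS -addSnnS PoszD; ring.
Qed.

Lemma int_ind1 (P : int -> Prop) :
  P 0 -> (forall z, P z -> P (z + 1)) -> (forall z, P (z + 1) -> P z) ->
  forall z, P z.
Proof.
move=> P0 PS PP; elim/int_ind => // n IHn.
  by rewrite -addn1 PoszD; apply: PS.
apply: PP; suff -> : - n.+1%:Z + 1 = - n%:Z by [].
by rewrite -addn1 PoszD opprD addrK.
Qed.

(** This recursion identifies [binz] with the polynomial z(z - 1)...(z - n + 1)/n!, while the
    encoding by upper negation keeps it integral by construction. Pascal's rule carries it from z to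
    z + 1. In the other direction the rule only gives level n + 1 at z in terms of level n at z,
    hence the inner induction on n. *)
Lemma binz_mul z n : n.+1%:Z * binz z n.+1 = (z - n%:Z) * binz z n.
Proof.
elim/int_ind1: z n => [n|z IHz n|z IHz].
- by case: n => [|n]; rewrite ?bin0n ?mulr0 // bin0n mulr0 subrr mul0r.
- case: n => [|n].
    by have := IHz 0%N; rewrite binzS !binz0; lia.
  have h1 := IHz n.+1; have h2 := IHz n; rewrite !binzS; move: h1 h2.
  rewrite -[in n.+2%:Z]addn2 -![in n.+1%:Z]addn1 !PoszD.
  set a := binz z n.+2; set b := binz z n.+1; set c := binz z n => h1 h2.
  have -> : (n%:Z + 2%:Z) * (a + b) = (n%:Z + 2%:Z) * a + b + (n%:Z + 1) * b.
    ring.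
  by rewrite h1 h2; ring.
- elim=> [|n IHn].
    by have := IHz 0%N; rewrite binzS !binz0; lia.
  have := IHz n.+1; rewrite !binzS; move: IHn.
  rewrite -[in n.+2%:Z]addn2 -![in n.+1%:Z]addn1 !PoszD.
  set a := binz z n.+2; set b := binz z n.+1; set c := binz z n => h1 h2.
  have -> : (n%:Z + 2%:Z) * a = (n%:Z + 2%:Z) * (a + b) - b - (n%:Z + 1) * b.
    ring.
  by rewrite h1 h2; ring.
Qed.

Lemma binz_addn z (w n : nat) :
  binz (z + w%:Z) n = \sum_(j < n.+1) 'C(w, j)%:Z * binz z (n - j).
Proof.
elim: w n => [|w IHw] n.
  rewrite addr0 big_ord_recl /= bin0 mul1r subn0 big1 ?addr0 // => i _.
  by rewrite /bump /= bin0n mul0r.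
rewrite -addn1 PoszD addrA; case: n => [|n].
  by rewrite big_ord_recl big_ord0 addr0 !binz0 bin0 mul1r.
rewrite binzS !IHw [in RHS]big_ord_recl /= !bin0 mul1r.
rewrite big_ord_recl /= bin0 mul1r -addrA; congr (_ + _).
rewrite -big_split /=; apply: eq_bigr => i _.
by rewrite /bump /= !add1n subSS addn1 binS PoszD; ring.
Qed.

Lemma binz_opp (l s : nat) : binz (s%:Z - l%:Z - 1) s = (-1) ^+ s * 'C(l, s)%:Z.
Proof.
have [sl|ls] := leqP s l.
  have -> : s%:Z - l%:Z - 1 = Negz (l - s) by rewrite NegzE; lia.
  by rewrite /= subnK.
have -> : s%:Z - l%:Z - 1 = (s - l - 1)%N%:Z by lia.
by rewrite /= !bin_small ?mulr0 //; lia.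
Qed.

Lemma binzN (z : int) (i : nat) : binz (- z) i = (-1) ^+ i * binz (z + i%:Z - 1) i.
Proof.
case: z => [[|m]|m].
- rewrite oppr0 add0r; case: i => [|i]; first by rewrite !binz0 expr0 mulr1.
  have -> : i.+1%:Z - 1 = i%:Z by lia.
  by rewrite !binz_nat bin0n bin_small // mulr0.
- have -> : - m.+1%:Z = Negz m by rewrite NegzE.
  have -> : m.+1%:Z + i%:Z - 1 = (m + i)%N%:Z by lia.
  by [].
- have -> : Negz m + i%:Z - 1 = i%:Z - m.+1%:Z - 1 by rewrite NegzE; lia.
  by rewrite binz_opp mulrA -expr2 sqrr_sign mul1r NegzE opprK.
Qed.

Lemma bin_mul (k : nzRingType) (lam s n : nat) : (s <= n)%N ->
  'C(lam, s)%:R * 'C(lam - s, n - s)%:R = 'C(lam, n)%:R * 'C(n, s)%:R :> k.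
Proof.
move=> sn; rewrite -!natrM; congr (_%:R).
have [nl|ln] := leqP n lam.
  apply/eqP; rewrite -(eqn_pmul2r (fact_gt0 s)) -(eqn_pmul2r (fact_gt0 (n - s))).
  rewrite -(eqn_pmul2r (fact_gt0 (lam - n))); apply/eqP.
  have sl := leq_trans sn nl.
  have h1 := bin_fact sl; have h2 := bin_fact (leq_sub2r s nl).
  have h3 := bin_fact nl; have h4 := bin_fact sn.
  rewrite subnBA // subnK // in h2.
  transitivity lam`!%N; last by rewrite -h3 -h4; ring.
  by rewrite -h1 -h2; ring.
rewrite (@bin_small _ n) // mul0n.
have [sl|ls] := leqP s lam; last by rewrite bin_small.
by rewrite (@bin_small (lam - s)) ?muln0 //; lia.
Qed.

Lemma bin_sub_zero (k : fieldType) (lam s n : nat) : (s <= n)%N -> 'C(lam, n)%:R = 0 :> k ->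
  'C(lam, s)%:R != 0 :> k -> 'C(lam - s, n - s)%:R = 0 :> k.
Proof.
move=> sn h0 h1; apply/eqP; have /eqP := bin_mul k lam sn.
by rewrite h0 mul0r mulf_eq0 (negPf h1).
Qed.

Section CharP.
Variables (k : fieldType) (p : nat).
Hypothesis hp : p \in [pchar k].

Definition bk (z : int) (n : nat) : k := (binz z n)%:~R.

Let p_pr : prime p. Proof. exact: pcharf_prime hp. Qed.
Let p_gt0 : (0 < p)%N. Proof. exact: prime_gt0 p_pr. Qed.

Lemma bk0 z : bk z 0 = 1. Proof. by rewrite /bk binz0. Qed.

Lemma bk_nat (m n : nat) : bk m%:Z n = 'C(m, n)%:R. Proof. by []. Qed.

Lemma pchar_natE (m : nat) : (m%:R == 0 :> k) = (p %| m)%N.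
Proof. by rewrite (dvdn_pcharf hp). Qed.

Lemma natr_small_neq0 (m : nat) : (0 < m < p)%N -> m%:R != 0 :> k.
Proof. by case/andP=> m0 mp; rewrite pchar_natE gtnNdvd. Qed.

Lemma fact_small_neq0 (m : nat) : (m < p)%N -> m`!%:R != 0 :> k.
Proof.
elim: m => [|m IHm] mp; first by rewrite fact0 oner_eq0.
rewrite factS natrM mulf_neq0 //; first exact: natr_small_neq0.
by apply: IHm; apply: ltnW.
Qed.

(** Vandermonde's convolution with p, where the inner binomials of p vanish in k; in generating
    functions, (1 + t)^p = 1 + t^p. *)
Lemma bkD_p z n : bk (z + p%:Z) n = bk z n + (if (p <= n)%N then bk z (n - p) else 0).
Proof.
rewrite /bk binz_addn.
rewrite rmorph_sum /= big_ord_recl /= bin0 mul1r subn0; congr (_ + _).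
have z0 (j : nat) : (0 < j < p)%N -> 'C(p, j)%:R = 0 :> k.
  by move=> jp; apply/eqP; rewrite pchar_natE prime_dvd_bin.
case: leqP => pn.
  have pn' : (p.-1 < n)%N by rewrite prednK.
  rewrite (bigD1 (Ordinal pn')) //= /bump /= add1n prednK // binn mul1r.
  rewrite big1 ?addr0 // => i ni.
  rewrite intrM /bump /= add1n.
  have [ip|pi] := ltnP i.+1 p; first by rewrite [X in X * _](z0 i.+1) ?mul0r.
  have ip : (p < i.+1)%N.
    rewrite ltn_neqAle pi andbT; apply: contra ni => /eqP e.
    by apply/eqP/val_inj; rewrite /= e.
  by rewrite bin_small // mul0r.
rewrite big1 // => i _; rewrite intrM /bump /= add1n.
rewrite [X in X * _](z0 i.+1) ?mul0r //=.
by apply: leq_ltn_trans pn; rewrite ltn_ord.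
Qed.

(** Lucas' theorem for an upper argument of any sign. By [bkD_p], adding p to the upper argument on
    the left follows the same rule as Pascal's for adding 1 to z' on the right, so induction on z'
    works in both directions. *)
Lemma lucas (z' : int) (z0 i0 i' : nat) : (z0 < p)%N -> (i0 < p)%N ->
  bk (z0%:Z + z' * p%:Z) (i0 + i' * p) = bk z0%:Z i0 * bk z' i'.
Proof.
move=> z0p i0p.
have stepF z i : bk (z0%:Z + (z + 1) * p%:Z) (i0 + i.+1 * p) =
   bk (z0%:Z + z * p%:Z) (i0 + i.+1 * p) + bk (z0%:Z + z * p%:Z) (i0 + i * p).
  rewrite mulrDl mul1r addrA bkD_p ifT; last by rewrite mulSn addnCA leq_addr.
  by congr (_ + bk _ _); rewrite mulSn addnCA addKn.
have stepG z i : bk (z + 1) i.+1 = bk z i.+1 + bk z i.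
  by rewrite /bk binzS rmorphD.
have step0 z : bk (z0%:Z + (z + 1) * p%:Z) i0 = bk (z0%:Z + z * p%:Z) i0.
  by rewrite mulrDl mul1r addrA bkD_p ifF ?addr0 // leqNgt i0p.
elim/int_ind1: z' i' => [i'|z IHz [|i']|z IHz].
- rewrite mul0r addr0 !bk_nat; case: i' => [|i'].
    by rewrite mul0n addn0 bin0 mulr1.
  rewrite bin0n mulr0 bin_small //.
  by rewrite mulSn addnCA; apply: leq_trans z0p (leq_addr _ _).
- by rewrite mul0n addn0 step0; have := IHz 0%N; rewrite mul0n addn0 => ->; rewrite !bk0.
- by rewrite stepF stepG !IHz mulrDr.
- elim=> [|i' IHi].
    by rewrite mul0n addn0 -step0; have := IHz 0%N; rewrite mul0n addn0 => ->; rewrite !bk0.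
  have := IHz i'.+1; rewrite stepF stepG IHi mulrDr; exact: addIr.
Qed.

Lemma int_divp (z : int) : exists z0 : nat, exists z' : int,
  [/\ (z0 < p)%N, z = z0%:Z + z' * p%:Z, z' = (z %/ p)%Z & (z0%:Z = z %% p)%Z].
Proof.
have p0 : p%:Z != 0 by rewrite eqz_nat -lt0n.
have := modz_ge0 z p0; case e: (z %% p)%Z => [m|//] _.
exists m, (z %/ p)%Z; split => //.
- by have := ltz_mod z p0; rewrite e.
- by rewrite {1}(divz_eq z p) e addrC.
Qed.

Lemma divz_add (z0 : nat) (z' : int) : (z0 < p)%N ->
  ((z0%:Z + z' * p%:Z) %/ p)%Z = z'.
Proof.
move=> *; rewrite addrC divzMDl ?divz_small ?addr0 // ?eqz_nat -?lt0n //.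
Qed.

Lemma bk_per r z (i : nat) : (i < p ^ r)%N -> bk (z + (p ^ r)%N%:Z) i = bk z i.
Proof.
elim: r z i => [|r IHr] z i; first by rewrite expn0 ltnS leqn0 => /eqP ->; rewrite !bk0.
move=> ir; have [z0 [z' [z0p -> _ _]]] := int_divp z.
rewrite (divn_eq i p) addnC expnSr PoszM -addrA -mulrDl.
have hi : (i %% p < p)%N by rewrite ltn_mod.
by rewrite !lucas // IHr // ltn_divLR // -expnSr.
Qed.

(** By Lucas the value is nonzero only if the last r digits of z are all p - 1, and then it is 1.
    This is why mu_a = binom(H - a - 1, p - 1) projects onto the weights congruent to a modulo p. *)
Lemma bk_delta r z : bk z (p ^ r).-1 = (((p ^ r)%N%:Z %| z + 1)%Z)%:R.
Proof.
elim: r z => [|r IHr] z; first by rewrite expn0 bk0 dvd1z.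
have [z0 [z' [z0p -> _ _]]] := int_divp z.
have pr0 : (0 < p ^ r)%N by rewrite expn_gt0 p_gt0.
have -> : ((p ^ r.+1).-1 = p.-1 + (p ^ r).-1 * p)%N.
  have := leq_pmull p pr0; rewrite expnSr -!subn1 mulnBl mul1n.
  by have := p_gt0; lia.
rewrite lucas ?prednK // IHr bk_nat.
have [z0e|z0l] := eqVneq z0 p.-1.
  rewrite z0e binn mul1r; congr ((_)%:R); congr nat_of_bool.
  have -> : p.-1%:Z + z' * p + 1 = (z' + 1) * p by lia.
  by rewrite expnSr PoszM dvdz_mul2r ?eqz_nat -?lt0n.
rewrite bin_small ?mul0r; last by rewrite ltn_neqAle z0l -ltnS prednK.
case h : ((p ^ r.+1)%N%:Z %| z0%:Z + z' * p%:Z + 1)%Z => //; exfalso.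
have : (p%:Z %| z0%:Z + z' * p + 1)%Z.
  by apply: dvdz_trans h; rewrite expnSr PoszM dvdz_mull.
have -> : z0%:Z + z' * p + 1 = z0.+1%:Z + z' * p by lia.
rewrite rpredDr ?dvdz_mull // => h2.
have := dvdn_leq (isT : 0 < z0.+1)%N h2; lia.
Qed.

Variable r : nat.
Local Notation q := (p ^ r)%N.
Let q_gt0 : (0 < q)%N. Proof. by rewrite expn_gt0 p_gt0. Qed.

Lemma bin_carry (n i : nat) : (n < q)%N -> (i < q)%N -> (q <= n + i)%N ->
  'C(n + i, i)%:R = 0 :> k.
Proof.
move=> nq iq qni; rewrite -bk_nat -(subnK qni) PoszD bk_per // bk_nat.
by rewrite bin_small //; lia.
Qed.

(** Modulo q the upper index is -1, and binom(-1, m) = (-1)^m. *)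
Lemma bin_full_neq0 (m : nat) : (m < q)%N -> 'C(q.-1, m)%:R != 0 :> k.
Proof.
move=> mq; rewrite -bk_nat.
have -> : q.-1%:Z = Negz 0 + q%:Z by rewrite NegzE; lia.
rewrite bk_per // /bk /=.
by rewrite add0n binn mulr1 rmorphXn /= rmorphN1 signr_eq0.
Qed.

Lemma bin_compl (l s : nat) : (l < q)%N -> (s < q)%N ->
  'C(q.-1 - l + s, s)%:R = (-1) ^+ s * 'C(l, s)%:R :> k.
Proof.
move=> lq sq; rewrite -bk_nat.
have -> : (q.-1 - l + s)%N%:Z = s%:Z - l%:Z - 1 + q%:Z by lia.
by rewrite bk_per // /bk binz_opp rmorphM rmorphXn /= rmorphN1.
Qed.

End CharP.

Lemma bin_lucas (k : fieldType) (p : nat) (hp : p \in [pchar k]) (a b c d : nat) :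
  (a < p)%N -> (b < p)%N -> 'C(a + c * p, b + d * p)%:R = 'C(a, b)%:R * 'C(c, d)%:R :> k.
Proof.
by move=> ap bp; rewrite -!bk_nat -(lucas hp) // PoszD PoszM.
Qed.

(** * Functions of the weight that are periodic modulo a power of p *)

Section Periodic.
Variables (k : fieldType) (p : nat).
Hypothesis hp : p \in [pchar k].

Let p_pr : prime p. Proof. exact: pcharf_prime hp. Qed.
Let p_gt0 : (0 < p)%N. Proof. exact: prime_gt0 p_pr. Qed.

Definition delta (r : nat) (b z : int) : k := (((p ^ r)%N%:Z %| z - b)%Z)%:R.

Definition per (r : nat) (phi : int -> k) := forall z, phi (z + (p ^ r)%N%:Z) = phi z.

Lemma perMz r phi : per r phi -> forall z w, phi (z + w * (p ^ r)%N%:Z) = phi z.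
Proof.
move=> h z w; elim/int_ind1: w => [|w IHw|w]; first by rewrite mul0r addr0.
  by rewrite mulrDl mul1r addrA h.
by rewrite mulrDl mul1r addrA h.
Qed.

Lemma per_le r s phi : (r <= s)%N -> per r phi -> per s phi.
Proof.
move=> rs h z; rewrite -(subnK rs) expnD PoszM.
exact: perMz.
Qed.

Lemma delta_per r b : per r (delta r b).
Proof.
move=> z; rewrite /delta addrAC; congr ((nat_of_bool _)%:R).
by rewrite rpredDr.
Qed.

Lemma per_mod r phi : per r phi -> forall z, phi z = phi (z %% (p ^ r)%N)%Z.
Proof.
by move=> h z; rewrite {1}(divz_eq z (p ^ r)%N%:Z) addrC perMz.
Qed.

Let pr_gt0 r : (0 < p ^ r)%N. Proof. by rewrite expn_gt0 p_gt0. Qed.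

Lemma delta_sum r phi : per r phi ->
  forall z, phi z = \sum_(b < p ^ r) phi b%:Z * delta r b%:Z z.
Proof.
move=> h z; rewrite (per_mod h).
have q0 : (p ^ r)%N%:Z != 0 by rewrite eqz_nat -lt0n.
have := modz_ge0 z q0; have := ltz_mod z q0.
case e : (z %% _)%Z => [b|//] hb _.
have {}hb : (b < p ^ r)%N by have := pr_gt0 r; lia.
rewrite (bigD1 (Ordinal hb)) //= big1 => [|c nc].
  rewrite addr0 /delta -e -eqz_mod_dvd modz_mod eqxx mulr1.
  by [].
rewrite /delta -eqz_mod_dvd e modz_small ?mulr0 //; last by rewrite ltz_nat /=.
case: eqP => [[] bc|]; last by rewrite mulr0.
by case/negP: nc; apply/eqP/val_inj.
Qed.

Lemma per_mul r phi psi : per r phi -> per r psi -> per r (fun z => phi z * psi z).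
Proof. by move=> h1 h2 z; rewrite h1 h2. Qed.

Lemma per_shift r phi c : per r phi -> per r (fun z => phi (z + c)).
Proof. by move=> h z; rewrite addrAC h. Qed.

(** The middle factor binom(H + 2i - m - n, i) of the commutation formula for X^(m) Y^(n), as a
    function of the weight; [yxk] is its analogue for Y^(m) X^(n), with -H in place of H. *)
Definition xyk (m n i : nat) (z : int) : k := bk k (z + ((i.*2)%:Z - m%:Z - n%:Z)) i.

Definition yxk (m n i : nat) (z : int) : k := bk k (- z + ((i.*2)%:Z - m%:Z - n%:Z)) i.

(** The effect of Fr' on functions of the weight: binom(z, np) = binom(floor(z / p), n) by Lucas. *)
Definition fdiv (phi : int -> k) (z : int) : k := phi (z %/ p)%Z.

Lemma fdiv_per r phi : per r phi -> per r.+1 (fdiv phi).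
Proof.
move=> h z; rewrite /fdiv; have p0 : p%:Z != 0 by rewrite eqz_nat -lt0n.
have -> : z + (p ^ r.+1)%N%:Z = (p ^ r)%N%:Z * p%:Z + z by rewrite expnSr PoszM addrC.
by rewrite divzMDl // [X in phi X]addrC h.
Qed.

End Periodic.

(** * Divided powers in characteristic zero *)

Section BinPoly.
Variable K : numFieldType.

Definition bpoly (n : nat) : {poly K} :=
  (n`!%:R : K)^-1 *: \prod_(i < n) ('X - i%:R%:P).

Lemma natr1_neq0 n : n.+1%:R != 0 :> K. Proof. by rewrite pnatr_eq0. Qed.

Lemma bpoly0 : bpoly 0 = 1.
Proof. by rewrite /bpoly big_ord0 fact0 invr1 scale1r. Qed.

Lemma bpolyS n : n.+1%:R *: bpoly n.+1 = ('X - n%:R%:P) * bpoly n.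
Proof.
rewrite /bpoly big_ord_recr /= factS natrM invfM scalerA mulrA.
by rewrite divff ?natr1_neq0 // mul1r -scalerAr mulrC.
Qed.

Lemma size_bpoly n : (size (bpoly n) <= n.+1)%N.
Proof.
apply: leq_trans (size_scale_leq _ _) _.
by rewrite -big_enum size_prod_XsubC size_enum_ord.
Qed.

Lemma bpoly_int n (z : int) : (bpoly n).[z%:~R] = (binz z n)%:~R.
Proof.
elim: n => [|n IHn]; first by rewrite bpoly0 hornerC binz0.
apply: (mulfI (natr1_neq0 n)).
rewrite -[n.+1%:R in RHS]/(n.+1%:Z%:~R) -intrM binz_mul intrM -IHn.
by rewrite -hornerZ bpolyS hornerM !hornerE rmorphB.
Qed.

Definition intval (f : {poly K}) := forall z : int, exists w : int, f.[z%:~R] = w%:~R.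

Lemma intval_bpoly n : intval (bpoly n).
Proof. by move=> z; exists (binz z n); rewrite bpoly_int. Qed.

Lemma intvalM f g : intval f -> intval g -> intval (f * g).
Proof.
move=> hf hg z; have [a ea] := hf z; have [b eb] := hg z.
by exists (a * b); rewrite hornerM ea eb rmorphM.
Qed.

Lemma intval_shift f (c : int) : intval f -> intval (f \Po ('X + c%:~R%:P)).
Proof.
by move=> hf z; have [a ea] := hf (z + c); exists a; rewrite horner_comp !hornerE -intrD.
Qed.

Lemma intvalN f : intval f -> intval (f \Po (- 'X)).
Proof.
by move=> hf z; have [a ea] := hf (- z); exists a; rewrite horner_comp !hornerE -rmorphN.
Qed.

(** Newton interpolation at 0, ..., n - 1. The matrix of values 'C(i, j) is unitriangular over the
    integers, so the coefficients are integers, and the size bound turns agreement at n points into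
    equality. *)
Lemma intval_newton f n : intval f -> (size f <= n)%N ->
  exists c : nat -> int, f = \sum_(j < n) (c j)%:~R *: bpoly j.
Proof.
move=> hf szf.
have [c hc] : exists c : nat -> int, forall i, (i < n)%N ->
    f.[i%:R] = (\sum_(j < n) (c j)%:~R *: bpoly j).[i%:R].
  elim: n {szf} => [|n [c hc]]; first by exists (fun=> 0).
  have [a ea] := hf n%:Z.
  have [b eb] : exists b : int, (\sum_(j < n) (c j)%:~R *: bpoly j).[n%:R] = b%:~R.
    exists (\sum_(j < n) c j * binz n%:Z j).
    rewrite horner_sum rmorph_sum; apply: eq_bigr => j _.
    by rewrite hornerZ -[n%:R]/(n%:Z%:~R) bpoly_int rmorphM.
  (* [bpoly n] vanishes at every i < n and is 1 at n: the earlier values persist, and the defect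
     [a - b] at n is the new coefficient. *)
  exists (fun j => if (j < n)%N then c j else a - b) => i.
  rewrite ltnS leq_eqVlt big_ord_recr /= ltnn.
  under eq_bigr => j _ do rewrite ltn_ord.
  rewrite hornerD hornerZ -[i%:R]/(i%:Z%:~R) bpoly_int.
  rewrite binz_nat; case: eqVneq => [->|ni] /=.
    by rewrite ea [X in X + _]eb binn mulr1 rmorphB addrCA subrr addr0.
  by move=> lin; rewrite (bin_small lin) mulr0 addr0; apply: hc.
exists c; apply/eqP; rewrite -subr_eq0.
set g := f - _.
have szg : (size g <= n)%N.
  rewrite (leq_trans (size_polyD _ _)) // geq_max szf size_polyN.
  apply: (leq_trans (size_sum _ _ _)); apply/bigmax_leqP => i _.
  apply: leq_trans (size_scale_leq _ _) _.
  by apply: leq_trans (size_bpoly i) _.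
apply: contraT => g0.
suff: (n < size g)%N by rewrite ltnNge szg.
rewrite -{1}(size_iota 0 n) -(size_map (fun i => i%:R : K)).
apply: max_poly_roots => //.
  apply/allP => x /mapP [m]; rewrite mem_iota add0n => /= lin ->.
  by rewrite /root /g hornerD hornerN (hc _ lin) subrr.
rewrite map_inj_uniq ?iota_uniq // => i j /eqP; rewrite eqr_nat => /eqP; exact.
Qed.

End BinPoly.

Section Sl2Rel.
Variables (K : numFieldType) (A : algType K) (x y h : A).
Hypothesis Hxy : x * y = y * x + h.
Hypothesis Hhx : h * x = x * (h + 2%:R).
Hypothesis Hhy : h * y = y * (h - 2%:R).

Definition dp (u : A) m : A := locked ((m`!%:R : K)^-1 *: u ^+ m).
Definition evp (f : {poly K}) : A := locked (horner_alg h f).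

Lemma dpE u m : dp u m = (m`!%:R : K)^-1 *: u ^+ m. Proof. by rewrite /dp -lock. Qed.
Lemma evpE f : evp f = horner_alg h f. Proof. by rewrite /evp -lock. Qed.

Lemma dp0 u : dp u 0 = 1.
Proof. by rewrite !dpE fact0 invr1 scale1r. Qed.

Lemma dpS u m : u * dp u m = m.+1%:R *: dp u m.+1.
Proof.
rewrite !dpE -scalerAr -exprS scalerA factS natrM invfM mulrA.
by rewrite (mulfV (natr1_neq0 K m)) mul1r.
Qed.

Lemma dpD u m n : dp u m * dp u n = ('C(m + n, m)%:R : K) *: dp u (m + n).
Proof.
rewrite !dpE -scalerAl -scalerAr -exprD !scalerA; congr (_ *: _).
have /(congr1 (fun i : nat => i%:R : K)) := bin_fact (leq_addr n m).
rewrite addKn !natrM => <-.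
by rewrite !invfM mulVKf // pnatr_eq0 -lt0n bin_gt0 leq_addr.
Qed.

Lemma evp_comm (u : A) (c : K) : h * u = u * (h + c%:A) ->
  forall f, evp f * u = u * evp (f \Po ('X + c%:P)).
Proof.
move=> hu f; rewrite !evpE; elim/poly_ind: f => [|f d IHf].
  by rewrite comp_poly0 !rmorph0 mul0r mulr0.
rewrite comp_polyD comp_polyM comp_polyC comp_polyX !rmorphD !rmorphM /= !rmorphD /=.
rewrite !horner_algC !horner_algX mulrDl mulrDr -scalerAl -scalerAr mul1r mulr1.
by congr (_ + _); rewrite -mulrA hu mulrA IHf mulrA.
Qed.

Lemma evp_x f : evp f * x = x * evp (f \Po ('X + 2%:R%:P)).
Proof. by apply: evp_comm; rewrite Hhx scaler_nat. Qed.

Lemma comp_shift (f : {poly K}) (c d : K) :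
  (f \Po ('X + c%:P)) \Po ('X + d%:P) = f \Po ('X + (c + d)%:P).
Proof.
rewrite -comp_polyA comp_polyD comp_polyX comp_polyC.
by rewrite polyCD; congr (_ \Po _); rewrite addrAC addrA.
Qed.

Lemma comp_shift0 (f : {poly K}) : f \Po ('X + 0%:P) = f.
Proof. by rewrite addr0 comp_polyXr. Qed.

Lemma evp_dp (u : A) (c : K) : h * u = u * (h + c%:A) ->
  forall m f, evp f * dp u m = dp u m * evp (f \Po ('X + (c *+ m)%:P)).
Proof.
move=> hu m f; rewrite !dpE; rewrite -scalerAr -scalerAl; congr (_ *: _).
elim: m f => [|m IHm] f.
  by rewrite mulr0n comp_shift0 mulr1 mul1r.
rewrite exprSr mulrA IHm -mulrA (evp_comm hu) comp_shift mulrA.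
by rewrite mulrSr.
Qed.

Lemma evp_dpx m f : evp f * dp x m = dp x m * evp (f \Po ('X + (m.*2)%:R%:P)).
Proof.
by rewrite (@evp_dp x 2%:R) ?Hhx ?scaler_nat // -mulrnA mul2n.
Qed.

Lemma evp_dpy m f : evp f * dp y m = dp y m * evp (f \Po ('X - (m.*2)%:R%:P)).
Proof.
rewrite (@evp_dp y (- 2%:R)) ?Hhy ?scaleNr ?scaler_nat //.
by rewrite mulNrn -mulrnA mul2n polyCN.
Qed.

Lemma evp1 : evp 1 = 1. Proof. by rewrite !evpE rmorph1. Qed.
Lemma evp0 : evp 0 = 0. Proof. by rewrite !evpE rmorph0. Qed.
Lemma evpX : evp 'X = h. Proof. by rewrite !evpE horner_algX. Qed.
Lemma evpD f g : evp (f + g) = evp f + evp g. Proof. by rewrite !evpE rmorphD. Qed.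
Lemma evpZ c f : evp (c *: f) = c *: evp f. Proof. by rewrite !evpE -mul_polyC rmorphM /= horner_algC mulr_algl. Qed.
Lemma evpM f g : evp (f * g) = evp f * evp g. Proof. by rewrite !evpE rmorphM. Qed.
Lemma dp1 u : dp u 1 = u.
Proof. by rewrite !dpE invr1 scale1r. Qed.

Lemma x_dpy q : x * dp y q.+1 = dp y q.+1 * x + dp y q * evp ('X - q%:R%:P).
Proof.
elim: q => [|q IHq].
  by rewrite dp1 dp0 mul1r subr0 evpX.
apply: (scalerI (natr1_neq0 K q.+1)); rewrite scalerAr -dpS mulrA Hxy mulrDl.
rewrite -mulrA IHq mulrDr !mulrA !dpS scalerDr -!scalerAl -addrA; congr (_ + _).
rewrite -{1}evpX evp_dpy comp_polyX !scalerAr -mulrDr; congr (_ * _).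
rewrite -!evpZ -evpD; congr evp.
rewrite -!mul_polyC.
have e (n : nat) : n%:R%:P = n%:R :> {poly K} by rewrite polyC_natr.
rewrite !e -mul2n natrM -[q.+2]addn2 -[q.+1]addn1 !natrD; ring.
Qed.

Definition xyc (m n i : nat) : {poly K} :=
  bpoly K i \Po ('X + ((i.*2)%:Z - m%:Z - n%:Z)%:~R%:P).

Lemma xyc0 m n : xyc m n 0 = 1.
Proof. by rewrite /xyc bpoly0 comp_polyC. Qed.

Lemma bpoly_pascal i : bpoly K i.+1 \Po ('X + 1) = bpoly K i.+1 + bpoly K i.
Proof.
elim: i => [|i IHi].
  have e1 : bpoly K 1 = 'X.
    by have := bpolyS K 0; rewrite bpoly0 scale1r mulr1 subr0.
  by rewrite e1 bpoly0 comp_polyX.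
apply: (scalerI (natr1_neq0 K i.+1)).
rewrite -comp_polyZ bpolyS comp_polyM IHi scalerDr bpolyS mulrDr.
rewrite comp_polyB comp_polyX comp_polyC.
have := bpolyS K i; set P := bpoly K i; set Q := bpoly K i.+1.
rewrite -!mul_polyC !polyC_natr -[i.+2]addn2 -[i.+1]addn1 !natrD => h1.
transitivity (('X - i%:R) * Q + ('X - i%:R) * P); first by ring.
by rewrite -h1; ring.
Qed.

(* With A the shifted variable, this is
   (m+1) C(A+1,i+1) = (m-i) C(A,i+1) + (A+m+1-i) C(A,i). *)
Lemma xyc_rec m n i :
  m.+1%:R *: xyc m.+1 n i.+1 =
  (m%:R - i%:R) *: (xyc m n i.+1 \Po ('X - 2%:R%:P)) +
  ('X - (n%:R - i%:R - 1)%:P) * xyc m n i.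
Proof.
pose a : {poly K} := 'X + ((i.*2)%:Z - m%:Z - n%:Z)%:~R%:P.
have -> : xyc m n i = bpoly K i \Po a by [].
have -> : xyc m n i.+1 \Po ('X - 2%:R%:P) = bpoly K i.+1 \Po a.
  rewrite /xyc -polyCN comp_shift; congr (_ \Po ('X + _%:P)).
  by rewrite doubleS -[in LHS]addn2 !rmorphB PoszD rmorphD /=; ring.
have -> : xyc m.+1 n i.+1 = (bpoly K i.+1 \Po ('X + 1)) \Po a.
  rewrite -comp_polyA comp_polyD comp_polyX -polyC1 comp_polyC /xyc /a -(addrA 'X) -polyCD.
  congr (_ \Po ('X + _%:P)).
  rewrite doubleS -[in LHS]addn2 -[m.+1]addn1 !rmorphB !PoszD !rmorphD /=; ring.
have -> : 'X - (n%:R - i%:R - 1)%:P = ('X + (m%:R + 1 - i%:R)%:P) \Po a.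
  rewrite comp_polyD comp_polyX comp_polyC /a -(addrA 'X) -polyCD -polyCN; congr (_ + _%:P).
  by rewrite -muln2 !rmorphB /= PoszM rmorphM /=; ring.
rewrite bpoly_pascal -!comp_polyZ -comp_polyM -comp_polyD; congr (_ \Po _).
have := bpolyS K i; set P := bpoly K i; set Q := bpoly K i.+1.
rewrite -!mul_polyC !polyCD !polyCN !polyC_natr -[m.+1]addn1 -[i.+1]addn1 !natrD => h1.
transitivity ((m%:R - i%:R) * Q + (i%:R + 1%:R) * Q + (m%:R + 1%:R) * P); first by ring.
by rewrite h1 polyC1; ring.
Qed.

(** Induction on m by left multiplication with x. Moved past Y^(n - i), it leaves a term of index i
    ([F i]) and, through the commutator, one of index i + 1 ([G i]); [xyc_rec] adds them up. Only
    the relations of an sl_2-triple enter, so the formula also serves for the triple (y, x, -h). *)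
Lemma dpx_dpy m n : dp x m * dp y n =
  \sum_(i < m.+1 | (i <= n)%N) dp y (n - i) * evp (xyc m n i) * dp x (m - i).
Proof.
elim: m => [|m IHm].
  by rewrite big_mkcond big_ord_recl big_ord0 /= addr0 !dp0 mul1r xyc0 evp1 !mulr1 subn0.
apply: (scalerI (natr1_neq0 K m)); rewrite scalerAl -dpS -mulrA IHm scaler_sumr mulr_sumr.
rewrite [LHS]big_mkcond [RHS]big_mkcond /=.
pose F i := if (i <= n)%N then (m.+1%:R - i%:R) *:
   (dp y (n - i) * evp (xyc m n i \Po ('X - 2%:R%:P)) * dp x (m.+1 - i)) else 0.
pose G i := if (i < n)%N then
   dp y (n - i.+1) * evp (('X - (n%:R - i%:R - 1)%:P) * xyc m n i) * dp x (m - i) else 0.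
transitivity (\sum_(i < m.+1) (F i + G i)).
  apply: eq_bigr => i _; rewrite /F /G; have [lein|] := leqP i n; last first.
    by move=> nin; rewrite ifF ?addr0 // ltnNge ltnW.
  have xe f : x * evp f = evp (f \Po ('X - 2%:R%:P)) * x.
    by rewrite evp_x -polyCN comp_shift addNr comp_shift0.
  have sm : (m.+1 - i = (m - i).+1)%N by rewrite subSn // -ltnS.
  have sr : m.+1%:R - i%:R = (m - i).+1%:R :> K.
    by rewrite -sm natrB // ltnW.
  case: ltngtP lein => // [lin _|ein _].
    rewrite -[(n - i)%N](@subnSK i) // mulrA mulrA x_dpy !mulrDl.
    rewrite subnSK //; congr (_ + _).
      rewrite -[X in X * dp x _ = _]mulrA xe mulrA -[LHS]mulrA dpS sm sr.
      by rewrite -scalerAr.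
    rewrite -mulrDl evpM !mulrA; congr (_ * evp _ * _ * _).
    by rewrite natrB // -[i.+1]addn1 natrD opprD addrA.
  by rewrite -ein subnn dp0 !mul1r addr0 mulrA xe -mulrA dpS sm sr -scalerAr.
rewrite big_split /= [RHS]big_ord_recl /=.
have -> : \sum_(i < m.+1) F i = F 0%N + \sum_(i < m.+1) F i.+1.
  rewrite big_ord_recl /=; congr (_ + _); rewrite [RHS]big_ord_recr /=.
  by rewrite [F m.+1]/F subrr scale0r if_same addr0.
rewrite -addrA; congr (_ + _).
  by rewrite /F !leq0n !subn0 subr0 !xyc0 comp_polyC evp1.
rewrite -big_split /=; apply: eq_bigr => i _.
rewrite /F /G /bump /= add1n; case: ifP => lin; last by rewrite addr0.
rewrite !subSS [RHS]scalerAl [X in _ = X * _]scalerAr -evpZ xyc_rec evpD evpZ mulrDr [RHS]mulrDl.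
rewrite -scalerAr -scalerAl; congr (_ *: _ + _).
by rewrite -!natr1; ring.
Qed.

End Sl2Rel.

(** * The Kostant form *)

Section Rep.
Variable R : realType.
Local Notation C := (R[i]).
Local Notation U := (Usl2 R).

Definition wspace := nat -> nat -> C -> C.
Implicit Types (F G : wspace) (g : sl2 R).

(* The model of the left regular representation in which the function F stands
   for the sum of the Y^(m) F(m, n, H) X^(n). *)
Definition opX F : wspace := fun m n a =>
  n%:R * F m n.-1 (a - 2%:R) + (a - m%:R) * F m.+1 n a.
Definition opY F : wspace := fun m n a => m%:R * F m.-1 n a.
Definition opH F : wspace := fun m n a => (a - (m.*2)%:R) * F m n a.
Definition opg g F : wspace := fun m n a =>
  g 0 1 * opX F m n a + g 1 0 * opY F m n a + g 0 0 * opH F m n a.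

Fixpoint termact (t : ueaTerm (sl2 R)) (F : wspace) : wspace :=
  match t with
  | uScal c => fun m n a => c * F m n a
  | uGen g => opg g F
  | uAdd t u => fun m n a => termact t F m n a + termact u F m n a
  | uMul t u => termact t (termact u F)
  end.

Lemma wspaceP F G : (forall m n a, F m n a = G m n a) -> F = G.
Proof. by move=> h; apply/funext => m; apply/funext => n; apply/funext => a. Qed.

Lemma termact_lin t (c : C) F G :
  termact t (fun m n a => c * F m n a + G m n a) =
  (fun m n a => c * termact t F m n a + termact t G m n a).
Proof.
elim: t F G => [d|g|t IHt u IHu|t IHt u IHu] F G /=.
- by apply: wspaceP => m n a; ring.
- by apply: wspaceP => m n a; rewrite /opg /opX /opY /opH; ring.
- by apply: wspaceP => m n a; rewrite IHt IHu; ring.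
- by rewrite IHu IHt.
Qed.

Lemma sl2_11 g : g 1 1 = - g 0 0.
Proof.
case: g => M /= hM; apply/eqP; rewrite -addr_eq0 addrC.
move: hM; rewrite unfold_in /mxtrace !big_ord_recr big_ord0 /= add0r.
by congr (_ == 0); congr (M _ _ + M _ _); apply/val_inj.
Qed.

Lemma sl2_bracketE g g' i j : (sl2_bracket g g') i j =
  (g i 0 * g' 0 j + g i 1 * g' 1 j) - (g' i 0 * g 0 j + g' i 1 * g 1 j).
Proof.
rewrite /= !mxE !big_ord_recr !big_ord0 /= !add0r.
have e0 : widen_ord (leqnSn 1) ord_max = 0 :> 'I_2 by apply/val_inj.
have e1 : ord_max = 1 :> 'I_2 by apply/val_inj.
by rewrite e0 e1.
Qed.

(** The relation with content is the bracket, which is a computation with the three operators; the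
    sum and scalar rules reduce to linearity of the action. The split into zero and successor is due
    to the predecessors in [opX] and [opY]. *)
Lemma termact_eq t u : ueaEq (@sl2_bracket R) t u -> forall F, termact t F = termact u F.
Proof.
elim=> //=; try by move=> *; apply: wspaceP => *; ring.
- by move=> t1 t2 t3 _ h1 _ h2 F; rewrite h1 h2.
- by move=> t1 t1' t2 t2' _ h1 _ h2 F; rewrite h1 h2.
- by move=> t1 t1' t2 t2' _ h1 _ h2 F; rewrite h2 h1.
- move=> t1 t2 t3 F.
  have := termact_lin t1 1 (termact t2 F) (termact t3 F) => h.
  transitivity (termact t1 (fun m n a => 1 * termact t2 F m n a + termact t3 F m n a)).
    by congr (termact t1 _); apply: wspaceP => *; rewrite mul1r.
  by rewrite h; apply: wspaceP => *; rewrite mul1r.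
- move=> c t1 F.
  have h0 := termact_lin t1 (-1) F F.
  have z : termact t1 (fun _ _ _ => 0) = (fun _ _ _ => 0).
    transitivity (termact t1 (fun m n a => -1 * F m n a + F m n a)).
      by congr (termact t1 _); apply: wspaceP => *; ring.
    by rewrite h0; apply: wspaceP => *; ring.
  transitivity (termact t1 (fun m n a => c * F m n a + 0)); last first.
    by congr (termact t1 _); apply: wspaceP => *; rewrite addr0.
  by rewrite termact_lin z; apply: wspaceP => *; rewrite addr0.
- by move=> g g' F; apply: wspaceP => m n a; rewrite /opg !mxE; ring.
- by move=> c g F; apply: wspaceP => m n a; rewrite /opg !mxE; ring.
- move=> g g' F; apply: wspaceP => m n a; rewrite /opg !sl2_bracketE !sl2_11.
  rewrite /opX /opY /opH.
  case: m => [|m]; case: n => [|n] /=; rewrite -?muln2 -?natr1 ?natrM -?natr1; ring.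
Qed.

Definition wact (u : U) (F : wspace) : wspace := termact (repr u) F.

Lemma wact_pi t F : wact (uea_pi _ t) F = termact t F.
Proof. exact/termact_eq/uea_reprP. Qed.

Lemma wactM u v F : wact (u * v) F = wact u (wact v F).
Proof.
elim/uea_piW: u => t; elim/uea_piW: v => t'.
by rewrite {1}/GRing.mul /= uea_mulE !wact_pi.
Qed.

Lemma wactD u v F m n a : wact (u + v) F m n a = wact u F m n a + wact v F m n a.
Proof.
elim/uea_piW: u => t; elim/uea_piW: v => t'.
by rewrite {1}/GRing.add /= uea_addE !wact_pi.
Qed.

Lemma wactZ (c : C) u F m n a : wact (c *: u) F m n a = c * wact u F m n a.
Proof.
elim/uea_piW: u => t.
by rewrite {1}/GRing.scale /= uea_scaleE !wact_pi.
Qed.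

Lemma wact0 F m n a : wact 0 F m n a = 0.
Proof. by rewrite -(scale0r 0) wactZ mul0r. Qed.

Lemma wact1 F : wact 1 F = F.
Proof. by rewrite wact_pi; apply: wspaceP => *; rewrite /= mul1r. Qed.

Lemma wactX F : wact (Ux R) F = opX F.
Proof.
rewrite wact_pi /=; apply: wspaceP => m n a; rewrite /opg /= !mxE /=.
by rewrite mul1r !mul0r !addr0.
Qed.
Lemma wactY F : wact (Uy R) F = opY F.
Proof.
rewrite wact_pi /=; apply: wspaceP => m n a; rewrite /opg /= !mxE /=.
by rewrite mul1r !mul0r addr0 add0r.
Qed.
Lemma wactH F : wact (Uh R) F = opH F.
Proof.
rewrite wact_pi /=; apply: wspaceP => m n a; rewrite /opg /= !mxE /=.
by rewrite !subr0 mul1r !mul0r !add0r.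
Qed.

(** The function that stands for 1. An element of the enveloping algebra applied to it displays its
    own coefficients in the order Y, H, X. *)
Definition w0 : wspace := fun m n a => ((m == 0%N) && (n == 0%N))%:R.

Local Notation X := (Ux R).
Local Notation Y := (Uy R).
Local Notation H := (Uh R).

Lemma sl2_ext g g' : g 0 0 = g' 0 0 -> g 0 1 = g' 0 1 -> g 1 0 = g' 1 0 -> g = g'.
Proof.
move=> h00 h01 h10; apply: val_inj => /=.
have h11 : g 1 1 = g' 1 1 by rewrite !sl2_11 h00.
apply/matrixP => i j.
have e2 (t : 'I_2) : t = 0 \/ t = 1.
  by case: t => [[|[|t]] lt] //; [left|right]; apply/val_inj.
by case: (e2 i) => ->; case: (e2 j) => ->.
Qed.

Lemma uea_inZ (c : C) g : uea_in (@sl2_bracket R) (c *: g) = c *: uea_in _ g.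
Proof.
by rewrite {2}/GRing.scale /= /uea_in uea_scaleE; apply/uea_piP/ueaEq_genZ.
Qed.
Lemma uea_inB g g' : uea_in (@sl2_bracket R) g * uea_in _ g' =
  uea_in _ g' * uea_in _ g + uea_in _ (sl2_bracket g g').
Proof.
rewrite /GRing.mul /GRing.add /= /uea_in !uea_mulE uea_addE.
exact/uea_piP/ueaEq_genB.
Qed.

Lemma UXY : X * Y = Y * X + H.
Proof.
rewrite /Ux /Uy uea_inB; congr (_ + uea_in _ _).
by apply: sl2_ext; rewrite sl2_bracketE /= !mxE /=; ring.
Qed.
Lemma UHX : H * X = X * (H + 2%:R).
Proof.
rewrite mulrDr mulr_natr -scaler_nat -uea_inZ /Uh /Ux uea_inB.
congr (_ + uea_in _ _).
by apply: sl2_ext; rewrite sl2_bracketE /= !mxE /=; ring.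
Qed.
Lemma UHY : H * Y = Y * (H - 2%:R).
Proof.
rewrite mulrBr mulr_natr -scaler_nat -scaleNr -uea_inZ /Uh /Uy uea_inB.
congr (_ + uea_in _ _).
by apply: sl2_ext; rewrite sl2_bracketE /= !mxE /=; ring.
Qed.

Lemma divpowE (u : U) m : divpow u m = dp u m.
Proof. by rewrite dpE. Qed.

End Rep.
Arguments w0 R : clear implicits.

(** * The integral span and integral coordinates *)

Section Kostant.
Variable R : realType.
Local Notation C := (R[i]).
Local Notation U := (Usl2 R).
Local Notation X := (Ux R).
Local Notation Y := (Uy R).
Local Notation H := (Uh R).
Local Notation bX := (dp (Ux R)).
Local Notation bY := (dp (Uy R)).
Local Notation hf := (evp (Uh R)).

Lemma wact_evp f F m n a : wact (hf f) F m n a = f.[a - (m.*2)%:R] * F m n a.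
Proof.
elim/poly_ind: f F => [|f c IHf] F.
  by rewrite evp0 wact0 horner0 mul0r.
rewrite hornerMXaddC evpD evpM evpX wactD wactM IHf wactH /opH.
have -> : c%:P = c *: 1 :> {poly C} by rewrite -mul_polyC mulr1.
by rewrite evpZ evp1 wactZ wact1; ring.
Qed.

Lemma wact_bX s : wact (bX s) (w0 R) = fun m n _ => ((m == 0%N) && (n == s))%:R.
Proof.
elim: s => [|s IHs]; first by rewrite dp0 wact1.
apply: wspaceP => m n a; apply: (mulfI (natr1_neq0 C s)).
rewrite -wactZ -dpS wactM IHs wactX /opX /= mulr0 addr0.
case: m n => [|m] [|n]; rewrite ?mul0r ?mulr0 ?andbF //= eqSS.
by case: eqP => [->|]; rewrite ?mulr0.
Qed.

Lemma wact_bY s F m n a :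
  wact (bY s) F m n a = if (s <= m)%N then 'C(m, s)%:R * F (m - s)%N n a else 0.
Proof.
elim: s m F => [|s IHs] m F; first by rewrite dp0 wact1 bin0 mul1r subn0.
apply: (mulfI (natr1_neq0 C s)).
rewrite -wactZ -dpS wactM wactY /opY IHs.
case: m => [|m] /=; first by rewrite mul0r mulr0.
rewrite ltnS subSS; case: ifP => // _; last by rewrite !mulr0.
by rewrite !mulrA -!natrM mul_bin_diag.
Qed.

Definition coordU (u : U) : wspace R := wact u (w0 R).

Lemma coordU_pbw s f t m n a :
  coordU (bY s * hf f * bX t) m n a = ((m == s) && (n == t))%:R * f.[a].
Proof.
rewrite /coordU !wactM wact_bX wact_bY.
case: leqP => [sm|ms]; last by rewrite (ltn_eqF ms) mul0r.
rewrite wact_evp subn_eq0.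
have [ms|sm'] := leqP m s; last by rewrite (gtn_eqF sm') !mulr0 mul0r.
have -> : m = s by apply/eqP; rewrite eqn_leq ms sm.
by rewrite eqxx subnn subr0 binn mul1r mulrC.
Qed.

Lemma UZ_closed : subring_closed (@UZpred R).
Proof. exact: UZpred_subring. Qed.

Lemma bX_UZ n : bX n \in @UZpred R.
Proof. by rewrite /UZpred inE -divpowE => S [_]; apply; exists n; left. Qed.
Lemma bY_UZ n : bY n \in @UZpred R.
Proof. by rewrite /UZpred inE -divpowE => S [_]; apply; exists n; right. Qed.

Lemma intval_xyc m n i : @intval C (xyc C m n i).
Proof. exact/intval_shift/intval_bpoly. Qed.

Lemma size_xyc m n i : (size (xyc C m n i) <= i.+1)%N.
Proof.
rewrite /xyc; apply: leq_trans (size_comp_poly_leq _ _) _.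
rewrite size_XaddC muln1 ltnS; have := size_bpoly C i.
by case: (size _) => //= s; rewrite ltnS.
Qed.

(* X^(n) Y^(n) = binom(H, n) + terms with binomials of lower degree. *)
Lemma evp_subring (S : {pred U}) (Q : nat) : subring_closed S ->
  (forall n, (n < Q)%N -> bX n \in S /\ bY n \in S) ->
  forall f, intval f -> (size f <= Q)%N -> hf f \in S.
Proof.
move=> [S1 SB SM] SXY.
have S0 : 0 \in S by rewrite -(subrr 1); apply: SB.
have SN u : u \in S -> - u \in S by move=> hu; rewrite -sub0r; apply: SB.
have SD u v : u \in S -> v \in S -> u + v \in S.
  by move=> hu hv; rewrite -[v]opprK; apply/SB/SN.
have Snat (n : nat) u : u \in S -> n%:R *: u \in S.
  move=> hu; rewrite scaler_nat; elim: n => [|n IHn]; first by rewrite mulr0n.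
  by rewrite mulrS; apply: SD.
have Sint (z : int) u : u \in S -> z%:~R *: u \in S.
  move=> hu; case: z => n; first exact: Snat.
  by rewrite NegzE rmorphN scaleNr; apply/SN/Snat.
have Ssum (I : eqType) (s : seq I) (P : pred I) (F : I -> U) :
    (forall i, P i -> F i \in S) -> \sum_(i <- s | P i) F i \in S.
  by move=> hF; elim/big_rec: _ => // i u Pi hu; apply: SD => //; apply: hF.
have Snew m : (forall n, (n < m)%N -> hf (bpoly C n) \in S) ->
    forall f, intval f -> (size f <= m)%N -> hf f \in S.
  move=> hb f hfi szf; have [c ->] := intval_newton hfi szf.
  suff: forall j, (j <= m)%N -> hf (\sum_(i < j) (c i)%:~R *: bpoly C i) \in S by apply.
  elim=> [|j IHj] jm.
    by rewrite big_ord0 evp0.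
  by rewrite big_ord_recr /= evpD evpZ SD ?IHj 1?ltnW // Sint // hb.
apply: (Snew); elim/ltn_ind => n IHn nQ.
have [hX hY] := SXY n nQ.
have := dpx_dpy (UXY R) (UHX R) (UHY R) n n.
rewrite big_mkcond big_ord_recr /= leqnn subnn !dp0 mul1r mulr1.
have -> : xyc C n n n = bpoly C n.
  by rewrite /xyc -addnn PoszD addrK subrr rmorph0 comp_shift0.
move/eqP; rewrite addrC -subr_eq => /eqP <-; apply: SB; first exact: SM.
apply: Ssum => i _; rewrite ltnW //.
have [hXi _] := SXY (n - i)%N (leq_ltn_trans (leq_subr _ _) nQ).
have [_ hYi] := SXY (n - i)%N (leq_ltn_trans (leq_subr _ _) nQ).
apply: (SM) => //; apply: (SM) => //.
apply: (Snew i.+1) => [j ji||].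
- by apply: IHn; have := ltn_ord i; lia.
- exact: intval_xyc.
- exact: size_xyc.
Qed.

Lemma hf_UZ f : intval f -> hf f \in @UZpred R.
Proof.
move=> hfi; apply: (evp_subring UZ_closed _ hfi (leqnn _)) => n _.
by split; [exact: bX_UZ|exact: bY_UZ].
Qed.

(** Arbitrary integer-valued f(H) are allowed in the middle because they are stable under the shifts
    and products created by straightening; [intval_newton] returns to the binomials afterwards. *)
Definition spanZ (u : U) : Prop :=
  exists2 s : seq (nat * {poly C} * nat), (forall t, t \in s -> intval t.1.2) &
    u = \sum_(t <- s) bY t.1.1 * hf t.1.2 * bX t.2.

Lemma spanZ0 : spanZ 0.
Proof. by exists [::]; rewrite ?big_nil. Qed.
Lemma spanZ_pbw m f n : intval f -> spanZ (bY m * hf f * bX n).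
Proof.
move=> hfi; exists [:: (m, f, n)]; last by rewrite big_seq1.
by move=> t; rewrite inE => /eqP ->.
Qed.
Lemma spanZD u v : spanZ u -> spanZ v -> spanZ (u + v).
Proof.
move=> [s hs ->] [s' hs' ->]; exists (s ++ s'); last by rewrite big_cat.
by move=> t; rewrite mem_cat => /orP [/hs|/hs'].
Qed.
Lemma intvalZ (z : int) f : @intval C f -> intval (z%:~R *: f).
Proof.
by move=> hfi x; have [w e] := hfi x; exists (z * w); rewrite hornerZ e rmorphM.
Qed.
Lemma spanZN u : spanZ u -> spanZ (- u).
Proof.
move=> [s hs ->]; rewrite -sumrN; elim: s hs => [|t s IHs] hs.
  by rewrite big_nil; apply: spanZ0.
rewrite big_cons; apply: spanZD; last first.
  by apply: IHs => t' ht'; apply: hs; rewrite inE ht' orbT.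
rewrite -mulNr -mulrN -scaleN1r -evpZ -[-1]/((-1)%:~R); apply: spanZ_pbw.
by apply: intvalZ; apply: hs; rewrite inE eqxx.
Qed.
Lemma spanZ_sum (I : eqType) (s : seq I) (P : pred I) (F : I -> U) :
  (forall i, i \in s -> P i -> spanZ (F i)) -> spanZ (\sum_(i <- s | P i) F i).
Proof.
elim: s => [|i s IHs] hF; first by rewrite big_nil; apply: spanZ0.
have hs : spanZ (\sum_(j <- s | P j) F j).
  by apply: IHs => j js; apply: hF; rewrite inE js orbT.
rewrite big_cons; case: ifP => // Pi.
by apply: spanZD => //; apply: hF; rewrite ?inE ?eqxx.
Qed.

Lemma spanZ_bYl n u : spanZ u -> spanZ (bY n * u).
Proof.
move=> [s hs ->]; rewrite mulr_sumr; apply: spanZ_sum => t ts _.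
rewrite !mulrA dpD -!scalerAl scalerAl scalerAr -evpZ -[_%:R]/(_%:Z%:~R).
by apply: spanZ_pbw; apply: intvalZ; apply: hs.
Qed.

Lemma evp_dpx_swap m f : bX m * hf f = hf (f \Po ('X + (- (m.*2)%:Z)%:~R%:P)) * bX m.
Proof.
rewrite (evp_dpx (UHX R)) comp_shift rmorphN /= addNr comp_shift0.
by [].
Qed.

Lemma spanZ_bXl n u : spanZ u -> spanZ (bX n * u).
Proof.
move=> [s hs ->]; rewrite mulr_sumr; apply: spanZ_sum => t ts _.
rewrite !mulrA (dpx_dpy (UXY R) (UHX R) (UHY R)) !mulr_suml.
apply: spanZ_sum => i _ it.
rewrite -[_ * bX _ * hf _]mulrA evp_dpx_swap !mulrA -[_ * _ * hf _]mulrA -evpM.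
rewrite -[_ * bX _ * bX _]mulrA dpD -scalerAr scalerAl scalerAr -evpZ -[_%:R]/(_%:Z%:~R).
apply: spanZ_pbw; apply: intvalZ; apply: intvalM; first exact: intval_xyc.
by apply: intval_shift; apply: hs.
Qed.

Lemma UZ_spanZ u : u \in @UZpred R -> spanZ u.
Proof.
rewrite /UZpred inE => hu.
(* The left multipliers that preserve the span form a subring containing the generators; the
   multiplier [u] is then applied to 1. *)
pose S : set U := [set u | forall v, spanZ v -> spanZ (u * v)].
have := hu S; rewrite -[u in spanZ u]mulr1 => h; apply: h.
  split; first split.
  - by rewrite inE => v; rewrite mul1r.
  - move=> a b; rewrite !inE => ha hb v hv; rewrite mulrBl.
    by apply: spanZD; [apply: ha|apply/spanZN/hb].
  - by move=> a b; rewrite !inE => ha hb v hv; rewrite -mulrA; apply/ha/hb.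
  by move=> v [n [->|->]] w hw; rewrite divpowE; [apply: spanZ_bXl|apply: spanZ_bYl].
have -> : 1 = bY 0 * hf 1 * bX 0 by rewrite !dp0 evp1 !mulr1.
by apply: spanZ_pbw => z; exists 1; rewrite hornerC.
Qed.

(** Integrality at integer weights is what allows the coordinates to be carried over to k. *)
Lemma coordU_int (u : UZ R) m n (z : int) :
  exists w : int, coordU (UZval u) m n z%:~R = w%:~R.
Proof.
have [s hs ->] := UZ_spanZ (UZvalP u).
elim: s hs => [|t s IHs] hs.
  by exists 0; rewrite big_nil /coordU wact0.
have [|w e] := IHs; first by move=> t' ht'; apply: hs; rewrite inE ht' orbT.
have [|v ev] := hs t _ z; first by rewrite inE eqxx.
exists ((nat_of_bool ((m == t.1.1) && (n == t.2)))%:Z * v + w).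
rewrite big_cons /coordU wactD -!/(coordU _ _ _ _) coordU_pbw e ev rmorphD rmorphM.
by [].
Qed.

End Kostant.

(** * The hyperalgebra and functions of the weight *)

Section Hyper.
Variables (R : realType) (k : closedFieldType).
Local Notation C := (R[i]).
Local Notation U := (Usl2 R).
Local Notation X := (Ux R).
Local Notation Y := (Uy R).
Local Notation H := (Uh R).
Local Notation bX := (dp (Ux R)).
Local Notation bY := (dp (Uy R)).
Local Notation hf := (evp (Uh R)).
Local Notation hyp := (hyper R k).
Local Notation hX := (hX R k).
Local Notation hY := (hY R k).
Local Notation img := (@img R k).
Local Notation UZp := (@UZpred R).

Lemma imgE (u : U) (hu : u \in UZp) : img u = tensor (MkUZ hu) (1 : k).
Proof.
rewrite /Defs.img; congr (tensor _ _); apply: val_inj; rewrite val_insubd /=.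
by rewrite hu.
Qed.

Lemma imgD u v : u \in UZp -> v \in UZp -> img (u + v) = img u + img v.
Proof.
move=> hu hv; have huv : u + v \in UZp by apply: rpredD.
by rewrite !imgE -tensorDl; congr (tensor _ _); apply: val_inj.
Qed.

Lemma imgM u v : u \in UZp -> v \in UZp -> img (u * v) = img u * img v.
Proof.
move=> hu hv; have huv : u * v \in UZp by apply: rpredM.
rewrite !imgE {2}/GRing.mul /= tens_mulE mul1r; congr (tensor _ _).
exact: val_inj.
Qed.

Lemma img1 : img 1 = 1.
Proof.
have h1 : (1 : U) \in UZp by apply: rpred1.
by rewrite imgE /GRing.one /=; congr (tensor _ _); apply: val_inj.
Qed.

Lemma img0 : img 0 = 0.
Proof. by apply: (addrI (img 0)); rewrite -imgD ?rpred0 // !addr0. Qed.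

Lemma img_sum (I : Type) (s : seq I) (P : pred I) (F : I -> U) :
  (forall i, P i -> F i \in UZp) -> img (\sum_(i <- s | P i) F i) = \sum_(i <- s | P i) img (F i).
Proof.
move=> hF; suff [] : img (\sum_(i <- s | P i) F i) = \sum_(i <- s | P i) img (F i) /\
   \sum_(i <- s | P i) F i \in UZp by [].
elim/big_rec2: _ => [|i u v Pi [<- hv]]; first by rewrite img0 rpred0.
by split; [rewrite imgD // hF|apply: rpredD => //; apply: hF].
Qed.

Lemma img_natZ (n : nat) u : u \in UZp -> img (n%:R *: u) = n%:R *: img u.
Proof.
move=> hu; rewrite !scaler_nat; elim: n => [|n IHn]; first by rewrite !mulr0n img0.
by rewrite !mulrS imgD ?IHn // rpredMn.
Qed.

Lemma hXE n : hX n = img (bX n). Proof. by rewrite /Defs.hX divpowE. Qed.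
Lemma hYE n : hY n = img (bY n). Proof. by rewrite /Defs.hY divpowE. Qed.

Lemma hX0 : hX 0 = 1. Proof. by rewrite hXE dp0 img1. Qed.
Lemma hY0 : hY 0 = 1. Proof. by rewrite hYE dp0 img1. Qed.

Lemma hXX m n : hX m * hX n = 'C(m + n, m)%:R *: hX (m + n).
Proof. by rewrite !hXE -imgM ?bX_UZ // dpD img_natZ ?bX_UZ. Qed.
Lemma hYY m n : hY m * hY n = 'C(m + n, m)%:R *: hY (m + n).
Proof. by rewrite !hYE -imgM ?bY_UZ // dpD img_natZ ?bY_UZ. Qed.

Definition coordZ (u : UZ R) m n (z : int) : int := sval (cid (coordU_int u m n z)).

Lemma coordZP u m n z : coordU (UZval u) m n z%:~R = (coordZ u m n z)%:~R.
Proof. by rewrite /coordZ; case: cid. Qed.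

Lemma coordZD u v m n z : coordZ (u + v) m n z = coordZ u m n z + coordZ v m n z.
Proof.
by apply: (@intr_inj C); rewrite rmorphD /= -!coordZP /= /coordU wactD.
Qed.

Definition coordf m n z (u : UZ R) (c : k) : k := (coordZ u m n z)%:~R * c.

Lemma coordf_bi m n z : biadditive (coordf m n z).
Proof. by split=> *; rewrite /coordf ?coordZD ?intrD (mulrDl, mulrDr). Qed.

Definition coord (u : hyp) m n z : k := tens_lift (coordf m n z) u.

Lemma coordD u v m n z : coord (u + v) m n z = coord u m n z + coord v m n z.
Proof. exact/tens_liftD/coordf_bi. Qed.

Lemma coord0 m n z : coord 0 m n z = 0.
Proof. exact/tens_lift0/coordf_bi. Qed.

Lemma coordZl c u m n z : coord (c *: u) m n z = c * coord u m n z.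
Proof.
elim/tens_ind: u => [|a d u IHu]; first by rewrite scaler0 coord0 mulr0.
rewrite scalerDr !coordD IHu mulrDr; congr (_ + _).
rewrite {1}/GRing.scale /= tens_scaleE /coord !tens_lift_tensor; try exact: coordf_bi.
by rewrite /coordf mulrCA.
Qed.

Lemma coord_sum (I : Type) (s : seq I) (P : pred I) (F : I -> hyp) m n z :
  coord (\sum_(i <- s | P i) F i) m n z = \sum_(i <- s | P i) coord (F i) m n z.
Proof. by elim/big_rec2: _ => [|i u v _ <-]; rewrite ?coord0 ?coordD. Qed.

Lemma coord_img u m n z w : u \in UZp -> coordU u m n z%:~R = w%:~R ->
  coord (img u) m n z = w%:~R.
Proof.
move=> hu hw; rewrite imgE /coord tens_lift_tensor; last exact: coordf_bi.
rewrite /coordf mulr1; congr (_%:~R); apply: (@intr_inj C).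
by rewrite -coordZP -hw.
Qed.

Lemma pbw_UZ m f n : intval f -> bY m * hf f * bX n \in UZp.
Proof. by move=> hfi; rewrite !rpredM ?bX_UZ ?bY_UZ ?hf_UZ. Qed.

Lemma coord_pbw a f b m n (z : int) (w : int) : intval f -> f.[z%:~R] = w%:~R ->
  coord (hY a * img (hf f) * hX b) m n z = ((m == a) && (n == b))%:R * w%:~R.
Proof.
move=> hfi hw; rewrite hYE hXE -!imgM ?rpredM ?bX_UZ ?bY_UZ ?hf_UZ //.
rewrite (@coord_img _ _ _ _ ((nat_of_bool ((m == a) && (n == b)))%:Z * w)).
- by rewrite intrM.
- exact: pbw_UZ.
- by rewrite coordU_pbw hw intrM.
Qed.

Definition hB (t : nat * nat * nat) : hyp := hY t.1.1 * hbinom R k 0 t.1.2 * hX t.2.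

Lemma hbinom_img c n : hbinom R k c n = img (hf (bpoly C n \Po ('X + c%:~R%:P))).
Proof.
rewrite /hbinom /ubinom; congr (Defs.img _ _).
rewrite evpE /bpoly comp_polyZ -mul_polyC rmorphM /= horner_algC mulr_algl.
congr (_ *: _); rewrite [_ \Po _](rmorph_prod (comp_poly _)) rmorph_prod /=.
apply: eq_bigr => i _; rewrite comp_polyB comp_polyX comp_polyC !rmorphB !rmorphD /=.
by rewrite horner_algX !horner_algC scaler_nat scaler_int.
Qed.

Lemma coord_hbinom a c n b i j z : coord (hY a * hbinom R k c n * hX b) i j z =
  ((i == a) && (j == b))%:R * bk k (z + c) n.
Proof.
rewrite hbinom_img; apply: coord_pbw; first exact/intval_shift/intval_bpoly.
by rewrite horner_comp hornerD hornerX hornerC -rmorphD /= bpoly_int.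
Qed.

Lemma coord_hB t i j z : coord (hB t) i j z =
  ((i == t.1.1) && (j == t.2))%:R * bk k z t.1.2.
Proof. by rewrite coord_hbinom addr0. Qed.

Lemma hyper_span (u : hyp) : exists s : seq (k * (nat * nat * nat)),
  u = \sum_(t <- s) t.1 *: hB t.2.
Proof.
elim/tens_ind: u => [|a c x [s ->]]; first by exists [::]; rewrite big_nil.
suff [s' ->] : exists s' : seq (k * (nat * nat * nat)), tensor a c = \sum_(t <- s') t.1 *: hB t.2.
  by exists (s' ++ s); rewrite big_cat.
have -> : tensor a c = c *: img (UZval a).
  rewrite (imgE (UZvalP a)) /GRing.scale /= tens_scaleE mulr1; congr (tensor _ _).
  exact: val_inj.
have [s' hs' ->] := UZ_spanZ (UZvalP a).
elim: s' hs' => [|t s' IHs] hs; first by exists [::]; rewrite !big_nil img0 scaler0.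
have [|s1 e1] := IHs; first by move=> t' ht'; apply: hs; rewrite inE ht' orbT.
have ht := hs t; rewrite inE eqxx /= in ht; have {ht}hti := ht isT.
rewrite big_cons imgD ?pbw_UZ //; last first.
  rewrite big_seq; apply: rpred_sum => t' ht'; apply: pbw_UZ.
  by apply: hs; rewrite inE ht' orbT.
rewrite scalerDr e1; set v := c *: _.
suff [s2 ->] : exists s2 : seq (k * (nat * nat * nat)), v = \sum_(t <- s2) t.1 *: hB t.2.
  by exists (s2 ++ s1); rewrite big_cat.
have [d hd] := intval_newton hti (leqnn _); rewrite {}/v {}hd.
move: (size t.1.2) => n.
exists [seq (c * (d i)%:~R, (t.1.1, i, t.2)) | i <- iota 0 n].
rewrite big_map -[n in iota _ n](subn0) -/(index_iota 0 n) big_mkord.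
have hiE i : hf (bpoly C i) \in UZp by apply/hf_UZ/intval_bpoly.
have hh : hf (\sum_(i < n) (d i)%:~R *: bpoly C i) =
          \sum_(i < n) hf (bpoly C i) *~ d i.
  elim: n => [|n IHn]; first by rewrite !big_ord0 evp0.
  by rewrite !big_ord_recr /= evpD IHn evpZ scaler_int.
rewrite hh mulr_sumr mulr_suml img_sum => [|i _]; last first.
  by rewrite !rpredM ?bX_UZ ?bY_UZ // rpredMz.
rewrite scaler_sumr; apply: eq_bigr => i _ /=.
rewrite -scalerA; congr (_ *: _); rewrite /hB /= hbinom_img comp_shift0.
rewrite !imgM ?rpredM ?bX_UZ ?bY_UZ ?rpredMz // -hXE -hYE scalerAl scalerAr.
congr (_ * _ * _); rewrite scaler_int.
case: (d i) => m.
  by elim: m => [|m IHm]; rewrite ?mulr0z ?img0 // -addn1 PoszD !mulrzDr imgD ?IHm ?rpredMz.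
suff e (m' : nat) : img (- (hf (bpoly C i) *+ m')) = - (img (hf (bpoly C i)) *+ m').
  by rewrite NegzE !mulrNz; apply: e.
apply/eqP; rewrite -addr_eq0; apply/eqP.
elim: m' => [|m' IHm]; first by rewrite !mulr0n oppr0 img0 addr0.
rewrite !mulrS opprD imgD ?rpredN ?rpredMn // addrACA IHm addr0 -imgD ?rpredN //.
by rewrite addNr img0.
Qed.

Definition coeffs (s : seq (k * (nat * nat * nat))) (key : nat * nat * nat) : k :=
  \sum_(t <- s | t.2 == key) t.1.

Lemma coeffs_sum s : \sum_(t <- s) t.1 *: hB t.2 =
  \sum_(key <- undup [seq t.2 | t <- s]) coeffs s key *: hB key.
Proof.
under [RHS]eq_bigr => key _ do rewrite /coeffs scaler_suml.
rewrite (exchange_big_dep xpredT) // [LHS]big_seq [RHS]big_seq.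
apply: eq_bigr => t ts; rewrite -big_filter.
rewrite (_ : [seq _ <- _ | _] = [:: t.2]) ?big_seq1 //.
rewrite (eq_filter (a2 := pred1 t.2)); last by move=> x; rewrite [RHS]eq_sym.
by rewrite filter_pred1_uniq ?undup_uniq // mem_undup map_f.
Qed.

(** Once equal keys are collected, evaluate at the weight n: binom(n, n) = 1, the binomials of
    degree greater than n vanish there, and those of smaller degree already have coefficient zero by
    induction. *)
Lemma coord_inj u : (forall m n z, coord u m n z = 0) -> u = 0.
Proof.
have [s ->] := hyper_span u; rewrite coeffs_sum => h.
set K := undup _ in h *.
suff c0 n m m' : (m, n, m') \in K -> coeffs s (m, n, m') = 0.
  by rewrite big_seq big1 // => -[[m n] m'] hK; rewrite c0 // scale0r.
elim/ltn_ind: n => n IHn hK.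
have := h m m' n; rewrite coord_sum (bigD1_seq (m, n, m')) ?undup_uniq //=.
rewrite coordZl coord_hB /= !eqxx mul1r bk_nat binn mulr1 big_seq_cond big1 ?addr0 //.
move=> -[[a b] c] /= /andP[hK' ne]; rewrite coordZl coord_hB /=.
have [ma|] := eqVneq m a; last by rewrite mul0r mulr0.
have [mc|] := eqVneq m' c; last by rewrite mul0r mulr0.
rewrite -ma -mc in hK' ne *; rewrite mul1r.
have [bn|nb] := ltnP b n; first by rewrite IHn // mul0r.
rewrite bk_nat bin_small ?mulr0 // ltn_neqAle nb andbT.
by apply: contra ne => /eqP ->.
Qed.

Lemma coord_eq u v : (forall m n z, coord u m n z = coord v m n z) -> u = v.
Proof.
move=> h; apply/eqP; rewrite -subr_eq0; apply/eqP/coord_inj => m n z.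
by rewrite coordD -scaleN1r coordZl mulN1r h subrr.
Qed.

End Hyper.

(** * The elements phi(H) and the map Fr' *)

Section WeightFunctions.
Variables (R : realType) (k : closedFieldType) (p : nat).
Hypothesis hp : p \in [pchar k].
Local Notation C := (R[i]).
Local Notation hyp := (hyper R k).
Local Notation hX := (hX R k).
Local Notation hY := (hY R k).
Local Notation img := (@img R k).
Local Notation hf := (evp (Uh R)).
Local Notation coord := (@coord R k).

Let p_pr : prime p. Proof. exact: pcharf_prime hp. Qed.
Let p_gt0 : (0 < p)%N. Proof. exact: prime_gt0 p_pr. Qed.

Lemma sandwich (u : hyp) : hY 0 * u * hX 0 = u.
Proof. by rewrite hX0 hY0 mul1r mulr1. Qed.

Definition is_hT (phi : int -> k) (u : hyp) : Prop :=
  forall m n z, coord u m n z = ((m == 0%N) && (n == 0%N))%:R * phi z.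

(** The element phi(H), specified by its coordinates, which determine it. It exists when phi is
    periodic modulo a power of p; the default 0 is not reached for such phi. *)
Definition hT (phi : int -> k) : hyp := xget 0 [set u | is_hT phi u].

Lemma isT_uniq phi u v : is_hT phi u -> is_hT phi v -> u = v.
Proof. by move=> hu hv; apply: coord_eq => m n z; rewrite hu hv. Qed.

Lemma hTE phi u : is_hT phi u -> hT phi = u.
Proof.
rewrite /hT => hu; case: xgetP => [v _ hv|/(_ u)]; last by [].
exact: isT_uniq hv hu.
Qed.

(** The idempotent of the weights congruent to b modulo p^r; [mu] is the case r = 1. *)
Definition hdelta r b : hyp := hbinom R k (- b - 1) (p ^ r).-1.

Lemma isT_binom c n : is_hT (fun z => bk k (z + c) n) (hbinom R k c n).
Proof.
by move=> i j z; rewrite -[hbinom _ _ _ _]sandwich coord_hbinom.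
Qed.

Lemma isT_delta r b : is_hT (delta k p r b) (hdelta r b).
Proof.
move=> i j z; rewrite isT_binom (bk_delta hp) /delta; congr (_ * (nat_of_bool (_ %| _)%Z)%:R).
by ring.
Qed.

Lemma isT_sum r (c : 'I_(p ^ r) -> k) :
  is_hT (fun z => \sum_b c b * delta k p r b%:Z z) (\sum_b c b *: hdelta r b%:Z).
Proof.
move=> i j z; rewrite coord_sum mulr_sumr; apply: eq_bigr => b _.
by rewrite coordZl isT_delta mulrCA.
Qed.

Lemma isT_ext phi psi u : phi =1 psi -> is_hT phi u -> is_hT psi u.
Proof. by move=> e h i j z; rewrite h e. Qed.

Lemma isT_per r phi : per p r phi ->
  is_hT phi (\sum_(b < p ^ r) phi b%:Z *: hdelta r b%:Z).
Proof.
by move=> h; apply: isT_ext (isT_sum _) => z; rewrite -(delta_sum hp).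
Qed.

Lemma hT_sum r phi : per p r phi ->
  hT phi = \sum_(b < p ^ r) phi b%:Z *: hdelta r b%:Z.
Proof. by move=> h; apply/hTE/isT_per. Qed.

Lemma isT_hT r phi : per p r phi -> is_hT phi (hT phi).
Proof. by move=> h; rewrite (hT_sum h); apply: isT_per. Qed.

Lemma hT_ext phi psi : phi =1 psi -> hT phi = hT psi.
Proof. by move=> e; congr hT; apply/funext. Qed.

Lemma hT_delta r b : hT (delta k p r b) = hdelta r b.
Proof. exact/hTE/isT_delta. Qed.

Lemma hT_binom c n : hT (fun z => bk k (z + c) n) = hbinom R k c n.
Proof. exact/hTE/isT_binom. Qed.

Lemma hTZ r c phi : per p r phi -> hT (fun z => c * phi z) = c *: hT phi.
Proof.
move=> h; apply: hTE => i j z; rewrite coordZl (isT_hT h); ring.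
Qed.

Lemma hTD r phi psi : per p r phi -> per p r psi ->
  hT (fun z => phi z + psi z) = hT phi + hT psi.
Proof.
move=> h1 h2; apply: hTE => i j z; rewrite coordD (isT_hT h1) (isT_hT h2); ring.
Qed.

Lemma hT0 : hT (fun=> 0) = 0.
Proof. by apply: hTE => i j z; rewrite coord0 mulr0. Qed.

Lemma hbinom0 c : hbinom R k c 0 = 1.
Proof. by rewrite hbinom_img bpoly0 comp_polyC evp1 img1. Qed.

Lemma hT1 : hT (fun=> 1) = 1.
Proof.
by rewrite -(hbinom0 0) -hT_binom; apply: hT_ext => z; rewrite bk0.
Qed.

Definition dpoly r (b : int) : {poly C} := bpoly C (p ^ r).-1 \Po ('X + (- b - 1)%:~R%:P).

Lemma intval_dpoly r b : intval (dpoly r b).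
Proof. exact/intval_shift/intval_bpoly. Qed.

Lemma dpoly_UZ r b : hf (dpoly r b) \in @UZpred R.
Proof. exact/hf_UZ/intval_dpoly. Qed.

Lemma hdelta_img r b : hdelta r b = img (hf (dpoly r b)).
Proof. by rewrite /hdelta hbinom_img. Qed.

(** The product is formed before the reduction to k, where both factors are integer-valued
    polynomials in H, so their values multiply. *)
Lemma hdeltaM r b c : hdelta r b * hdelta r c = hT (fun z => delta k p r b z * delta k p r c z).
Proof.
apply/esym/hTE => i j z; rewrite !hdelta_img -imgM ?dpoly_UZ //.
rewrite -evpM -[img _]sandwich.
have [w ew] := intval_dpoly r b z; have [v ev] := intval_dpoly r c z.
have hd b' w' : (dpoly r b').[z%:~R] = w'%:~R -> delta k p r b' z = w'%:~R.
  move=> hw; have := isT_delta r b' 0 0 z; rewrite mul1r => <-.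
  rewrite hdelta_img -[img _]sandwich.
  by rewrite (coord_pbw _ _ _ _ _ (intval_dpoly r b') hw) mul1r.
rewrite (coord_pbw _ _ _ _ _ (w := w * v)).
- by rewrite (hd _ _ ew) (hd _ _ ev) rmorphM.
- by apply: intvalM; apply: intval_dpoly.
- by rewrite hornerM ew ev rmorphM.
Qed.

Lemma hTM r phi psi : per p r phi -> per p r psi ->
  hT phi * hT psi = hT (fun z => phi z * psi z).
Proof.
move=> h1 h2; rewrite (hT_sum h1) (hT_sum h2) mulr_suml.
apply/esym/hTE => i j z; rewrite coord_sum.
rewrite (delta_sum hp h1 z) (delta_sum hp h2 z) mulr_suml mulr_sumr.
apply: eq_bigr => b _; rewrite mulr_sumr coord_sum mulr_sumr mulr_sumr.
apply: eq_bigr => c _; rewrite -scalerAl -scalerAr !coordZl hdeltaM.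
by rewrite (isT_hT (per_mul (delta_per k p r b) (delta_per k p r c))); ring.
Qed.

Lemma hdelta_X r b n : hdelta r b * hX n = hX n * hdelta r (b - (n.*2)%:Z).
Proof.
rewrite !hdelta_img !hXE -!imgM ?dpoly_UZ ?bX_UZ //.
rewrite (evp_dpx (UHX R)) /dpoly comp_shift.
suff -> : (- b - 1)%:~R + (n.*2)%:R = (- (b - (n.*2)%:Z) - 1)%:~R :> C by [].
by rewrite pmulrn -intrD; congr (_%:~R); ring.
Qed.

Lemma hdelta_Y r b n : hdelta r b * hY n = hY n * hdelta r (b + (n.*2)%:Z).
Proof.
rewrite !hdelta_img !hYE -!imgM ?dpoly_UZ ?bY_UZ //.
rewrite (evp_dpy (UHY R)) /dpoly -polyCN comp_shift.
suff -> : (- b - 1)%:~R + - (n.*2)%:R = (- (b + (n.*2)%:Z) - 1)%:~R :> C by [].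
by rewrite pmulrn -mulrNz -intrD; congr (_%:~R); ring.
Qed.

Lemma hT_X r phi n : per p r phi -> hT phi * hX n = hX n * hT (fun z => phi (z + (n.*2)%:Z)).
Proof.
move=> h; rewrite (hT_sum h) mulr_suml.
under eq_bigr => b _ do rewrite -scalerAl hdelta_X scalerAr.
rewrite -mulr_sumr; congr (_ * _); apply/esym/hTE => i j z.
rewrite coord_sum (delta_sum hp h) mulr_sumr; apply: eq_bigr => b _.
rewrite coordZl isT_delta mulrCA /delta; congr (_ * (_ * (nat_of_bool (_ %| _)%Z)%:R)).
ring.
Qed.

Lemma hT_Y r phi n : per p r phi -> hT phi * hY n = hY n * hT (fun z => phi (z - (n.*2)%:Z)).
Proof.
move=> h; rewrite (hT_sum h) mulr_suml.
under eq_bigr => b _ do rewrite -scalerAl hdelta_Y scalerAr.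
rewrite -mulr_sumr; congr (_ * _); apply/esym/hTE => i j z.
rewrite coord_sum (delta_sum hp h) mulr_sumr; apply: eq_bigr => b _.
rewrite coordZl isT_delta mulrCA /delta; congr (_ * (_ * (nat_of_bool (_ %| _)%Z)%:R)).
ring.
Qed.

Lemma coord_T r a phi b m n z : per p r phi ->
  coord (hY a * hT phi * hX b) m n z = ((m == a) && (n == b))%:R * phi z.
Proof.
move=> h; rewrite (hT_sum h) mulr_sumr mulr_suml coord_sum [in RHS](delta_sum hp h) mulr_sumr.
apply: eq_bigr => c _; rewrite -scalerAr -scalerAl coordZl coord_hbinom (bk_delta hp).
rewrite mulrCA /delta; congr (_ * (_ * (nat_of_bool (_ %| _)%Z)%:R)).
ring.
Qed.

Lemma hXY m n : hX m * hY n =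
  \sum_(i < m.+1 | (i <= n)%N) hY (n - i) * hT (xyk k m n i) * hX (m - i).
Proof.
rewrite hXE hYE -imgM ?bX_UZ ?bY_UZ // (dpx_dpy (UXY R) (UHX R) (UHY R)).
have hi i : hf (xyc C m n i) \in @UZpred R by apply/hf_UZ/intval_xyc.
rewrite img_sum => [|i _]; last by rewrite !rpredM ?bX_UZ ?bY_UZ.
apply: eq_bigr => i _; rewrite !imgM ?rpredM ?bX_UZ ?bY_UZ // -hXE -hYE.
by congr (_ * _ * _); rewrite /xyk hT_binom hbinom_img.
Qed.

Lemma isT_img f phi : @intval C f ->
  (forall z, exists2 w : int, f.[z%:~R] = w%:~R & phi z = w%:~R) -> hT phi = img (hf f).
Proof.
move=> hfi h; apply: hTE => i j z; have [w ew ->] := h z.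
by rewrite -[img _]sandwich (coord_pbw _ _ _ _ _ hfi ew).
Qed.

Lemma hYX m n : hY m * hX n =
  \sum_(i < m.+1 | (i <= n)%N) hX (n - i) * hT (yxk k m n i) * hY (m - i).
Proof.
(* (Y, X, -H) is again an sl_2-triple, so [dpx_dpy] applies with the roles of X and Y exchanged. *)
have r1 : Uy R * Ux R = Ux R * Uy R + - Uh R by rewrite UXY addrK.
have r2 : - Uh R * Uy R = Uy R * (- Uh R + 2%:R).
  by rewrite mulNr UHY -mulrN opprB addrC.
have r3 : - Uh R * Ux R = Ux R * (- Uh R - 2%:R).
  by rewrite mulNr UHX -mulrN opprD.
rewrite hXE hYE -imgM ?bX_UZ ?bY_UZ // (dpx_dpy r1 r2 r3).
have eN f : evp (- Uh R) f = hf (f \Po (- 'X)).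
  rewrite !evpE; elim/poly_ind: f => [|f c IHf]; first by rewrite comp_poly0 !rmorph0.
  rewrite comp_polyD comp_polyM comp_polyC comp_polyX !rmorphD !rmorphM /= IHf.
  by rewrite rmorphN /= !horner_algX !horner_algC.
have hi i : intval (xyc C m n i \Po (- 'X)) by apply/intvalN/intval_xyc.
rewrite img_sum => [|i _]; last by rewrite eN !rpredM ?bX_UZ ?bY_UZ ?hf_UZ.
apply: eq_bigr => i _; rewrite eN !imgM ?rpredM ?bX_UZ ?bY_UZ ?hf_UZ // -hXE -hYE.
congr (_ * _ * _); apply/esym/isT_img => // z.
exists (binz (- z + ((i.*2)%:Z - m%:Z - n%:Z)) i) => //.
rewrite horner_comp /xyc horner_comp hornerD hornerN !hornerX hornerC -rmorphN -rmorphD /=.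
by rewrite bpoly_int.
Qed.

(** [Fr'] is a choice among the linear maps with the prescribed values, so one such map has to be
    exhibited. It is built as a relation between coordinates, which is functional because
    coordinates determine an element and total because the basis elements span. *)
Lemma FrP : exists f : hyp -> hyp, linear f /\
  (forall m n m', f (hY m * hbinom R k 0 n * hX m') =
         hY (m * p) * hbinom R k 0 (n * p) * hX (m' * p)) /\
  (forall u m n z, coord (f u) m n z =
    if (p %| m)%N && (p %| n)%N then coord u (m %/ p)%N (n %/ p)%N (z %/ p)%Z else 0).
Proof.
pose Fr (u : hyp) (v : hyp) := forall m n z, coord v m n z =
  if (p %| m)%N && (p %| n)%N then coord u (m %/ p)%N (n %/ p)%N (z %/ p)%Z else 0.
have FrB m n m' : Fr (hY m * hbinom R k 0 n * hX m')
                     (hY (m * p) * hbinom R k 0 (n * p) * hX (m' * p)).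
  move=> i j z; rewrite !coord_hbinom !addr0.
  have [z0 [z' [z0p -> _ _]]] := int_divp hp z.
  rewrite (divz_add hp) // -[(n * p)%N]add0n (lucas hp) // bk0 mul1r.
  have [/dvdnP[i' ->]|ni] := boolP (p %| i)%N; last first.
    case: eqP => [e|]; last by rewrite mul0r.
    by move: ni; rewrite e dvdn_mull.
  have [/dvdnP[j' ->]|nj] := boolP (p %| j)%N; last first.
    rewrite andbC; case: eqP => [e|]; last by rewrite mul0r.
    by move: nj; rewrite e dvdn_mull.
  by rewrite /= !mulnK // !eqn_pmul2r.
have FrL c u v u' v' : Fr u u' -> Fr v v' -> Fr (c *: u + v) (c *: u' + v').
  move=> h1 h2 m n z; rewrite !coordD !coordZl h1 h2.
  by case: ifP => // _; rewrite mulr0 addr0.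
have Fr0 : Fr 0 0 by move=> m n z; rewrite !coord0 if_same.
have FrU u v v' : Fr u v -> Fr u v' -> v = v'.
  by move=> h1 h2; apply: coord_eq => m n z; rewrite h1 h2.
have FrE u : exists v, Fr u v.
  have [s ->] := hyper_span u; elim: s => [|t s [v hv]].
    by exists 0; rewrite big_nil.
  rewrite big_cons; eexists; apply: FrL hv; exact: FrB.
exists (fun u => sval (cid (FrE u))); split; last split.
- move=> c u v; apply: FrU (svalP (cid (FrE _))) _.
  by apply: FrL; apply: (svalP (cid (FrE _))).
- by move=> m n m'; apply: FrU (svalP (cid (FrE _))) _.
- by move=> u; apply: (svalP (cid (FrE u))).
Qed.

Local Notation Fr' := (@Fr' R k p).

Lemma Fr_linear : linear Fr'.
Proof.
rewrite /Defs.Fr'; case: xgetP => [f _ [] //|h].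
by have [f [f1 [f2 f3]]] := FrP; case: (h f).
Qed.

Lemma Fr_basis m n m' : Fr' (hY m * hbinom R k 0 n * hX m') =
  hY (m * p) * hbinom R k 0 (n * p) * hX (m' * p).
Proof.
rewrite /Defs.Fr'; case: xgetP => [f _ [] //|h].
by have [f [f1 [f2 f3]]] := FrP; case: (h f).
Qed.

Lemma FrZD c u v : Fr' (c *: u + v) = c *: Fr' u + Fr' v.
Proof. exact: Fr_linear. Qed.
Lemma FrD u v : Fr' (u + v) = Fr' u + Fr' v.
Proof. by have := FrZD 1 u v; rewrite !scale1r. Qed.
Lemma Fr0 : Fr' 0 = 0.
Proof. by apply: (addrI (Fr' 0)); rewrite -FrD !addr0. Qed.
Lemma FrZ c u : Fr' (c *: u) = c *: Fr' u.
Proof. by have := FrZD c u 0; rewrite Fr0 !addr0. Qed.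

(** Linear maps with the same values on a spanning family coincide, so the chosen map has the
    coordinates of the constructed one. *)
Lemma Fr_coord u m n z : coord (Fr' u) m n z =
  if (p %| m)%N && (p %| n)%N then coord u (m %/ p)%N (n %/ p)%N (z %/ p)%Z else 0.
Proof.
have [f [f1 [f2 f3]]] := FrP; rewrite -f3; congr coord.
have f0 : f 0 = 0.
  by have := f1 1 0 0; rewrite !scale1r addr0 => e; apply: (addrI (f 0)); rewrite addr0 -e.
have [s ->] := hyper_span u; elim: s => [|t s IHs]; first by rewrite !big_nil Fr0 f0.
by rewrite !big_cons FrZD f1 IHs /hB Fr_basis f2.
Qed.

Lemma Fr_T r m n phi : per p r phi ->
  Fr' (hY m * hT phi * hX n) = hY (m * p) * hT (fdiv p phi) * hX (n * p).
Proof.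
move=> h; apply: coord_eq => i j z; rewrite Fr_coord (coord_T _ _ _ _ _ h).
rewrite (coord_T _ _ _ _ _ (fdiv_per hp h)).
have [/dvdnP[i' ->]|ni] := boolP (p %| i)%N; last first.
  case: (i =P (m * p)%N) => [e|]; last by rewrite mul0r.
  by move: ni; rewrite e dvdn_mull.
have [/dvdnP[j' ->]|nj] := boolP (p %| j)%N; last first.
  rewrite [(_ == _) && (j == _)]andbC andbF; case: (j =P (n * p)%N) => [e|]; last by rewrite mul0r.
  by move: nj; rewrite e dvdn_mull.
by rewrite /= !mulnK // !eqn_pmul2r.
Qed.

End WeightFunctions.

(** * The socle *)

(* [gX n] and [gY n] are the divided powers, [gT phi] is phi(H), and [gcoord]
   reads the coefficients in the order Y, H, X, the middle one as a function of
   the weight. *)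
Record hyperlike (k : fieldType) (p : nat) (A : algType k) := Hyperlike {
  gX : nat -> A; gY : nat -> A; gT : (int -> k) -> A;
  gcoord : A -> nat -> nat -> int -> k;
  gX0 : gX 0 = 1; gY0 : gY 0 = 1;
  gXX : forall m n, gX m * gX n = 'C(m + n, m)%:R *: gX (m + n);
  gYY : forall m n, gY m * gY n = 'C(m + n, m)%:R *: gY (m + n);
  gT0 : gT (fun=> 0) = 0;
  gT1 : gT (fun=> 1) = 1;
  gTZ : forall r (c : k) (phi : int -> k), per p r phi -> gT (fun z => c * phi z) = c *: gT phi;
  gTD : forall r (phi psi : int -> k), per p r phi -> per p r psi ->
    gT (fun z => phi z + psi z) = gT phi + gT psi;
  gTM : forall r (phi psi : int -> k), per p r phi -> per p r psi ->
    gT phi * gT psi = gT (fun z => phi z * psi z);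
  gTX : forall r (phi : int -> k) n, per p r phi ->
    gT phi * gX n = gX n * gT (fun z => phi (z + (n.*2)%:Z));
  gTY : forall r (phi : int -> k) n, per p r phi ->
    gT phi * gY n = gY n * gT (fun z => phi (z - (n.*2)%:Z));
  gXY : forall m n, gX m * gY n =
    \sum_(i < m.+1 | (i <= n)%N) gY (n - i) * gT (xyk k m n i) * gX (m - i);
  gYX : forall m n, gY m * gX n =
    \sum_(i < m.+1 | (i <= n)%N) gX (n - i) * gT (yxk k m n i) * gY (m - i);
  gcoordD : forall u v m n z, gcoord (u + v) m n z = gcoord u m n z + gcoord v m n z;
  gcoordZ : forall (c : k) u m n z, gcoord (c *: u) m n z = c * gcoord u m n z;
  gcoordT : forall r a (phi : int -> k) b m n z, per p r phi ->
    gcoord (gY a * gT phi * gX b) m n z = ((m == a) && (n == b))%:R * phi z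
}.

Section Socle.
Variables (k : fieldType) (p : nat).
Hypothesis hp : p \in [pchar k].
Variables (A : algType k) (G : hyperlike p A).
Local Notation X := (gX G).
Local Notation Y := (gY G).
Local Notation T := (gT G).
Local Notation coord := (gcoord G).

Lemma gTeq phi psi : phi =1 psi -> T phi = T psi.
Proof. by move=> e; congr T; apply/funext. Qed.

Lemma gcoord0 m n z : coord 0 m n z = 0.
Proof. by rewrite -(scale0r 0) gcoordZ mul0r. Qed.

Lemma gcoord_sum (I : Type) (s : seq I) (P : pred I) (F : I -> A) m n z :
  coord (\sum_(i <- s | P i) F i) m n z = \sum_(i <- s | P i) coord (F i) m n z.
Proof. by elim/big_rec2: _ => [|i u v _ <-]; rewrite ?gcoord0 ?gcoordD. Qed.

Lemma gXT r phi n : per p r phi -> X n * T phi = T (fun z => phi (z - (n.*2)%:Z)) * X n.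
Proof.
move=> h; rewrite (gTX G (r := r)); last exact: per_shift.
by congr (_ * _); apply: gTeq => z /=; rewrite addrK.
Qed.

Variable r : nat.
Local Notation q := (p ^ r)%N.
Local Notation N := (p ^ r).-1.

Let q_gt0 : (0 < q)%N.
Proof. by rewrite expn_gt0 prime_gt0 // (pcharf_prime hp). Qed.

Lemma leq_pred_pexp n : (n <= N)%N = (n < q)%N. Proof. by rewrite -[in RHS](prednK q_gt0). Qed.

Lemma xyk_per m n i : (i < q)%N -> per p r (xyk k m n i).
Proof. by move=> iq z; rewrite /xyk addrAC (bk_per hp). Qed.

Lemma yxk_per m n i : (i < q)%N -> per p r (yxk k m n i).
Proof.
move=> iq z; rewrite /yxk -[LHS](bk_per hp _ iq); congr bk; ring.
Qed.

Definition mu_ (b : int) : A := T (delta k p r b).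

Lemma delta_shift (s : nat) b c z : delta k p s b (z + c) = delta k p s (b - c) z.
Proof. by rewrite /delta opprB addrA. Qed.

Lemma deltaE_mod (s : nat) b c : ((p ^ s)%N%:Z %| b - c)%Z -> delta k p s b =1 delta k p s c.
Proof.
move=> h z; rewrite /delta; congr ((nat_of_bool _)%:R).
have -> : z - c = (z - b) + (b - c) by ring.
by rewrite [RHS]rpredDr.
Qed.

Lemma mu_mod b c : (q%:Z %| b - c)%Z -> mu_ b = mu_ c.
Proof. by move=> h; apply/gTeq/deltaE_mod. Qed.

Lemma per_delta phi b z : per p r phi -> phi z * delta k p r b z = phi b * delta k p r b z.
Proof.
move=> h; rewrite /delta; case: dvdzP => [[w e]|_]; last by rewrite !mulr0.
have -> : z = b + w * q%:Z by rewrite -e addrC subrK.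
by rewrite (perMz h).
Qed.

Lemma T_mu phi b : per p r phi -> T phi * mu_ b = phi b *: mu_ b.
Proof.
move=> h; rewrite /mu_ (gTM G h (delta_per _ _ _ _)) -(gTZ G (r := r)); last exact: delta_per.
by apply: gTeq => z; exact: per_delta.
Qed.

Lemma deltaXX (s : nat) b z : delta k p s b z * delta k p s b z = delta k p s b z.
Proof. by rewrite /delta -natrM mulnb andbb. Qed.

Lemma delta_id (s : nat) b : delta k p s b b = 1.
Proof. by rewrite /delta subrr dvdz0. Qed.

Lemma mu_mu b : mu_ b * mu_ b = mu_ b.
Proof. by rewrite T_mu ?delta_id ?scale1r //; exact: delta_per. Qed.

Lemma mu_X b n : mu_ b * X n = X n * mu_ (b - (n.*2)%:Z).
Proof.
rewrite (gTX G (r := r)); last exact: delta_per.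
by congr (_ * _); apply: gTeq => z; rewrite delta_shift.
Qed.

Lemma X_mu b n : X n * mu_ b = mu_ (b + (n.*2)%:Z) * X n.
Proof. by rewrite mu_X addrK. Qed.

Lemma mu_Y b n : mu_ b * Y n = Y n * mu_ (b + (n.*2)%:Z).
Proof.
rewrite (gTY G (r := r)); last exact: delta_per.
by congr (_ * _); apply: gTeq => z; rewrite delta_shift opprK.
Qed.

Lemma Y_mu b n : Y n * mu_ b = mu_ (b - (n.*2)%:Z) * Y n.
Proof. by rewrite mu_Y subrK. Qed.

Lemma mu_sum : \sum_(b < q) mu_ b%:Z = 1.
Proof.
rewrite -(gT1 G); symmetry.
transitivity (T (fun z => \sum_(b < q) delta k p r b%:Z z)).
  apply: gTeq => z; rewrite [LHS](delta_sum hp (r := r) (phi := fun=> 1) _ z) //.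
  by apply: eq_bigr => b _; rewrite mul1r.
suff : forall n, T (fun z => \sum_(b < n) delta k p r b%:Z z) = \sum_(b < n) mu_ b%:Z by apply.
elim=> [|n IHn].
  by rewrite big_ord0 -(gT0 G); apply: gTeq => z; rewrite big_ord0.
rewrite big_ord_recr /= -IHn -(gTD G (r := r)); last first.
- exact: delta_per.
- by move=> z; apply: eq_bigr => b _; rewrite delta_per.
by apply: gTeq => z; rewrite big_ord_recr.
Qed.

Lemma gXX_small m n : (m < q)%N -> (n < q)%N ->
  X m * X n = (if (m + n < q)%N then 'C(m + n, m)%:R else 0) *: X (m + n).
Proof.
move=> mq nq; rewrite gXX; case: ltnP => // h.
by rewrite addnC (bin_carry hp nq mq) // addnC.
Qed.

Lemma gYY_small m n : (m < q)%N -> (n < q)%N ->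
  Y m * Y n = (if (m + n < q)%N then 'C(m + n, m)%:R else 0) *: Y (m + n).
Proof.
move=> mq nq; rewrite gYY; case: ltnP => // h.
by rewrite addnC (bin_carry hp nq mq) // addnC.
Qed.

Definition lowest (lam : int) (v : A) : Prop :=
  (forall i, (0 < i < q)%N -> Y i * v = 0) /\ mu_ (- lam) * v = v.

Lemma lowest_T lam v phi : lowest lam v -> per p r phi -> T phi * v = phi (- lam) *: v.
Proof. by move=> [_ <-] h; rewrite mulrA T_mu // -scalerAl. Qed.

(** In the straightened product every term that keeps a positive divided power of Y on the right
    kills v, which leaves the last one. *)
Lemma lowest_YX lam v i n : lowest lam v -> (i < q)%N -> (n < q)%N ->
  Y i * (X n * v) = if (i <= n)%N then bk k (lam - n%:Z + i%:Z) i *: (X (n - i) * v) else 0.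
Proof.
move=> hv iq nq; rewrite mulrA gYX mulr_suml big_mkcond big_ord_recr /=.
rewrite big1 ?add0r => [|j _].
  case: leqP => // lein; rewrite subnn gY0 mulr1 -mulrA (lowest_T hv); last exact: yxk_per.
  by rewrite -scalerAr; congr (_ *: _); rewrite /yxk; congr bk; rewrite -addnn PoszD; ring.
case: leqP => // _; rewrite -mulrA; case: hv => -> //; first by rewrite mulr0.
by rewrite subn_gt0 ltn_ord /= (leq_ltn_trans (leq_subr _ _) iq).
Qed.

Lemma T_XV phi n lam v : lowest lam v -> per p r phi ->
  T phi * (X n * v) = phi (- lam + (n.*2)%:Z) *: (X n * v).
Proof.
move=> hv h; rewrite mulrA (gTX G n h) -mulrA (lowest_T hv); last exact: per_shift.
by rewrite -scalerAr.
Qed.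

(** * Left ideals generated by lowest weight vectors *)

Section Sub.
Variable V : A -> Prop.
Hypothesis VT : forall phi, per p r phi -> V (T phi).
Hypothesis VX : forall n, (n < q)%N -> V (X n).
Hypothesis VY : forall n, (n < q)%N -> V (Y n).
Hypothesis VM : forall u v, V u -> V v -> V (u * v).
Hypothesis VZ : forall c u, V u -> V (c *: u).
Hypothesis Vspan : forall u, V u -> exists phi : nat -> nat -> int -> k,
  (forall m n, per p r (phi m n)) /\
  u = \sum_(m < q) \sum_(n < q) Y m * T (phi m n) * X n.

Lemma lowest_orbit lam v u : lowest lam v -> V u ->
  exists c : nat -> k, u * v = \sum_(n < q) c n *: (X n * v).
Proof.
move=> hv /Vspan [phi [hphi ->]].
have P0 : exists c : nat -> k, 0 = \sum_(n < q) c n *: (X n * v).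
  by exists (fun=> 0); rewrite big1 // => i _; rewrite scale0r.
have PD w w' : (exists c : nat -> k, w = \sum_(n < q) c n *: (X n * v)) ->
   (exists c : nat -> k, w' = \sum_(n < q) c n *: (X n * v)) ->
   exists c : nat -> k, w + w' = \sum_(n < q) c n *: (X n * v).
  move=> [c ->] [d ->]; exists (fun n => c n + d n); rewrite -big_split /=.
  by apply: eq_bigr => i _; rewrite scalerDl.
rewrite mulr_suml; elim/big_ind: _ => // m _.
rewrite mulr_suml; elim/big_ind: _ => // n _.
rewrite -!mulrA (T_XV n hv) // -scalerAr (lowest_YX hv) //.
case: leqP => mn; last by rewrite scaler0.
have nmq : (n - m < q)%N by apply: leq_ltn_trans (leq_subr _ _) (ltn_ord n).
rewrite scalerA; set c := _ * _; exists (fun i => if i == (n - m)%N then c else 0).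
rewrite (bigD1 (Ordinal nmq)) //= eqxx big1 ?addr0 // => i ni.
case: eqP => [e|]; last by rewrite scale0r.
by case/negP: ni; apply/eqP/val_inj.
Qed.

(* [bk (lam - n + i) i] is ['C(lam - s, n - s)] with [s = n - i]. *)
Lemma bk_sub_zero (lam n i : nat) : (i <= n)%N -> 'C(lam, n)%:R = 0 :> k ->
  'C(lam, n - i)%:R != 0 :> k -> bk k (lam%:Z - n%:Z + i%:Z) i = 0.
Proof.
move=> lin h0 h1.
have sl : (n - i <= lam)%N.
  by rewrite leqNgt; apply: contra h1 => h; rewrite bin_small.
have -> : lam%:Z - n%:Z + i%:Z = (lam - (n - i))%N%:Z by lia.
have := bin_sub_zero (leq_subr i n) h0 h1; by rewrite subKn // bk_nat.
Qed.

Definition fvec (lam : nat) (l : nat) : A := Y N * mu_ (- lam%:Z - 2) * X (N - l).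

(** The origin of the weight -lam - 2 in [fvec]: an idempotent moved from the left to the right of
    Y^(N) has its weight increased by 2N, which is -2 modulo q. *)
Lemma dvd_weight (lam : int) : (q%:Z %| - lam + (N.*2)%:Z - (- lam - 2))%Z.
Proof.
have -> : - lam + (N.*2)%:Z - (- lam - 2) = 2 * q%:Z by have := prednK q_gt0; lia.
exact: dvdz_mull.
Qed.

Lemma lowest_fvec_gen (lam : int) u : lowest lam (Y N * mu_ (- lam - 2) * u).
Proof.
split=> [i /andP[i0 iq]|].
  rewrite !mulrA gYY_small ?leq_pred_pexp ?prednK // ifF ?scale0r ?mul0r //.
  by apply/negbTE; rewrite -leqNgt; have := prednK q_gt0; lia.
rewrite !mulrA mu_Y -[Y N * _ * _]mulrA; congr (_ * _ * _).
rewrite -[RHS]mu_mu; congr (_ * _); apply: mu_mod.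
exact: dvd_weight.
Qed.

Lemma lowest_fvec lam l : lowest lam%:Z (fvec lam l).
Proof. exact: lowest_fvec_gen. Qed.

Lemma X_fgen (lam : int) (t n : nat) : (n < q)%N ->
  X n * (Y N * mu_ (- lam - 2) * X t) =
  \sum_(i < n.+1) (bk k (n%:Z - lam - 1) i * 'C(n - i + t, n - i)%:R) *:
     (Y (N - i) * mu_ (- lam - 2 + ((n - i).*2)%:Z) * X (n - i + t)).
Proof.
move=> nq; rewrite !mulrA gXY !mulr_suml big_mkcond; apply: eq_bigr => i _.
have iq : (i < q)%N by apply: leq_ltn_trans nq; rewrite -ltnS.
rewrite leq_pred_pexp iq -[_ * X (n - i) * _]mulrA X_mu -!mulrA gXX [T _ * _]mulrA T_mu; last exact: xyk_per.
rewrite -!scalerAr -!scalerAl -!scalerAr scalerA [X in X *: _]mulrC; congr (_ * _ *: _).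
(* The upper argument is n - lam - 2 - N, which becomes n - lam - 1 after adding q. *)
rewrite /xyk -[LHS](bk_per hp _ iq); congr bk.
have := prednK q_gt0; have := ltn_ord i; lia.
Qed.

Lemma X_fvec (lam l n : nat) : (n < q)%N ->
  X n * fvec lam l =
  \sum_(i < n.+1) (bk k (n%:Z - lam%:Z - 1) i * 'C(n - i + (N - l), n - i)%:R) *:
     (Y (N - i) * mu_ (- lam%:Z - 2 + ((n - i).*2)%:Z) * X (n - i + (N - l))).
Proof. exact: X_fgen. Qed.

(** With s = n - i, the i-th coefficient is, up to sign, 'C(l, s) binom(n - lam - 1, i). If 'C(l, s)
    is nonzero in k, then so is 'C(lam, s), by 'C(lam, s) 'C(lam - s, l - s) = 'C(lam, l) 'C(l, s).
    The same identity with n in place of l then gives 'C(lam - s, i) = 0, and this is the second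
    factor up to sign. *)
Lemma X_fvec0 (lam l n : nat) : (l < q)%N -> (n < q)%N ->
  'C(lam, l)%:R != 0 :> k -> 'C(lam, n)%:R = 0 :> k -> X n * fvec lam l = 0.
Proof.
move=> lq nq hl hn; rewrite X_fvec // big1 // => i _.
have lin : (i <= n)%N by rewrite -ltnS.
set s := (n - i)%N; have sq : (s < q)%N by apply: leq_ltn_trans (leq_subr _ _) nq.
rewrite [(s + _)%N]addnC (bin_compl hp) //.
have [->|h1] := eqVneq ('C(l, s)%:R : k) 0; first by rewrite !mulr0 scale0r.
have sl : (s <= l)%N by rewrite leqNgt; apply: contra h1 => h; rewrite bin_small.
have h2 : 'C(lam, s)%:R != 0 :> k.
  apply/eqP => h; have /eqP := bin_mul k lam sl.
  by rewrite h mul0r eq_sym mulf_eq0 (negPf hl) (negPf h1).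
have h3 := bk_sub_zero lin hn h2.
have -> : bk k (n%:Z - lam%:Z - 1) i = 0; last by rewrite mul0r scale0r.
have -> : n%:Z - lam%:Z - 1 = - (lam%:Z + 1 - n%:Z) by ring.
rewrite /bk binzN rmorphM /=.
have -> : lam%:Z + 1 - n%:Z + i%:Z - 1 = lam%:Z - n%:Z + i%:Z by ring.
by rewrite -/(bk k _ _) h3 mulr0.
Qed.

Lemma fvec_neq0 lam l : fvec lam l != 0.
Proof.
apply/eqP => /(congr1 (fun u => coord u N (N - l) (- lam%:Z - 2))).
rewrite gcoord0 (gcoordT G (r := r)) ?eqxx ?mul1r ?delta_id; last exact: delta_per.
by apply/eqP; rewrite oner_eq0.
Qed.

Lemma ex_max_ord (P : pred nat) : P 0%N -> exists2 n, (n < q)%N && P n &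
  forall m, (n < m < q)%N -> ~~ P m.
Proof.
move=> P0; pose Q n := (n < q)%N && P n.
have exQ : exists n, Q n by exists 0%N; rewrite /Q q_gt0.
have bQ n : Q n -> (n <= q)%N by case/andP=> /ltnW.
case: (ex_maxnP exQ bQ) => n Qn maxn; exists n => // m /andP[nm mq].
by apply/negP => Pm; have := maxn m; rewrite /Q mq Pm => /(_ isT); rewrite leqNgt nm.
Qed.

(** Among the nonzero terms c_n X^(n) v of the product take the one with n largest. Y^(n) kills the
    terms of smaller index and maps this one to c_n 'C(lam, n) v, where 'C(lam, n) is nonzero by
    [X_fvec0]. *)
Lemma fvec_simple lam l u : (l < q)%N -> 'C(lam, l)%:R != 0 :> k -> V u ->
  u * fvec lam l != 0 -> exists2 u', V u' & u' * (u * fvec lam l) = fvec lam l.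
Proof.
move=> lq hl hu; have hv := lowest_fvec lam l.
have [c ->] := lowest_orbit hv hu; set v := fvec lam l in hv *.
move=> w0; pose P n := (n < q)%N && (c n *: (X n * v) != 0).
have exP : exists n, P n.
  apply/not_existsP => h; case/eqP: w0; rewrite big1 // => i _.
  by have /negP := h i; rewrite /P ltn_ord /= negbK => /eqP.
have bP n : P n -> (n <= q)%N by case/andP=> /ltnW.
case: (ex_maxnP exP bP) => n /andP[nq Pn] maxn.
have hn : 'C(lam, n)%:R != 0 :> k.
  by apply: contra Pn => /eqP h; rewrite X_fvec0 // scaler0.
have cn : c n != 0 by apply: contra Pn => /eqP ->; rewrite scale0r.
exists ((c n * 'C(lam, n)%:R)^-1 *: Y n); first exact/VZ/VY.
rewrite mulr_sumr (bigD1 (Ordinal nq)) //= big1 ?addr0 => [|i ni].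
  rewrite -scalerAl -scalerAr (lowest_YX hv) // leqnn subnn gX0 mul1r subrK bk_nat.
  by rewrite !scalerA -mulrA mulVf ?scale1r // mulf_neq0.
have [lin|nli] := ltnP i n.
  by rewrite -scalerAl -scalerAr (lowest_YX hv) // leqNgt lin /= !scaler0.
suff -> : c i *: (X i * v) = 0 by rewrite mulr0.
apply/eqP; apply: contraT => h.
have := maxn i; rewrite /P ltn_ord h => /(_ isT) hin.
by case/negP: ni; apply/eqP/val_inj/eqP; rewrite /= eqn_leq hin nli.
Qed.

(** This recovers f(lam, l) from X^(l) f(lam, l) whenever p does not divide 'C(lam, l). *)
Lemma YX_fvec lam l : (l < q)%N -> Y l * (X l * fvec lam l) = 'C(lam, l)%:R *: fvec lam l.
Proof.
move=> lq; rewrite (lowest_YX (lowest_fvec lam l)) // leqnn subnn gX0 mul1r subrK.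
by [].
Qed.

(** * Lowest weight vectors in simple left ideals *)

Section Simple.
Variable M : A -> Prop.
Hypothesis MV : forall v, M v -> V v.
Hypothesis MM : forall u v, V u -> M v -> M (u * v).
Hypothesis Mcyc : forall v w, M v -> M w -> w != 0 -> exists2 u, V u & v = u * w.

(** The last nonzero Y^(n) v0 is killed by all Y^(i) with 0 < i < q, since Y^(i) Y^(n) is a multiple
    of Y^(i + n), and is zero by carrying when i + n reaches q. Some weight component of this vector
    is nonzero. *)
Lemma simple_lowest v0 : M v0 -> v0 != 0 ->
  exists lam v, [/\ (lam < q)%N, M v, v != 0 & lowest lam%:Z v].
Proof.
move=> Mv0 v0n.
have [|n /andP[nq hn] maxn] := ex_max_ord (P := fun n => Y n * v0 != 0).
  by rewrite gY0 mul1r.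
have hY i : (0 < i < q)%N -> Y i * (Y n * v0) = 0.
  move=> /andP[i0 iq]; rewrite mulrA gYY_small //.
  case: ltnP => h; last by rewrite scale0r mul0r.
  have := maxn (i + n)%N; rewrite h -[n in (n < _)%N]add0n ltn_add2r i0 negbK.
  by move=> /(_ isT)/eqP h0; rewrite -scalerAl h0 scaler0.
set v1 := Y n * v0 in hn hY.
have [b hb] : exists b : 'I_q, mu_ b%:Z * v1 != 0.
  apply/not_existsP => h; case/eqP: hn; rewrite -[v1]mul1r -mu_sum mulr_suml big1 // => b _.
  by have /negP := h b; rewrite negbK => /eqP.
have Mv1 : M v1 by apply: MM => //; apply: VY.
(* The representative of -b in 0, ..., q - 1. *)
exists ((q - b) %% q)%N, (mu_ b%:Z * v1); split => //.
- by rewrite ltn_mod.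
- by apply: MM => //; apply/VT/delta_per.
split=> [i hi|].
  by rewrite mulrA Y_mu -mulrA hY // mulr0.
rewrite mulrA; congr (_ * _); rewrite -[RHS]mu_mu; congr (_ * _); apply: mu_mod.
have := divn_eq (q - b) q; have := ltn_ord b; move: (_ %% _)%N (_ %/ _)%N => m d h1 h2.
have -> : - m%:Z - b%:Z = (d%:Z - 1) * q%:Z by lia.
exact: dvdz_mull.
Qed.

(* Otherwise a minimal [n] violating the claim makes [X n * v] a lowest weight
   vector, hence a generator, although [X n] acts nilpotently. *)
Lemma simple_X0 (lam : nat) v : M v -> v != 0 -> lowest lam%:Z v ->
  forall n, (n < q)%N -> 'C(lam, n)%:R = 0 :> k -> X n * v = 0.
Proof.
move=> Mv vn hv; elim/ltn_ind => n IHn nq hn.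
apply/eqP; apply: contraT => wn; exfalso.
have n0 : (0 < n)%N by case: n hn {IHn nq wn} => // /eqP; rewrite bin0 oner_eq0.
have hw : lowest (lam%:Z - (n.*2)%:Z) (X n * v).
  split=> [i /andP[i0 iq]|].
    rewrite (lowest_YX hv) //; case: leqP => // lin.
    have [h|h] := eqVneq ('C(lam, n - i)%:R : k) 0.
      rewrite IHn ?scaler0 //; first by rewrite -subn_gt0 subKn.
      exact: leq_ltn_trans (leq_subr _ _) nq.
    by rewrite bk_sub_zero // scale0r.
  rewrite mulrA mu_X -mulrA; congr (_ * _); case: hv => _.
  by have -> : - (lam%:Z - (n.*2)%:Z) - (n.*2)%:Z = - lam%:Z by ring.
have [u Vu ev] := Mcyc Mv (MM (VX nq) Mv) wn.
have [c ec] := lowest_orbit hw Vu; rewrite ec in ev.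
(* [n1] is the last index with X^(n1) v nonzero. As v is a combination of the X^(i) X^(n) v with n >
   0, X^(n1) v is one of the X^(n1 + i + n) v, so it vanishes. *)
have [|n1 /andP[n1q hn1] maxn] := ex_max_ord (P := fun n => X n * v != 0).
  by rewrite gX0 mul1r.
have hX i : (n1 < i < q)%N -> X i * v = 0 by move=> /maxn; rewrite negbK => /eqP.
case/eqP: hn1; rewrite {1}ev mulr_sumr big1 // => i _.
rewrite -scalerAr [X i * _]mulrA [X n1 * _]mulrA gXX_small // -scalerAr.
case: ltnP => inq; last by rewrite scale0r mul0r scaler0.
rewrite gXX_small //; case: ltnP => nnq; last by rewrite scale0r scaler0 mul0r scaler0.
by rewrite -!scalerAl hX ?scaler0 // nnq andbT; lia.
Qed.

Lemma simple_fvec (lam : nat) v : (lam < q)%N -> M v -> v != 0 -> lowest lam%:Z v ->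
  exists c : nat -> k, (forall l, (l < q)%N -> c l != 0 -> 'C(lam, l)%:R != 0 :> k) /\
    v = \sum_(l < q) c l *: fvec lam l.
Proof.
move=> lq Mv vn hv.
have [phi [hphi ev]] := Vspan (MV Mv).
(* Y^(N - m) kills v, and the coordinate of the product at Y^(N) is 'C(N, m) times the value of phi,
   with 'C(N, m) nonzero in k. *)
have phi0 m n z : (m < N)%N -> (n < q)%N -> phi m n z = 0.
  move=> mN nq; have mq : (m < q)%N by lia.
  have hNm : (0 < N - m < q)%N by lia.
  have := congr1 (fun u => coord u N n z) (hv.1 _ hNm).
  rewrite /= gcoord0 {1}ev mulr_sumr gcoord_sum (bigD1 (Ordinal mq)) //= [X in _ + X]big1 ?addr0 => [|i ni].
    rewrite mulr_sumr gcoord_sum (bigD1 (Ordinal nq)) //= [X in _ + X]big1 ?addr0 => [|j nj].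
      rewrite !mulrA gYY -!scalerAl gcoordZ subnK 1?ltnW // (gcoordT G (r := r)) //.
      rewrite !eqxx mul1r => /eqP; rewrite mulf_eq0.
      by rewrite (negPf (bin_full_neq0 hp _)) /=; [move/eqP|lia].
    rewrite !mulrA gYY -!scalerAl gcoordZ (gcoordT G (r := r)) // andbC.
    case: eqP => [e|_]; last by rewrite mul0r mulr0.
    by case/negP: nj; apply/eqP/val_inj.
  rewrite mulr_sumr gcoord_sum big1 // => j _.
  rewrite !mulrA gYY -!scalerAl gcoordZ (gcoordT G (r := r)) //.
  case: eqP => [e|_]; last by rewrite mul0r mulr0.
  by case/negP: ni; apply/eqP/val_inj => /=; lia.
have NqP : (N < q)%N by rewrite prednK.
have ev2 : v = \sum_(n < q) Y N * T (phi N n) * X n.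
  rewrite {1}ev (bigD1 (Ordinal NqP)) //= [X in _ + X]big1 ?addr0 // => i ni.
  rewrite big1 // => j _; have iN : (i < N)%N.
    rewrite ltn_neqAle leq_pred_pexp ltn_ord andbT; apply: contra ni => /eqP e.
    by apply/eqP/val_inj.
  rewrite (gTeq (psi := fun=> 0)); last by move=> z; apply: phi0.
  by rewrite gT0 mulr0 mul0r.
pose c n := phi N n (- lam%:Z - 2).
have ev3 : v = \sum_(n < q) c n *: (Y N * mu_ (- lam%:Z - 2) * X n).
  rewrite -hv.2 {1}ev2 mulr_sumr; apply: eq_bigr => n _.
  rewrite !mulrA mu_Y -[Y N * _ * _]mulrA (mu_mod (dvd_weight lam%:Z)).
  rewrite /mu_ (gTM G (r := r)) //; last exact: delta_per.
  rewrite (gTeq (psi := fun z => c n * delta k p r (- lam%:Z - 2) z)); last first.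
    by move=> z; rewrite mulrC per_delta.
  by rewrite (gTZ G (r := r)) -?scalerAr -?scalerAl //; exact: delta_per.
(* If 'C(lam, N - n) vanished, X^(N - n) would kill v by [simple_X0]. The coordinate of X^(N - n) v
   at Y^(N), X^(N) comes only from the n-th term and from the summand i = 0 of [X_fgen]; it is c_n
   'C(N, N - n), with a nonzero binomial. *)
have c0 n : (n < q)%N -> c n != 0 -> 'C(lam, N - n)%:R != 0 :> k.
  move=> nq cn; apply/eqP => h0; case/eqP: cn.
  have Nnq : (N - n < q)%N by lia.
  have := simple_X0 Mv vn hv Nnq h0.
  pose z0 := - lam%:Z - 2 + ((N - n).*2)%:Z.
  move/(congr1 (fun u => coord u N N z0)); rewrite /= gcoord0 ev3 mulr_sumr gcoord_sum.
  rewrite (bigD1 (Ordinal nq)) //= big1 ?addr0 => [|j nj]; last first.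
    rewrite -scalerAr gcoordZ X_fgen // gcoord_sum big1 ?mulr0 // => i _.
    rewrite gcoordZ (gcoordT G (r := r)); last exact: delta_per.
    case: eqP => [e1|]; last by rewrite mul0r mulr0.
    case: eqP => [e2|]; last by rewrite andbF mul0r mulr0.
    case/negP: nj; apply/eqP/val_inj => /=.
    by have := ltn_ord i; have := ltn_ord j; lia.
  rewrite -scalerAr gcoordZ X_fgen // gcoord_sum big_ord_recl /= big1 ?addr0 => [|i _].
    rewrite gcoordZ (gcoordT G (r := r)); last exact: delta_per.
    rewrite !subn0 subnK; last by lia.
    rewrite !eqxx bk0 !mul1r delta_id mulr1 => /eqP; rewrite mulf_eq0.
    by rewrite (negPf (bin_full_neq0 hp Nnq)) orbF => /eqP.
  rewrite gcoordZ (gcoordT G (r := r)); last exact: delta_per.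
  case: eqP => [e1|]; last by rewrite mul0r mulr0.
  by exfalso; have := ltn_ord i; move: e1; rewrite /bump /=; lia.
exists (fun l => c (N - l)%N); split=> [l lq' cl|].
  by have := c0 _ _ cl; rewrite subKn ?leq_pred_pexp //; apply; lia.
rewrite ev3 (reindex_inj rev_ord_inj) /=; apply: eq_bigr => l _.
rewrite /fvec; have -> : (q - l.+1 = N - l)%N by lia.
by [].
Qed.

End Simple.
End Sub.
End Socle.

(** * Frobenius and the map Z *)

Lemma sum_multiples (V : nmodType) (p c : nat) (F : nat -> V) : (0 < p)%N ->
  (forall j, ~~ (p %| j)%N -> F j = 0) ->
  \sum_(j < (c * p).+1) F j = \sum_(i < c.+1) F (i * p)%N.
Proof.
move=> p0 F0; elim: c => [|c IHc].
  by rewrite mul0n !big_ord_recl !big_ord0.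
rewrite [RHS]big_ord_recr /= -IHc -!(big_mkord xpredT F) (big_cat_nat (n := (c * p).+1)) //=.
  congr (_ + _); rewrite mulSn addnC big_nat_recr /=; last by rewrite -addn1 leq_add2l.
  rewrite [X in X + _]big1_seq ?add0r // => j; rewrite mem_index_iota => /andP[_ hj].
  apply: F0; apply/negP => /dvdnP[d e]; move: hj; rewrite e -mulSnr ltn_pmul2r // ltn_pmul2r //.
  lia.
by rewrite ltnS leq_pmul2r.
Qed.

Section Zmap.
Variables (k : fieldType) (p : nat).
Hypothesis hp : p \in [pchar k].
Variables (A : algType k) (G : hyperlike p A).
Local Notation X := (gX G).
Local Notation Y := (gY G).
Local Notation T := (gT G).
Local Notation del := (delta k p).

Let p_gt1 : (1 < p)%N. Proof. exact/prime_gt1/(pcharf_prime hp). Qed.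
Let p_gt0 : (0 < p)%N. Proof. exact: ltnW. Qed.

Lemma gXC m n : X m * X n = X n * X m.
Proof. by rewrite !gXX addnC -bin_sub ?leq_addl // addnK. Qed.
Lemma gYC m n : Y m * Y n = Y n * Y m.
Proof. by rewrite !gYY addnC -bin_sub ?leq_addl // addnK. Qed.

(** Adding a nonzero last digit to p - 1 produces a carry, so the binomial vanishes by Lucas. *)
Lemma gYY_nd m : ~~ (p %| m)%N -> Y p.-1 * Y m = 0.
Proof.
move=> pm; rewrite gYY (divn_eq m p).
have m0 : (0 < m %% p)%N by rewrite lt0n.
have mp : (m %% p < p)%N by rewrite ltn_mod.
have -> : (p.-1 + (m %/ p * p + m %% p) = (m %% p).-1 + (m %/ p).+1 * p)%N.
  by rewrite mulSn; move: (_ * p)%N => x; lia.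
have h1 : ((m %% p).-1 < p)%N by lia.
have := bin_lucas hp (m %/ p).+1 0 h1 (_ : (p.-1 < p)%N).
rewrite mul0n addn0 prednK // => /(_ (leqnn _)) ->.
by rewrite bin_small ?mul0r ?scale0r //; lia.
Qed.

Lemma gXX_nd c i t : (0 < i <= t)%N -> (t < p)%N -> (i <= c * p)%N -> X (c * p - i) * X t = 0.
Proof.
move=> /andP[i0 it] tp icp; rewrite gXC gXX.
have -> : (t + (c * p - i) = (t - i) + c * p)%N by lia.
have h1 : (t - i < p)%N by lia.
have := bin_lucas hp c 0 h1 tp; rewrite mul0n addn0 => ->.
by rewrite bin_small ?mul0r ?scale0r //; lia.
Qed.

Lemma bin_pp c d : 'C(c * p, d * p)%:R = 'C(c, d)%:R :> k.
Proof. by have := bin_lucas hp c d p_gt0 p_gt0; rewrite !add0n mul1r. Qed.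

Lemma bin_p1 l c : (l < p)%N -> 'C(l + c * p, c * p)%:R = 1 :> k.
Proof.
by move=> lp; have := bin_lucas hp c c lp p_gt0; rewrite add0n bin0 binn mul1r.
Qed.

Lemma gXX_p c d : X (c * p) * X (d * p) = 'C(c + d, c)%:R *: X ((c + d) * p).
Proof. by rewrite gXX -mulnDl bin_pp. Qed.

Lemma gXX_add l c : (l < p)%N -> X (c * p) * X l = X (l + c * p).
Proof. by move=> lp; rewrite gXX addnC bin_p1 // scale1r. Qed.

Lemma gYY_add c : Y p.-1 * Y (c * p) = Y (p.-1 + c * p).
Proof. by rewrite gYC gYY addnC bin_p1 ?prednK // scale1r. Qed.

(* For t = p - 1 - l, this has weight 2m - lam on the left and 2l - lam on the
   right: a matrix unit of the simple module of lowest weight - lam. *)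
Definition emat (lam : int) (m t : nat) : A := X m * (Y p.-1 * T (del 1 (- lam - 2)) * X t).

Lemma bk_perM z w i : (i < p)%N -> bk k (z + w * p%:Z) i = bk k z i.
Proof.
move=> ip; have h : per p 1 (bk k ^~ i) by move=> y; rewrite (bk_per hp) // expn1.
by have := perMz h z w; rewrite expn1.
Qed.

Lemma T_delta1_eq b c : (p%:Z %| b - c)%Z -> T (del 1 b) = T (del 1 c).
Proof. by move=> h; apply/gTeq/deltaE_mod; rewrite expn1. Qed.

Lemma delta1_per b : per p 1 (del 1 b). Proof. exact: delta_per. Qed.

Lemma xyk_per1 m n i : (i < p)%N -> per p 1 (xyk k m n i).
Proof. by move=> ip; apply: (xyk_per hp); rewrite expn1. Qed.

Lemma xyk0 m n z : xyk k m n 0 z = 1. Proof. by rewrite /xyk bk0. Qed.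
Lemma T_xyk0 m n : T (xyk k m n 0) = 1.
Proof. by rewrite -(gT1 G); apply: gTeq => z; rewrite xyk0. Qed.
Lemma T_yxk0 m n : T (yxk k m n 0) = 1.
Proof. by rewrite -(gT1 G); apply: gTeq => z; rewrite /yxk bk0. Qed.

(** Moving X^(cp) past Y^(p - 1) creates corrections of index 0 < i < p. If i <= p - 1 - l, then
    X^(cp - i) X^(p - 1 - l) = 0. Otherwise the scalar at the given weight is 'C(p - 1 - lam, i),
    which is zero because l <= lam. *)
Lemma emat_X (lam m l c : nat) : (l <= lam)%N -> (lam < p)%N ->
  X (c * p) * emat lam%:Z m (p.-1 - l) = emat lam%:Z m (p.-1 - l) * X (c * p).
Proof.
move=> llam lamp; rewrite /emat mulrA gXC -!mulrA; congr (X m * _).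
rewrite !mulrA gXY !mulr_suml big_mkcond big_ord_recl /= big1 ?addr0 => [|i _].
  rewrite !subn0 T_xyk0 mulr1 -[Y p.-1 * _ * _]mulrA.
  rewrite (gXT G _ (delta1_per _)) -!mulrA [X _ * X _]gXC !mulrA; congr (_ * _ * _ * _).
  have h : (p%:Z %| - lam%:Z - 2 + ((c * p).*2)%:Z - (- lam%:Z - 2))%Z.
    have -> : - lam%:Z - 2 + ((c * p).*2)%:Z - (- lam%:Z - 2) = (2 * c%:Z) * p%:Z by lia.
    exact: dvdz_mull.
  rewrite -(T_delta1_eq h); apply: gTeq => z.
  by rewrite delta_shift opprK.
rewrite /bump /= add1n; case: leqP => // ip1.
have ip : (i.+1 < p)%N by lia.
have icp : (i.+1 <= c * p)%N by have := ltn_ord i.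
have [it|ti] := leqP i.+1 (p.-1 - l).
  rewrite -[_ * X _ * T _]mulrA (gXT G _ (delta1_per _)) -!mulrA gXX_nd ?mulr0 //; lia.
rewrite -[_ * X _ * T _]mulrA (gXT G _ (delta1_per _)) !mulrA -[Y _ * T _ * T _]mulrA.
rewrite (gTM G (xyk_per1 _ _ ip) (per_shift _ (delta1_per _))).
rewrite (gTeq G (psi := fun=> 0)) ?gT0 ?mulr0 ?mul0r // => z.
rewrite delta_shift opprK (per_delta _ _ (xyk_per1 _ _ ip)).
rewrite (_ : xyk _ _ _ _ _ = 0) ?mul0r //.
rewrite /xyk.
have -> : - lam%:Z - 2 + ((c * p - i.+1).*2)%:Z + ((i.+1.*2)%:Z - (c * p)%N%:Z - p.-1%:Z) =
   (p.-1 - lam)%N%:Z + (c%:Z - 2) * p%:Z.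
  by move: icp; rewrite -!muln2 => icp; nia.
by rewrite bk_perM // bk_nat bin_small //; lia.
Qed.

Lemma T_delta1_shift b c w : (p%:Z %| c)%Z ->
  T (fun z => del 1 b (z + w * c)) = T (del 1 b).
Proof.
move=> h; rewrite -(@T_delta1_eq (b - w * c) b).
  by apply: gTeq => z; rewrite delta_shift.
by rewrite addrAC subrr add0r rpredN dvdz_mull.
Qed.

Lemma dvd_mulp (b : nat) : (p%:Z %| (b * p)%N%:Z)%Z.
Proof. by rewrite PoszM dvdz_mull. Qed.

Lemma delta1_Yp b c : T (del 1 b) * Y (c * p) = Y (c * p) * T (del 1 b).
Proof.
rewrite (gTY G _ (delta1_per _)); congr (_ * _).
rewrite -[RHS](T_delta1_shift _ (-2) (dvd_mulp c)); apply: gTeq => z.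
by congr del; rewrite -muln2 PoszM; ring.
Qed.

Lemma emat_Y lam m t b : (t < p)%N ->
  emat lam m t * Y (b * p) = X m * (Y p.-1 * Y (b * p) * T (del 1 (- lam - 2)) * X t).
Proof.
move=> tp; rewrite /emat -!mulrA; congr (X m * _).
rewrite gXY !mulr_sumr big_mkcond big_ord_recl /= big1 ?addr0 => [|i _].
  by rewrite !subn0 T_xyk0 mulr1 !mulrA -[Y p.-1 * T _ * _]mulrA delta1_Yp !mulrA.
rewrite /bump /= add1n; case: leqP => // ibp.
rewrite !mulrA -[Y p.-1 * T _ * _]mulrA (gTY G _ (delta1_per _)) !mulrA gYY_nd ?mul0r //.
apply/negP => h; have : (p %| i.+1)%N by rewrite -(dvdn_subr ibp) // dvdn_mull.
by move/dvdn_leq => /(_ isT); have := ltn_ord i; lia.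
Qed.

(** As in [emat_Y], the corrections contain Y^(p - 1) and Y^(bp - i) with 0 < i < p, whose product
    is zero by [gYY_nd]. *)
Lemma emat_YC lam m t b : (t < p)%N -> (m < p)%N ->
  Y (b * p) * emat lam m t = emat lam m t * Y (b * p).
Proof.
move=> tp mp; rewrite emat_Y // /emat mulrA gYX !mulr_suml big_mkcond big_ord_recl /=.
rewrite big1 ?addr0 => [|i _].
  by rewrite !subn0 T_yxk0 mulr1 -!mulrA [Y _ * (Y _ * _)]mulrA gYC !mulrA.
rewrite /bump /= add1n; case: leqP => // im.
have ibp : (i.+1 <= b * p)%N by have := ltn_ord i.
rewrite !mulrA -[_ * Y _ * Y p.-1]mulrA gYC gYY_nd ?mulr0 ?mul0r //.
apply/negP => h; have : (p %| i.+1)%N by rewrite -(dvdn_subr ibp) // dvdn_mull.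
by move/dvdn_leq => /(_ isT); lia.
Qed.

Lemma gTC r s phi psi : per p r phi -> per p s psi -> T phi * T psi = T psi * T phi.
Proof.
move=> h1 h2.
have h1' := per_le (leq_maxl r s) h1; have h2' := per_le (leq_maxr r s) h2.
rewrite (gTM G h1' h2') (gTM G h2' h1').
by apply: gTeq => z; rewrite mulrC.
Qed.

Lemma emat_T s (lam : int) m t phi : per p s phi ->
  T phi * emat lam m t = emat lam m t * T (fun z => phi (z + ((m + t).*2)%:Z - (p.-1.*2)%:Z)).
Proof.
move=> h; rewrite /emat.
have h1 := per_shift (m.*2)%:Z h.
have h2 := per_shift (- (p.-1.*2)%:Z) h1; rewrite /= in h2.
have h3 := per_shift (t.*2)%:Z h2; rewrite /= in h3.
rewrite mulrA (gTX G _ h) -!mulrA; congr (X m * _).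
rewrite mulrA (gTY G _ h1) -!mulrA; congr (Y _ * _).
rewrite mulrA (gTC h2 (delta1_per _)) -!mulrA; congr (T _ * _).
rewrite (gTX G _ h2); congr (_ * _); apply: gTeq => z.
by congr phi; rewrite doubleD PoszD; ring.
Qed.

Lemma emat_T0 s (lam l : nat) phi : (l <= lam)%N -> (lam < p)%N -> per p s phi ->
  T phi * emat lam%:Z l (p.-1 - l) = emat lam%:Z l (p.-1 - l) * T phi.
Proof.
move=> llam lamp h; rewrite (emat_T _ _ _ h); congr (_ * _); apply: gTeq => z.
by congr phi; rewrite subnKC ?addrK //; lia.
Qed.

Lemma emat_wt (lam m l : nat) : (l < p)%N -> (lam <= l.*2)%N ->
  emat lam%:Z m (p.-1 - l) * T (del 1 (l.*2 - lam)%N%:Z) = emat lam%:Z m (p.-1 - l).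
Proof.
move=> lp lam2; rewrite /emat -!mulrA; congr (X m * (Y _ * _)).
rewrite (gXT G _ (delta1_per _)) mulrA; congr (_ * _).
rewrite (gTeq G (psi := del 1 (- lam%:Z - 2))).
  rewrite (gTM G (delta1_per _) (delta1_per _)); apply: gTeq => z; exact: deltaXX.
move=> z; rewrite delta_shift; apply: deltaE_mod; rewrite expn1 opprK.
have -> : (l.*2 - lam)%N%:Z + ((p.-1 - l).*2)%:Z - (- lam%:Z - 2) = 2 * p%:Z by lia.
exact: dvdz_mull.
Qed.

Lemma per_ex_ge s i (phi : int -> k) : per p s phi -> exists s', (i < p ^ s')%N /\ per p s' phi.
Proof.
move=> h; exists (maxn s i); split; last exact: (per_le (leq_maxl _ _)).
apply: leq_trans (ltn_expl i p_gt1) _.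
by rewrite leq_exp2l // leq_maxr.
Qed.

(* The terms with p not dividing j die, either on the left because Y^(p-1)
   meets Y^(n) with p not dividing n, or by Lucas on the weight 2l - lam. *)
Lemma emat_YTX_nd (lam m l b c j : nat) s psi (M : nat) :
  (l <= lam)%N -> (lam < p)%N -> (lam <= l.*2)%N -> ~~ (p %| j)%N -> (j <= b * p)%N ->
  per p s psi ->
  emat lam%:Z m (p.-1 - l) * (Y (b * p - j) * T (fun z => xyk k (c * p) (b * p) j z * psi z) * X M) = 0.
Proof.
move=> llam lamp lam2 pj jbp hpsi.
have lp : (l < p)%N by lia.
have [jl|lj] := leqP (j %% p) l.
  rewrite !mulrA; suff -> : emat lam%:Z m (p.-1 - l) * Y (b * p - j) = 0 by rewrite !mul0r.
  rewrite /emat -!mulrA gXY !mulr_sumr big1 ?mulr0 // => i hi.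
  rewrite !mulrA -[X m * _ * T _]mulrA -[X m * _ * Y _]mulrA -[Y p.-1 * T _ * _]mulrA.
  rewrite (gTY G _ (delta1_per _)) [Y p.-1 * _]mulrA gYY_nd ?mul0r ?mulr0 ?mul0r //.
  rewrite -subnDA; apply/negP => h.
  have : (p %| j + i)%N by rewrite -(dvdn_subr (_ : j + i <= b * p)%N) ?dvdn_mull //; lia.
  have := divn_eq j p; move: (j %/ p)%N => d e; rewrite e -addnA dvdn_addr ?dvdn_mull //.
  have : (0 < j %% p)%N by rewrite lt0n.
  move=> j0 /dvdn_leq; rewrite addn_gt0 j0 => /(_ isT).
  have := ltn_ord i; lia.
have [s' [js hpsi']] := per_ex_ge j hpsi.
have hxy : per p (maxn s' 1) (xyk k (c * p) (b * p) j).
  by apply: (per_le (leq_maxl _ _)); apply: (xyk_per hp).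
have hps := per_le (leq_maxl s' 1) hpsi'.
rewrite -(emat_wt m lp lam2); move: (emat _ _ _) => E.
rewrite -!mulrA [T _ * (Y _ * _)]mulrA (gTY G _ (delta1_per _)).
rewrite -!mulrA [T _ * (T _ * _)]mulrA.
have hd : per p (maxn s' 1) (del 1 (l.*2 - lam)%N%:Z).
  by apply: (per_le (leq_maxr _ _)); apply: delta_per.
rewrite (gTM G (per_shift _ hd) (per_mul hxy hps)).
rewrite [X in _ * (_ * (X * _))](gTeq G (psi := fun=> 0)) ?gT0 ?mul0r ?mulr0 // => z.
rewrite /delta; case: dvdzP => [[w e]|_]; last by rewrite /= mul0r.
rewrite /xyk; have -> : z + ((j.*2)%:Z - (c * p)%N%:Z - (b * p)%N%:Z) =
   (l.*2 - lam)%N%:Z + (w + b%:Z - c%:Z) * p%:Z.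
  have -> : z = (z - ((b * p - j).*2)%:Z - (l.*2 - lam)%N%:Z) + ((b * p - j).*2)%:Z + (l.*2 - lam)%N%:Z.
    by ring.
  by rewrite e expn1; lia.
rewrite {1}(divn_eq j p) addnC (lucas hp) ?ltn_mod //; last by lia.
by rewrite bk_nat bin_small ?mul0r ?mulr0 //; lia.
Qed.

Lemma XYTX c b d s phi : per p s phi ->
  X c * Y b * T phi * X d = \sum_(i < c.+1 | (i <= b)%N)
    Y (b - i) * T (fun z => xyk k c b i z * phi (z - ((c - i).*2)%:Z)) * (X (c - i) * X d).
Proof.
move=> h; rewrite gXY !mulr_suml; apply: eq_bigr => i _.
rewrite -[_ * X (c - i) * T _]mulrA (gXT G _ h) !mulrA; congr (_ * _ * _).
have [s' [js h']] := per_ex_ge i h.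
rewrite -mulrA (gTM G (xyk_per hp _ _ js) (per_shift _ h')).
by [].
Qed.

Lemma per_xyphi (c b i : nat) s phi u : per p s phi ->
  exists s', per p s' (fun z => xyk k c b i z * phi (z + u)).
Proof.
move=> h; have [s' [js h']] := per_ex_ge i h; exists s'.
exact: per_mul (xyk_per hp _ _ js) (per_shift _ h').
Qed.

(** * An abstract Fr', known by its values on the Y^(m) phi(H) X^(n) *)

Variable FF : A -> A.
Hypothesis FFD : forall u v, FF (u + v) = FF u + FF v.
Hypothesis FFZ : forall c u, FF (c *: u) = c *: FF u.
Hypothesis FFT : forall s m n (phi : int -> k), per p s phi ->
  FF (Y m * T phi * X n) = Y (m * p) * T (fdiv p phi) * X (n * p).

Lemma FF0 : FF 0 = 0. Proof. by have := FFZ 0 0; rewrite !scale0r. Qed.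
Lemma FF_sum (I : Type) (s : seq I) (P : pred I) (F : I -> A) :
  FF (\sum_(i <- s | P i) F i) = \sum_(i <- s | P i) FF (F i).
Proof. by elim/big_rec2: _ => [|i u v _ <-]; rewrite ?FF0 ?FFD. Qed.

Lemma FF_XYTX c b d s phi : per p s phi ->
  FF (X c * Y b * T phi * X d) = \sum_(i < c.+1 | (i <= b)%N)
    Y ((b - i) * p) * T (fdiv p (fun z => xyk k c b i z * phi (z - ((c - i).*2)%:Z))) *
      (X ((c - i) * p) * X (d * p)).
Proof.
move=> h; rewrite (XYTX _ _ _ h) FF_sum; apply: eq_bigr => i _.
have [s' h'] := per_xyphi c b i (- ((c - i).*2)%:Z) h.
by rewrite gXX -scalerAr FFZ (FFT _ _ h') gXX_p -scalerAr.
Qed.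

(** To the right of e, [FF] respects products. Straightening X^(cp) Y^(bp) gives terms of every
    index j; e kills those with p not dividing j, and for j = ip Lucas turns the middle factor into
    the one in [FF] of the straightened X^(c) Y^(b). *)
Lemma emat_FF (lam m l c b d : nat) s phi :
  (l <= lam)%N -> (lam < p)%N -> (lam <= l.*2)%N -> per p s phi ->
  emat lam%:Z m (p.-1 - l) * FF (X c * Y b * T phi * X d) =
  emat lam%:Z m (p.-1 - l) * (X (c * p) * Y (b * p) * T (fdiv p phi) * X (d * p)).
Proof.
move=> llam lamp lam2 h; rewrite (FF_XYTX _ _ _ h) (XYTX _ _ _ (fdiv_per hp h)).
have ndvd := emat_YTX_nd m _ _ llam lamp lam2.
move: (emat _ _ _) ndvd => E ndvd.
rewrite !mulr_sumr big_mkcond [RHS]big_mkcond /=.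
pose F j := if (j <= b * p)%N then E * (Y (b * p - j) *
   T (fun z => xyk k (c * p) (b * p) j z * fdiv p phi (z - ((c * p - j).*2)%:Z)) *
     (X (c * p - j) * X (d * p))) else 0.
have F0 j : ~~ (p %| j)%N -> F j = 0.
  move=> pj; rewrite /F; case: leqP => // jb; rewrite gXX -!scalerAr.
  have h' := per_shift (- ((c * p - j).*2)%:Z) (fdiv_per hp h).
  by rewrite (ndvd _ _ _ _ _ _ pj jb h') scaler0.
transitivity (\sum_(j < (c * p).+1) F j); last by [].
rewrite (sum_multiples c p_gt0 F0); apply: eq_bigr => i _.
have ic : (i <= c)%N by rewrite -ltnS.
rewrite /F leq_pmul2r //; case: leqP => // ib; rewrite -!mulnBl.
congr (E * (_ * _ * _)); apply: gTeq => z; rewrite /fdiv /=.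
have [z0 [z' [z0p -> _ _]]] := int_divp hp z.
rewrite (divz_add hp) //.
have -> : z0%:Z + z' * p%:Z - (((c - i) * p).*2)%:Z = z0%:Z + (z' - ((c - i).*2)%:Z) * p%:Z.
  by rewrite -!muln2; lia.
rewrite (divz_add hp) //; congr (_ * _); rewrite /xyk.
have -> : z0%:Z + z' * p%:Z + (((i * p).*2)%:Z - (c * p)%N%:Z - (b * p)%N%:Z) =
   z0%:Z + (z' + ((i.*2)%:Z - c%:Z - b%:Z)) * p%:Z by rewrite -!muln2; lia.
by rewrite -[(i * p)%N]add0n (lucas hp) // bk0 mul1r.
Qed.

Lemma FF_emat (lam l c b d : nat) s phi : (l <= lam)%N -> (lam < p)%N -> per p s phi ->
  FF (X c * Y b * T phi * X d) * emat lam%:Z l (p.-1 - l) =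
  emat lam%:Z l (p.-1 - l) * FF (X c * Y b * T phi * X d).
Proof.
move=> llam lamp h; rewrite (FF_XYTX _ _ _ h) mulr_suml mulr_sumr; apply: eq_bigr => i _.
have [s' /(fdiv_per hp) h'] := per_xyphi c b i (- ((c - i).*2)%:Z) h.
have eX n := emat_X l n llam lamp.
have eT := emat_T0 llam lamp h'.
have eY n : Y (n * p) * emat lam%:Z l (p.-1 - l) = emat lam%:Z l (p.-1 - l) * Y (n * p).
  by apply: emat_YC; lia.
move: (emat _ _ _) eX eT eY => E eX eT eY.
rewrite -!mulrA eX [X _ * (E * _)]mulrA eX.
by rewrite !mulrA -[_ * _ * E]mulrA eT !mulrA eY.
Qed.

Definition esoc (r : nat) (lam l : nat) : A := X l * fvec G r lam l.

(* The Steinberg-type factorization of the generators of the socle. *)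
Lemma emat_esoc (r lam l lam' l' s : nat) : (l <= lam)%N -> (lam < p)%N ->
  (l + s <= lam)%N -> (lam <= (l + s).*2)%N -> (l' < p ^ r)%N ->
  emat lam%:Z l (p.-1 - (l + s)) * FF (esoc r lam' l') * X s =
  'C(p.-1 - l, s)%:R *: esoc r.+1 (lam + lam' * p) (l + l' * p).
Proof.
move=> llam lamp lslam lam2 l'q.
have hd := delta_per k p r (- lam'%:Z - 2).
have q0 : (0 < p ^ r)%N by rewrite expn_gt0 p_gt0.
set N' := (p ^ r).-1.
have -> : esoc r lam' l' = X l' * Y N' * T (del r (- lam'%:Z - 2)) * X (N' - l').
  by rewrite /esoc /fvec !mulrA.
rewrite (emat_FF _ _ _ _ lslam lamp lam2 hd).
have tp : (p.-1 - (l + s) < p)%N by lia.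
rewrite !mulrA -(emat_X l l' lslam lamp) -[X _ * _ * Y _]mulrA emat_Y //.
set t := (p.-1 - (l + s))%N in tp *.
rewrite !mulrA gXX_add; last by lia.
rewrite -[_ * Y p.-1 * Y _]mulrA gYY_add.
have hf := fdiv_per hp hd.
rewrite -[_ * X t * T _]mulrA (gXT G _ hf) -!mulrA [T _ * (T _ * _)]mulrA.
have hd1 : per p r.+1 (del 1 (- lam%:Z - 2)) by apply: (per_le _ (delta1_per _)).
rewrite (gTM G hd1 (per_shift _ hf)).
rewrite [X _ * X s]gXC [X t * (X s * _)]mulrA gXX -scalerAl.
have -> : (t + s = p.-1 - l)%N by rewrite /t; lia.
have -> : 'C(p.-1 - l, t) = 'C(p.-1 - l, s).
  by rewrite -bin_sub /t; [congr 'C(_, _)|]; lia.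
rewrite -!scalerAr; congr (_ *: _); rewrite [X _ * X (_ * p)]gXC gXX_add; last by lia.
rewrite /esoc /fvec -/N' !mulrA.
have eN : ((p ^ r.+1).-1 = p.-1 + N' * p)%N.
  have := leq_pmull p q0; rewrite /N' expnSr -!subn1 mulnBl mul1n.
  by have := p_gt0; lia.
have eNl : ((p ^ r.+1).-1 - (l + l' * p) = p.-1 - l + (N' - l') * p)%N.
  by rewrite eN mulnBl; have : (l' * p <= N' * p)%N; [rewrite leq_pmul2r // /N'; lia|lia].
rewrite eNl eN; congr (_ * _ * _ * _); apply: gTeq => z.
have [z0 [z' [z0p ez _ _]]] := int_divp hp (z - (t.*2)%:Z).
rewrite /fdiv ez (divz_add hp) // /delta expn1.
rewrite -natrM mulnb; congr ((nat_of_bool _)%:R).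
(* The two weight conditions merge into one modulo p^(r + 1): since 2(l + s) - lam lies in 0, ..., p
   - 1, the first says that it is the last digit of z - 2t, and the second then concerns the
   remaining quotient. *)
have w0 : (((l + s).*2 - lam) < p)%N by lia.
have -> : z = z0%:Z + z' * p%:Z + (t.*2)%:Z by rewrite -ez subrK.
have -> : z0%:Z + z' * p%:Z + (t.*2)%:Z - (- lam%:Z - 2) =
   z0%:Z - ((l + s).*2 - lam)%N%:Z + (z' + 2) * p%:Z by rewrite /t; lia.
rewrite rpredDr ?dvdz_mull //.
apply/andP/idP => [[h1 h2]|h].
  have e0 : z0 = ((l + s).*2 - lam)%N.
    have /eqP : (z0%:Z = ((l + s).*2 - lam)%N%:Z %[mod p%:Z])%Z by apply/eqP; rewrite eqz_mod_dvd.
    by rewrite !modz_small ?ltz_nat // => /eqP [].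
  have -> : z0%:Z + z' * p%:Z + (t.*2)%:Z - (- (lam + lam' * p)%N%:Z - 2) =
     (z' - (- lam'%:Z - 2)) * p%:Z by rewrite e0 /t; lia.
  by rewrite expnSr PoszM dvdz_mul.
have hz : z0%:Z + z' * p%:Z + (t.*2)%:Z - (- (lam + lam' * p)%N%:Z - 2) =
   z0%:Z - ((l + s).*2 - lam)%N%:Z + (z' + lam'%:Z + 2) * p%:Z by rewrite /t; lia.
rewrite hz in h.
have h1 : (p%:Z %| z0%:Z - ((l + s).*2 - lam)%N%:Z)%Z.
  have : (p%:Z %| z0%:Z - ((l + s).*2 - lam)%N%:Z + (z' + lam'%:Z + 2) * p%:Z)%Z.
    by apply: dvdz_trans h; rewrite expnSr PoszM dvdz_mull.
  by rewrite rpredDr ?dvdz_mull.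
split=> //.
have e0 : z0 = ((l + s).*2 - lam)%N.
  have /eqP : (z0%:Z = ((l + s).*2 - lam)%N%:Z %[mod p%:Z])%Z by apply/eqP; rewrite eqz_mod_dvd.
  by rewrite !modz_small ?ltz_nat // => /eqP [].
move: h; rewrite e0 subrr add0r expnSr PoszM dvdz_mul2r ?eqz_nat -?lt0n //.
by congr (_ %| _)%Z; ring.
Qed.

End Zmap.

(** * The Casimir element and the generators at level one *)

Section Casimir.
Variables (k : fieldType) (p : nat).
Hypothesis hp : p \in [pchar k].
Variables (A : algType k) (G : hyperlike p A).
Local Notation X := (gX G).
Local Notation Y := (gY G).
Local Notation T := (gT G).
Local Notation del := (delta k p).

Let p_gt1 : (1 < p)%N. Proof. exact/prime_gt1/(pcharf_prime hp). Qed.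
Let p_gt0 : (0 < p)%N. Proof. exact: ltnW. Qed.

Lemma gX_pow n : X 1 ^+ n = n`!%:R *: X n.
Proof.
elim: n => [|n IHn]; first by rewrite expr0 gX0 scale1r.
by rewrite exprSr IHn -scalerAl gXX addn1 binSn scalerA factS mulnC natrM.
Qed.
Lemma gY_pow n : Y 1 ^+ n = n`!%:R *: Y n.
Proof.
elim: n => [|n IHn]; first by rewrite expr0 gY0 scale1r.
by rewrite exprSr IHn -scalerAl gYY addn1 binSn scalerA factS mulnC natrM.
Qed.

Lemma bk1 z : bk k z 1 = z%:~R.
Proof.
have := binz_mul z 0; rewrite binz0 !mulr1 subr0 mul1r /bk => ->.
by [].
Qed.

Lemma XY1 n : X n.+1 * Y 1 = Y 1 * X n.+1 + T (xyk k n.+1 1 1) * X n.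
Proof.
rewrite gXY big_mkcond 2!big_ord_recl /= big1 ?addr0 => [|i _]; last by [].
by rewrite T_xyk0 mulr1 !subn0 /bump /= subnn gY0 mul1r addn0 subSS subn0.
Qed.

Lemma YX1 n : Y n.+1 * X 1 = X 1 * Y n.+1 + T (yxk k n.+1 1 1) * Y n.
Proof.
rewrite gYX big_mkcond 2!big_ord_recl /= big1 ?addr0 => [|i _]; last by [].
by rewrite T_yxk0 mulr1 !subn0 /bump /= subnn gX0 mul1r addn0 subSS subn0.
Qed.

Section Weight.
Variable a : int.
Local Notation mu := (T (del 1 a)).

Lemma mu1_eq : mu = mu_ G 1 a. Proof. by []. Qed.

Lemma mu_YX n : mu * (Y n * X n) = Y n * X n * mu.
Proof. by rewrite mulrA !mu1_eq mu_Y -mulrA mu_X addrK mulrA. Qed.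

Lemma mumu : mu * mu = mu. Proof. exact: mu_mu. Qed.

Lemma YX_step n : Y n * X n * mu * (mu * Y 1 * X 1) =
  (n.+1 ^ 2)%:R *: (Y n.+1 * X n.+1 * mu) + (n%:R * (a%:~R + n%:R + 1)) *: (Y n * X n * mu).
Proof.
have -> : Y n * X n * mu * (mu * Y 1 * X 1) = Y n * (X n * Y 1) * X 1 * mu.
  by rewrite -[mu * Y 1 * X 1]mulrA mu_YX mulrA -[_ * mu * _]mulrA mu_YX !mulrA -[_ * mu * mu]mulrA mumu.
case: n => [|n].
  by rewrite gX0 gY0 !mul1r mul0r scale0r addr0 scale1r.
rewrite XY1 mulrDr !mulrDl !mulrA gYY addn1 -[_ * X n.+1 * X 1]mulrA -[_ * X n * X 1]mulrA.
rewrite !gXX !addn1 !binSn -!scalerAl -!scalerAr -!scalerAl scalerA -natrM; congr (_ *: _ + _).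
have hx : per p 1 (xyk k n.+1 1 1) by apply: (xyk_per hp); rewrite expn1.
rewrite -!(mulrA (Y n.+1)) -(mulrA (T _)) mu1_eq X_mu (mulrA (T _)) (T_mu G _ hx).
rewrite -scalerAl -scalerAr scalerA; congr (_ * _ *: _); rewrite /xyk.
have -> : a + (n.+1.*2)%:Z + ((1.*2)%:Z - n.+1%:Z - 1%:Z) = a + n.+1%:Z + 1 by lia.
by rewrite bk1 !intrD.
Qed.

Lemma XY_step n : X n * Y n * mu * (mu * Y 1 * X 1) =
  (n.+1 ^ 2)%:R *: (X n.+1 * Y n.+1 * mu) + (n%:R * (n%:R + 1 - a%:~R) - a%:~R) *: (X n * Y n * mu).
Proof.
have -> : X n * Y n * mu * (mu * Y 1 * X 1) = X n * Y n * (Y 1 * X 1 * mu).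
  by rewrite -[mu * Y 1 * X 1]mulrA mu_YX mulrA -[_ * mu * _]mulrA mu_YX !mulrA -[_ * mu * mu]mulrA mumu.
have -> : Y 1 * X 1 * mu = X 1 * Y 1 * mu - a%:~R *: mu.
  have hy : per p 1 (yxk k 1 1 1) by apply: (yxk_per hp); rewrite expn1.
  rewrite YX1 gY0 mulr1 mulrDl mu1_eq (T_mu G _ hy) -scaleNr; congr (_ + _ *: _).
  by rewrite /yxk bk1 addr0 rmorphN.
rewrite mulrBr -scalerAr scalerBl addrA; congr (_ - _).
case: n => [|n].
  by rewrite gX0 gY0 !mul1r mul0r scale0r addr0 scale1r.
rewrite !mulrA -(mulrA (X n.+1) (Y n.+1) (X 1)) YX1 mulrDr !mulrDl !mulrA gXX addn1 binSn.
rewrite -!(mulrA _ (Y _) (Y 1)) !gYY !addn1 !binSn -!scalerAl -!scalerAr -!scalerAl scalerA -natrM.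
congr (_ *: _ + _).
have hy : per p 1 (yxk k n.+1 1 1) by apply: (yxk_per hp); rewrite expn1.
rewrite -!(mulrA (X n.+1)) -(mulrA (T _)) mu1_eq Y_mu (mulrA (T _)) (T_mu G _ hy).
rewrite -scalerAl -scalerAr scalerA; congr (_ * _ *: _); rewrite /yxk.
have -> : - (a - (n.+1.*2)%:Z) + ((1.*2)%:Z - n.+1%:Z - 1%:Z) = n.+1%:Z + 1 - a by lia.
by rewrite bk1 intrD mulrNz intrD.
Qed.

End Weight.

Section Factor.
Variables (a : int) (alpha : k).
Hypothesis halpha : 2%:R * alpha = a%:~R + 1.
Local Notation mu := (T (del 1 a)).
(** For p odd, on the weight a, this is a quarter of 4YX + (H + 1)^2, a shifted Casimir element. *)
Definition casimir : A := mu * Y 1 * X 1 + (alpha ^+ 2)%:A.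

(** The roots absorb the lower terms of [YX_step] and [XY_step]: for 2 alpha = a + 1 one has n(a + n
    + 1) = (alpha + n)^2 - alpha^2 and n(n + 1 - a) - a = (alpha - 1 - n)^2 - alpha^2. *)
Definition upf n : {poly k} := \prod_(i < n) ('X - ((alpha + i%:R) ^+ 2)%:P).
Definition downf n : {poly k} := \prod_(i < n) ('X - ((alpha - 1 - i%:R) ^+ 2)%:P).
Local Notation ev := (horner_alg casimir).

Lemma mu_casimir : mu * casimir = casimir * mu.
Proof.
rewrite /casimir mulrDr mulrDl -[mu * Y 1 * X 1]mulrA mu_YX [LHS]addrC [RHS]addrC.
congr (_ + _); first by rewrite mulr_algr mulr_algl.
by rewrite mulrA mu_YX.
Qed.

Lemma mu_ev f : mu * ev f = ev f * mu.
Proof.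
elim/poly_ind: f => [|f c IHf]; first by rewrite rmorph0 mulr0 mul0r.
rewrite rmorphD rmorphM /= horner_algX horner_algC mulrDr mulrDl mulr_algl mulr_algr.
by congr (_ + _); rewrite mulrA IHf -!mulrA mu_casimir.
Qed.

Lemma ev_up n : ev (upf n) * mu = (n`! ^ 2)%:R *: (Y n * X n * mu).
Proof.
elim: n => [|n IHn].
  by rewrite /upf big_ord0 rmorph1 gX0 gY0 !mul1r fact0 scale1r.
rewrite /upf big_ord_recr /= -/(upf n) rmorphM /= -mulrA -mu_ev mulrA IHn.
rewrite rmorphB /= horner_algX horner_algC -scalerAl /casimir -addrA -scalerBl mulrDr.
rewrite YX_step -scalerAr mulr1 -addrA -scalerDl.
have -> : n%:R * (a%:~R + n%:R + 1) + (alpha ^+ 2 - (alpha + n%:R) ^+ 2) = 0.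
  have -> : a%:~R = 2%:R * alpha - 1 by rewrite halpha addrK.
  ring.
by rewrite scale0r addr0 scalerA -natrM factS expnMn mulnC.
Qed.

Lemma ev_down n : ev (downf n) * mu = (n`! ^ 2)%:R *: (X n * Y n * mu).
Proof.
elim: n => [|n IHn].
  by rewrite /downf big_ord0 rmorph1 gX0 gY0 !mul1r fact0 scale1r.
rewrite /downf big_ord_recr /= -/(downf n) rmorphM /= -mulrA -mu_ev mulrA IHn.
rewrite rmorphB /= horner_algX horner_algC -scalerAl /casimir -addrA -scalerBl mulrDr.
rewrite XY_step -scalerAr mulr1 -addrA -scalerDl.
have -> : n%:R * (n%:R + 1 - a%:~R) - a%:~R + (alpha ^+ 2 - (alpha - 1 - n%:R) ^+ 2) = 0.
  have -> : a%:~R = 2%:R * alpha - 1 by rewrite halpha addrK.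
  ring.
by rewrite scale0r addr0 scalerA -natrM factS expnMn mulnC.
Qed.

End Factor.

Lemma emat_mu (lam l : nat) a : (l <= lam)%N -> (lam < p)%N -> (p%:Z %| a - ((l.*2)%:Z - lam%:Z))%Z ->
  X l * Y p.-1 * X (p.-1 - l) * T (del 1 a) = emat G lam%:Z l (p.-1 - l).
Proof.
move=> llam lamp ha; rewrite /emat -!mulrA; congr (X l * (Y _ * _)).
rewrite (gXT G _ (delta1_per k p _)); congr (_ * _); apply: gTeq => z.
rewrite delta_shift opprK; apply: deltaE_mod; rewrite expn1.
have -> : a + ((p.-1 - l).*2)%:Z - (- lam%:Z - 2) = (a - ((l.*2)%:Z - lam%:Z)) + 2 * p%:Z by lia.
by rewrite rpredDr ?dvdz_mull.
Qed.

(** Up to squares of factorials [downf] yields X^(l) Y^(l) and [upf] yields Y^(p - 1 - l) X^(p - 1 -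
    l); the two inner factors combine to 'C(p - 1, l) Y^(p - 1). *)
Lemma ev_emat (a : int) (alpha : k) (lam l : nat) : 2%:R * alpha = a%:~R + 1 ->
  (l <= lam)%N -> (lam < p)%N -> (p%:Z %| a - ((l.*2)%:Z - lam%:Z))%Z ->
  horner_alg (casimir a alpha) (downf alpha l * upf alpha (p.-1 - l)) * T (del 1 a) =
  (l`! ^ 2 * (p.-1 - l)`! ^ 2 * 'C(p.-1, l))%:R *: emat G lam%:Z l (p.-1 - l).
Proof.
move=> hal llam lamp ha; rewrite rmorphM /= -mulrA ev_up // -scalerAr -[Y _ * X _ * _]mu_YX.
rewrite (mulrA (horner_alg _ _)) ev_down // -scalerAl scalerA -[X l * Y l * _ * _]mulrA mu_YX.
rewrite !mulrA -(mulrA (X l)) gYY -scalerAr -!scalerAl scalerA subnKC; last by lia.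
by rewrite (emat_mu llam lamp ha) -!natrM; congr (_%:R *: _); lia.
Qed.

(* The coefficients of B^(1), up to a factor; the factor alone depends on the shift s in Z^(1). *)
Definition bcoef (lam l j : nat) : k :=
  bk k (l%:Z - lam%:Z - 1) (p.-1 - j) / (j`!%:R * (l - (p.-1 - j))`!%:R).

(** This is [X_fgen] with ordinary powers in place of divided ones. With t = p - 1 - l - s, the
    identity 'C(p - 1 - i - s, l - i) (l - i)! t! = (p - 1 - i - s)! leaves s only in the outer
    factor t! and in the exponent of X, so the coefficients for s = 0 can be reused in Z^(1). *)
Lemma emat_expand (a : int) (lam l s : nat) : (l + s <= lam)%N -> (lam < p)%N ->
  (p%:Z %| a - ((l.*2)%:Z - lam%:Z))%Z ->
  (p.-1 - l - s)`!%:R *: emat G lam%:Z l (p.-1 - l - s) =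
  T (del 1 a) * \sum_(j < p | (p.-1 - l <= j)%N) bcoef lam l j *: (Y 1 ^+ j * X 1 ^+ (j - s)).
Proof.
move=> lslam lamp ha.
have lp : (l < p ^ 1)%N by rewrite expn1; lia.
have -> : emat G lam%:Z l (p.-1 - l - s) =
    X l * (Y (p ^ 1).-1 * mu_ G 1 (- lam%:Z - 2) * X (p.-1 - l - s)).
  by rewrite /emat /mu_ expn1.
rewrite (X_fgen hp) // expn1 scaler_sumr mulr_sumr.
rewrite [RHS](reindex_inj rev_ord_inj) /=.
pose F i := (p.-1 - l - s)`!%:R *: ((bk k (l%:Z - lam%:Z - 1) i *
    'C(l - i + (p.-1 - l - s), l - i)%:R) *:
   (Y (p.-1 - i) * mu_ G 1 (- lam%:Z - 2 + ((l - i).*2)%:Z) * X (l - i + (p.-1 - l - s)))).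
rewrite -[LHS]/(\sum_(i < l.+1) F i) (big_ord_widen p F) /F {F}; last by lia.
apply: eq_big => [i|i il]; first by have := ltn_ord i; lia.
have ei : (p - i.+1 = p.-1 - i)%N by lia.
rewrite ei /bcoef; have -> : (p.-1 - (p.-1 - i) = i)%N by have := ltn_ord i; lia.
rewrite gX_pow gY_pow -!scalerAl -!scalerAr !scalerA.
have -> : (l - i + (p.-1 - l - s) = p.-1 - i - s)%N by lia.
have f0 n : (n < p)%N -> n`!%:R != 0 :> k by exact: (fact_small_neq0 hp).
have h1 := f0 (p.-1 - i)%N (_ : _ < p)%N; have h2 := f0 (l - i)%N (_ : _ < p)%N.
have hb : 'C(p.-1 - i - s, l - i)%:R * (l - i)`!%:R * (p.-1 - l - s)`!%:R = (p.-1 - i - s)`!%:R :> k.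
  rewrite -!natrM -mulnA; congr (_%:R); rewrite -[in RHS](@bin_fact (p.-1 - i - s) (l - i)); last by lia.
  by congr (_ * (_ * _`!))%N; lia.
have {h1}h1 : (p.-1 - i)`!%:R != 0 :> k by apply: h1; lia.
have {h2}h2 : (l - i)`!%:R != 0 :> k by apply: h2; lia.
rewrite -hb; congr (_ *: _).
  by field; rewrite h1 h2.
rewrite !mulrA; congr (_ * _); rewrite -[RHS]/(mu_ G 1 a * _) mu_Y; congr (_ * _).
apply: mu_mod; rewrite expn1.
have -> : - lam%:Z - 2 + ((l - i).*2)%:Z - (a + ((p.-1 - i).*2)%:Z) =
   - (a - ((l.*2)%:Z - lam%:Z)) - 2 * p%:Z by lia.
by rewrite rpredDr ?rpredN ?dvdz_mull.
Qed.

(** Since m! is invertible in k for m < p, this gives the uniqueness of the c_m. *)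
Lemma coord_muYX (a : int) (d : nat -> k) (P : pred nat) (m : nat) : (m < p)%N -> P m ->
  gcoord G (T (delta k p 1 a) * \sum_(j < p | P j) d j *: (Y 1 ^+ j * X 1 ^+ j)) m m (a + (m.*2)%:Z) =
  d m * (m`! ^ 2)%:R.
Proof.
move=> mp Pm; rewrite mulr_sumr gcoord_sum (bigD1 (Ordinal mp)) //= big1 ?addr0 => [|j nj].
  rewrite -scalerAr gcoordZ gY_pow gX_pow -!scalerAl -!scalerAr !gcoordZ (mulrA (T _)).
  rewrite -[T _]/(mu_ G 1 a) mu_Y (gcoordT G _ _ _ _ _ (delta_per k p 1 _)) !eqxx.
  by rewrite delta_id !mulr1 natrX expr2 mulrA.
rewrite -scalerAr gcoordZ gY_pow gX_pow -!scalerAl -!scalerAr !gcoordZ (mulrA (T _)).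
rewrite -[T _]/(mu_ G 1 a) mu_Y (gcoordT G _ _ _ _ _ (delta_per k p 1 _)).
case: eqP => [e|_]; last by rewrite mul0r !mulr0.
by case/andP: nj => _ /negP[]; apply/eqP/val_inj.
Qed.

End Casimir.

(** * The prime field and products of the x - i^2 *)

Section PrimeField.
Variables (k : closedFieldType) (p : nat).
Hypothesis hp : p \in [pchar k].
Let p_pr : prime p. Proof. exact: pcharf_prime hp. Qed.
Let p_gt0 : (0 < p)%N. Proof. exact: prime_gt0 p_pr. Qed.
Local Notation Fp_to := (@Fp_to k p).

Lemma natr_modp n : (n %% p)%N%:R = n%:R :> k.
Proof. by rewrite {2}(divn_eq n p) natrD natrM (pcharf0 hp) mulr0 add0r. Qed.

Lemma Fp_to_nat n : Fp_to n%:R = n%:R.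
Proof. by rewrite /Defs.Fp_to val_Fp_nat // natr_modp. Qed.

Lemma Fp_to_add x y : Fp_to (x + y) = Fp_to x + Fp_to y.
Proof.
by rewrite -[x]natr_Zp -[y]natr_Zp -natrD !Fp_to_nat natrD.
Qed.

Lemma Fp_to_zmod : zmod_morphism Fp_to.
Proof. by move=> x y; apply/eqP; rewrite eq_sym subr_eq -Fp_to_add subrK. Qed.

Lemma Fp_to_monoid : monoid_morphism Fp_to.
Proof.
split=> [|x y]; first exact: (Fp_to_nat 1).
by rewrite -[x]natr_Zp -[y]natr_Zp -natrM !Fp_to_nat natrM.
Qed.

Definition Fp_rmorph : {rmorphism 'F_p -> k} :=
  HB.pack Fp_to (GRing.isZmodMorphism.Build _ _ _ Fp_to_zmod)
    (GRing.isMonoidMorphism.Build _ _ _ Fp_to_monoid).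

Lemma Fp_toE c : Fp_to c = Fp_rmorph c. Proof. by []. Qed.

(** The choice in [coefB] ranges over coefficients in F_p, so the coefficients found in k have to be
    lifted. *)
Definition inFp (x : k) : Prop := exists c, Fp_to c = x.

Lemma inFp_int (z : int) : inFp z%:~R.
Proof. by exists z%:~R; rewrite Fp_toE rmorph_int. Qed.
Lemma inFpM x y : inFp x -> inFp y -> inFp (x * y).
Proof. by move=> [c <-] [d <-]; exists (c * d); rewrite !Fp_toE rmorphM. Qed.
Lemma inFpV x : inFp x -> inFp x^-1.
Proof. by move=> [c <-]; exists c^-1; rewrite !Fp_toE fmorphV. Qed.

Definition sqf (z : int) : {poly k} := 'X - (z%:~R ^+ 2)%:P.

Lemma sqf_per z : sqf (z + p%:Z) = sqf z.
Proof. by rewrite /sqf intrD [p%:Z%:~R](pcharf0 hp) addr0. Qed.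

Lemma sqfN z : sqf (- z) = sqf z.
Proof. by rewrite /sqf rmorphN sqrrN. Qed.

Lemma prod_shift (u : int) : \prod_(i < p) sqf (u + i%:Z) = \prod_(i < p) sqf i%:Z.
Proof.
have step z : \prod_(i < p) sqf (z + 1 + i%:Z) = \prod_(i < p) sqf (z + i%:Z).
  case: p p_gt0 sqf_per => // n _ sper.
  rewrite big_ord_recr [RHS]big_ord_recl /= mulrC addr0 -addrA -[1 + n%:Z]/(n.+1%:Z) sper.
  by congr (_ * _); apply: eq_bigr => i _; rewrite /bump /= -addrA.
elim/int_ind1: u => [|u IHu|u IHu]; last by rewrite -step.
  by apply: eq_bigr => i _; rewrite add0r.
by rewrite step.
Qed.

(** As alpha = u + l + 1, the roots of [downf] are the squares of u + 1, ..., u + l and those of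
    [upf] the squares of u + l + 1, ..., u + p - 1: a full residue system with u left out. *)
Lemma updown_prod (alpha : k) (u : int) l : (l < p)%N -> alpha - 1 - l%:R = u%:~R ->
  downf alpha l * upf alpha (p.-1 - l) * sqf u = \prod_(i < p) sqf i%:Z.
Proof.
move=> lp hal; rewrite -(prod_shift u).
have hal' : alpha = u%:~R + l%:R + 1 by rewrite -hal; ring.
rewrite mulrAC; have -> : downf alpha l * sqf u = downf alpha l.+1.
  by rewrite /downf [RHS]big_ord_recr /= hal.
have -> : downf alpha l.+1 = \prod_(i < l.+1) sqf (u + i%:Z).
  rewrite /downf (reindex_inj rev_ord_inj) /=; apply: eq_bigr => i _.
  rewrite /sqf hal'; congr ('X - (_ ^+ 2)%:P).
  have il : (i <= l)%N by rewrite -ltnS.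
  by rewrite subSS natrB // intrD; ring.
have e : p = (l.+1 + (p.-1 - l))%N by lia.
rewrite [in RHS]e big_split_ord /=; congr (_ * _); rewrite /upf; apply: eq_bigr => i _.
rewrite /sqf hal'; congr ('X - (_ ^+ 2)%:P).
by rewrite PoszD -addn1 PoszD !intrD; ring.
Qed.

(** In the full product every nonzero square occurs twice, from i and from p - i, and 0 occurs once;
    psi^(1) lacks exactly one factor x - s^2. *)
Lemma psi_prod (s : nat) : odd p -> (s <= p.-1./2)%N ->
  map_poly Fp_to (psi p 1 s) * sqf s%:Z = \prod_(i < p) sqf i%:Z.
Proof.
move=> podd sh; set h := p.-1./2 in sh *.
have ph : p = h.*2.+1 by rewrite /h; lia.
have -> : \prod_(i < p) sqf i%:Z = 'X * \prod_(1 <= i < h.+1) sqf i%:Z ^+ 2.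
  rewrite ph big_ord_recl /= {1}/sqf expr0n /= subr0; congr (_ * _).
  rewrite -(big_mkord xpredT (fun i => sqf (bump 0 i)%:Z)) -addnn (big_cat_nat (n := h)) //=; last by lia.
  rewrite -{2}[h]add0n big_addn addnK [X in _ * X]big_nat_rev /= add0n.
  rewrite [RHS](big_addn 0 h.+1 1) /= subn1 /= -big_split /= big_nat [RHS]big_nat.
  apply: eq_bigr => i /andP[_ ih]; rewrite /bump /= !add1n expr2; congr (sqf _ * _).
    by rewrite addn1.
  rewrite -sqfN -[LHS]sqf_per; congr sqf; rewrite ph; lia.
have [f fE] : exists f : {rmorphism 'F_p -> k}, Fp_to =1 f by exists Fp_rmorph.
rewrite (eq_map_poly fE) /psi.
have sqE i : map_poly f ('X - ((i ^ 2)%:R)%:P) = sqf i%:Z.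
  by rewrite rmorphB /= map_polyX map_polyC /= rmorph_nat /sqf natrX.
have qE : map_poly f (\prod_(1 <= i < h.+1 | i != s) ('X - ((i ^ 2)%:R)%:P) ^+ 2) =
    \prod_(1 <= i < h.+1 | i != s) sqf i%:Z ^+ 2.
  by rewrite rmorph_prod; apply: eq_bigr => i _; rewrite rmorphXn /= sqE.
case: eqP => [s0|/eqP s0].
  rewrite qE s0 /sqf expr0n /= subr0 mulrC; congr (_ * _).
  by rewrite big_nat_cond [RHS]big_nat_cond; apply: eq_bigl => i; case: i.
have mM (x y : {poly 'F_p}) : map_poly f (x * y) = map_poly f x * map_poly f y by rewrite rmorphM.
rewrite [1 == 0]oner_eq0 mM mM sqE qE map_polyX.
rewrite [in RHS](bigD1_seq s) ?iota_uniq //=; last by rewrite mem_index_iota lt0n s0 ltnS.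
by rewrite expr2 -!mulrA; congr (_ * (_ * _)); rewrite mulrC.
Qed.

End PrimeField.

(** * The index set *)

Section Cases.
Variables (R : realType) (k : closedFieldType) (p : nat).
Hypothesis hp : p \in [pchar k].
Let p_pr : prime p. Proof. exact: pcharf_prime hp. Qed.
Let p_gt1 : (1 < p)%N. Proof. exact: prime_gt1. Qed.
Let p_gt0 : (0 < p)%N. Proof. exact: prime_gt0. Qed.

Definition hyperG : hyperlike p (hyper R k : algType k) :=
  @Hyperlike k p (hyper R k) (hX R k) (hY R k) (@hT R k) (@coord R k)
    (hX0 R k) (hY0 R k) (hXX R k) (hYY R k) (hT0 R k) (hT1 R k)
    (fun r c phi h => hTZ R hp c h)
    (fun r phi psi h1 h2 => hTD R hp h1 h2)
    (fun r phi psi h1 h2 => hTM R hp h1 h2)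
    (fun r phi n h => hT_X R hp n h)
    (fun r phi n h => hT_Y R hp n h)
    (hXY R k) (hYX R k) (@coordD R k) (@coordZl R k)
    (fun r a phi b m n z h => coord_T R hp a b m n z h).

Local Notation G := hyperG.
Local Notation X := (gX G).
Local Notation Y := (gY G).
Local Notation T := (gT G).

Lemma muE a : mu R k p a = T (delta k p 1 a).
Proof. by rewrite /= (hT_delta R hp). Qed.

Lemma hat_nat (a : nat) : (a < p)%N -> hat p a%:Z = a.
Proof. by move=> ap; rewrite /hat modz_small //= ltz_nat. Qed.

(* The conditions (A), (B), (C), (D) on (a, j) = (a, s), with the lowest weight
   - lam and the digit l of the corresponding generator; sg is s(a, j) in the
   cases (A) and (C). *)
Definition oddcase (a s lam l sg : nat) : Prop :=
  [\/ [/\ ~~ odd a, (s.*2 = lam.+1)%N, (l.*2 + p = a + lam)%N & (sg.*2 = p.+1 - a)%N],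
      [/\ ~~ odd a, (s.*2 + lam.+1 = p)%N, (l.*2 = a + lam)%N & sg = 0%N],
      [/\ odd a, (s.*2 + lam.+1 = p)%N, (l.*2 + p = a + lam)%N & (sg.*2 = p - a)%N] |
      [/\ odd a, (s.*2 = lam.+1)%N, (l.*2 = a + lam)%N & sg = 0%N]].

Lemma ratz_half_le (x y : int) : ((x%:~R : rat) / 2%:R <= y%:~R) = (x <= 2 * y)%R.
Proof. by rewrite ler_pdivrMr // -[2%:R]/(2%:~R) -intrM ler_int mulrC. Qed.

Lemma ratz_le_half (x y : int) : ((y%:~R : rat) <= x%:~R / 2%:R) = (2 * y <= x)%R.
Proof. by rewrite ler_pdivlMr // -[2%:R]/(2%:~R) -intrM ler_int mulrC. Qed.

Section Odd.
Hypothesis podd : odd p.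
Variables a s lam l sg : nat.
Hypotheses (ap : (a < p)%N) (llam : (l <= lam)%N) (lamp : (lam < p)%N).
Hypothesis hc : oddcase a s lam l sg.
Local Notation aj := (a%:Z, s%:R : rat).

Let p2 : (p == 2%N) = false.
Proof. by apply/eqP => e; move: podd; rewrite e. Qed.

Lemma condA_odd : condA p aj = ~~ odd a && (p.+1 <= a + s.*2)%N && (s.*2 <= p.-1)%N.
Proof.
rewrite /condA hat_nat // p2 /= -andbA; congr (_ && (_ && _)).
  have -> : p%:R - a%:R + 1 = (p%:Z - a%:Z + 1)%:~R :> rat by rewrite intrD intrB.
  by rewrite -[s%:R]/(s%:Z%:~R) ratz_half_le; lia.
have -> : p%:R - 1 = (p%:Z - 1)%:~R :> rat by rewrite intrB.
by rewrite -[s%:R]/(s%:Z%:~R) ratz_le_half; lia.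
Qed.

Lemma condB_odd : condB p aj = ~~ odd a && (s.*2 + a < p)%N.
Proof.
rewrite /condB hat_nat // p2; congr (_ && _); rewrite ler0n /=.
have -> : p%:R - a%:R - 1 = (p%:Z - a%:Z - 1)%:~R :> rat by rewrite !intrB.
by rewrite -[s%:R]/(s%:Z%:~R) ratz_le_half; lia.
Qed.

Lemma condC_odd : condC p aj = odd a && (s.*2 < a)%N.
Proof.
rewrite /condC hat_nat // p2; congr (_ && _); rewrite ler0n /=.
have -> : a%:R - 1 = (a%:Z - 1)%:~R :> rat by rewrite !intrB.
by rewrite -[s%:R]/(s%:Z%:~R) ratz_le_half; lia.
Qed.

Lemma condD_odd : condD p aj = odd a && (a < s.*2)%N && (s.*2 < p)%N.
Proof.
rewrite /condD hat_nat // p2 /= -andbA; congr (_ && (_ && _)).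
  have -> : a%:R + 1 = (a%:Z + 1)%:~R :> rat by rewrite intrD.
  by rewrite -[s%:R]/(s%:Z%:~R) ratz_half_le; lia.
have -> : p%:R - 1 = (p%:Z - 1)%:~R :> rat by rewrite intrB.
by rewrite -[s%:R]/(s%:Z%:~R) ratz_le_half; lia.
Qed.

Lemma condAC_odd : (condA p aj || condC p aj -> sB p aj = sg) /\
  (condA p aj || condC p aj = false -> sg = 0%N).
Proof.
rewrite condA_odd condC_odd /sB p2 /= hat_nat //.
case: hc => -[ha h1 h2 h3]; rewrite ?ha ?(negPf ha) /=; split=> //; lia.
Qed.

Lemma nB_odd : nB p 1 aj = (p.-1 - l)%N.
Proof.
have e10 : (1 == 0 :> 'F_2) = false by [].
rewrite /nB; have pl : (p.-1 - l)%N%:R + l%:R + 1 = p%:R :> rat.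
  have e : p = (p.-1 - l + l + 1)%N by lia.
  by rewrite [in RHS]e !natrD.
have cast (x y : nat) : x = y -> x%:R = y%:R :> rat by move=> ->.
suff -> : nrat p 1 aj = (p.-1 - l)%N%:R by rewrite natrK.
rewrite /nrat condA_odd condB_odd condC_odd condD_odd hat_nat // e10.
case: hc => -[ha h1 h2 h3]; rewrite ?ha ?(negPf ha) /=.
- rewrite ifT; last by lia.
  have := cast _ _ h1; have := cast _ _ h2; rewrite -!addnn -?[lam.+1]addn1 !natrD; lra.
- rewrite ifF; last by lia.
  rewrite ifT; last by lia.
  have := cast _ _ h1; have := cast _ _ h2; rewrite -!addnn -?[lam.+1]addn1 !natrD; lra.
- rewrite ifT; last by lia.
  have := cast _ _ h1; have := cast _ _ h2; rewrite -!addnn -?[lam.+1]addn1 !natrD; lra.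
- rewrite ifF; last by lia.
  rewrite ifT; last by lia.
  have := cast _ _ h1; have := cast _ _ h2; rewrite -!addnn -?[lam.+1]addn1 !natrD; lra.
Qed.

Lemma weight_odd : (p%:Z %| a%:Z - ((l.*2)%:Z - lam%:Z))%Z.
Proof.
case: hc => -[ha h1 h2 h3].
- have -> : a%:Z - ((l.*2)%:Z - lam%:Z) = 1 * p%:Z by lia.
  exact: dvdz_mull.
- by have -> : a%:Z - ((l.*2)%:Z - lam%:Z) = 0 by lia.
- have -> : a%:Z - ((l.*2)%:Z - lam%:Z) = 1 * p%:Z by lia.
  exact: dvdz_mull.
- by have -> : a%:Z - ((l.*2)%:Z - lam%:Z) = 0 by lia.
Qed.

Lemma sg_odd : (l + sg <= lam)%N /\ (lam <= (l + sg).*2)%N.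
Proof. by case: hc => -[ha h1 h2 h3]; split; lia. Qed.

(** Both psi^(1) and [downf] times [upf] are the full product of the x - i^2 with one factor
    removed. For the latter the removed index u satisfies 2u = a - 1 - 2l in k, and in each case of
    [oddcase] this gives u = s or u = -s. *)
Lemma B1_odd : B1 R k p 1 aj =
  (l`! ^ 2 * (p.-1 - l)`! ^ 2 * 'C(p.-1, l))%:R *: emat G lam%:Z l (p.-1 - l).
Proof.
rewrite /B1 p2 natrK muE.
set alpha := (a%:Z + 1)%:~R / 2%:R.
have n2 : 2%:R != 0 :> k.
  by apply: (natr_small_neq0 hp) => /=; move: podd p_gt1; case: (p) => [|[|[|]]].
have hal : 2%:R * alpha = a%:Z%:~R + 1.
  by rewrite /alpha mulrCA mulfV // mulr1 intrD.
have [u [hu hu2]] : exists u : int, alpha - 1 - l%:R = u%:~R /\ (u = s%:Z \/ u = - s%:Z).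
  have cast (x y : nat) : x = y -> x%:R = y%:R :> k by move=> ->.
  have p0 : p%:R = 0 :> k := pcharf0 hp.
  have hal' : 2%:R * alpha = a%:R + 1 by rewrite hal.
  have zD (x y z w : nat) : (x + y = z + w)%N -> x%:R + y%:R = z%:R + w%:R :> k.
    by move=> e; rewrite -!natrD e.
  have key (e : int) : (p%:Z %| a%:Z - 1 - (l.*2)%:Z - 2 * e)%Z -> alpha - 1 - l%:R = e%:~R.
    move=> /dvdzP[w hw]; apply: (mulfI n2).
    have : (a%:Z - 1 - (l.*2)%:Z - 2 * e)%:~R = 0 :> k.
      by rewrite hw intrM [p%:Z%:~R](pcharf0 hp) mulr0.
    rewrite !rmorphB rmorphM /= -!pmulrn -muln2 natrM => h.
    have -> : 2%:R * (alpha - 1 - l%:R) = 2%:R * alpha - 2%:R - l%:R * 2%:R by ring.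
    apply/eqP; rewrite hal -subr_eq0; apply/eqP; rewrite -[RHS]h; ring.
  case: hc => -[ha h1 h2 h3]; [exists (- s%:Z)|exists s%:Z|exists s%:Z|exists (- s%:Z)];
    (split; last by [left|right]); apply: key.
  - have -> : a%:Z - 1 - (l.*2)%:Z - 2 * (- s%:Z) = 1 * p%:Z by lia.
    exact: dvdz_mull.
  - have -> : a%:Z - 1 - (l.*2)%:Z - 2 * s%:Z = (-1) * p%:Z by lia.
    exact: dvdz_mull.
  - have -> : a%:Z - 1 - (l.*2)%:Z - 2 * s%:Z = 0 by lia.
    exact: dvdz0.
  - have -> : a%:Z - 1 - (l.*2)%:Z - 2 * (- s%:Z) = 0 by lia.
    exact: dvdz0.
have lp : (l < p)%N by apply: leq_ltn_trans lamp.
have sh : (s <= p.-1./2)%N.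
  by case: hc => -[ha h1 h2 h3]; move: podd; lia.
have eP : map_poly (@Fp_to k p) (psi p 1 s) = downf alpha l * upf alpha (p.-1 - l).
  have nz : sqf k s%:Z != 0 by rewrite monic_neq0 // monicXsubC.
  apply: (mulIf nz); rewrite (psi_prod hp podd sh).
  have -> : sqf k s%:Z = sqf k u by case: hu2 => ->; rewrite ?sqfN.
  by rewrite (updown_prod hp lp hu).
rewrite eP -(ev_emat hp G hal llam lamp weight_odd) /casimir.
by [].
Qed.

End Odd.
End Cases.

(** * From indices to generators at level one *)

Section Param.
Variables (R : realType) (k : closedFieldType) (p : nat).
Hypothesis hp : p \in [pchar k].
Let p_pr : prime p. Proof. exact: pcharf_prime hp. Qed.
Let p_gt1 : (1 < p)%N. Proof. exact: prime_gt1. Qed.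
Let p_gt0 : (0 < p)%N. Proof. exact: prime_gt0. Qed.
Local Notation G := (hyperG R hp).
Local Notation X := (gX G).
Local Notation Y := (gY G).
Local Notation T := (gT G).

Definition condAC (aj : int * rat) := condA p aj || condC p aj.

(** What the induction uses of an index, in a form common to odd p and p = 2. The inequalities on
    [sg] place the right weight 2(l + sg) - lam in 0, ..., p - 1. *)
Definition bparam (aj : int * rat) (lam l sg : nat) : Prop :=
  [/\ (l <= lam)%N, (lam < p)%N, (l + sg <= lam)%N, (lam <= (l + sg).*2)%N &
      (p%:Z %| aj.1 - ((l.*2)%:Z - lam%:Z))%Z] /\
  [/\ nB p 1 aj = (p.-1 - l)%N, condAC aj -> sB p aj = sg, condAC aj = false -> sg = 0%N &
      exists2 n : nat, n%:R != 0 :> k & B1 R k p 1 aj = n%:R *: emat G lam%:Z l (p.-1 - l)].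

Lemma bparam_odd (a s lam l sg : nat) : odd p -> (a < p)%N -> (l <= lam)%N -> (lam < p)%N ->
  oddcase p a s lam l sg -> bparam (a%:Z, s%:R) lam l sg.
Proof.
move=> podd ap llam lamp hc.
have [AC1 AC2] := condAC_odd hp podd ap llam lamp hc.
have [sg1 sg2] := sg_odd hp podd ap llam lamp hc.
split; split=> //; first exact: (weight_odd hp podd ap llam lamp hc).
  exact: (nB_odd hp podd ap llam lamp hc).
exists (l`! ^ 2 * (p.-1 - l)`! ^ 2 * 'C(p.-1, l))%N; last exact: (B1_odd R hp podd ap llam lamp hc).
have lp : (l < p)%N by apply: leq_ltn_trans lamp.
have h1 : l`!%:R != 0 :> k by apply: (fact_small_neq0 hp).
have h2 : (p.-1 - l)`!%:R != 0 :> k by apply: (fact_small_neq0 hp); lia.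
have h3 : 'C(p.-1, l)%:R != 0 :> k.
  by rewrite -{1}(expn1 p); apply: (bin_full_neq0 hp); rewrite expn1.
by rewrite !natrM ?natrX !mulf_neq0.
Qed.

Lemma Pset_odd_case (a s : nat) : odd p -> (a < p)%N -> (s <= p.-1./2)%N ->
  exists lam l sg, [/\ (l <= lam)%N, (lam < p)%N & oddcase p a s lam l sg].
Proof.
move=> podd ap sh.
have [oa|ea] := boolP (odd a).
  have [sa|as_] := ltnP s.*2 a.
    exists (p.-1 - s.*2)%N, (a + (p.-1 - s.*2) - p)./2, (p - a)./2.
    by split; [lia|lia|apply: Or43; split => //; lia].
  exists s.*2.-1, (a + s.*2.-1)./2, 0%N.
  by split; [lia|lia|apply: Or44; split => //; lia].
have [pa|pa] := leqP p.+1 (a + s.*2).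
  exists s.*2.-1, (a + s.*2.-1 - p)./2, (p.+1 - a)./2.
  by split; [lia|lia|apply: Or41; split => //; lia].
exists (p.-1 - s.*2)%N, (a + (p.-1 - s.*2))./2, 0%N.
by split; [lia|lia|apply: Or42; split => //; lia].
Qed.

(** The parity of lam decides whether 2s is lam + 1 or p - 1 - lam, and the comparison of 2l with
    lam decides whether a is 2l - lam or 2l - lam + p. *)
Lemma oddcase_surj (lam l : nat) : odd p -> (l <= lam)%N -> (lam < p)%N ->
  exists a s sg, [/\ (a < p)%N, (s <= p.-1./2)%N & oddcase p a s lam l sg].
Proof.
move=> podd llam lamp.
have [ol|el] := boolP (odd lam).
  have [l2|l2] := leqP lam l.*2.
    exists (l.*2 - lam)%N, (lam.+1)./2, 0%N.
    by split; [lia|lia|apply: Or44; split; lia].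
  exists (l.*2 + p - lam)%N, (lam.+1)./2, (p.+1 - (l.*2 + p - lam))./2.
  by split; [lia|lia|apply: Or41; split; lia].
have [l2|l2] := leqP lam l.*2.
  exists (l.*2 - lam)%N, (p.-1 - lam)./2, 0%N.
  by split; [lia|lia|apply: Or42; split; lia].
exists (l.*2 + p - lam)%N, (p.-1 - lam)./2, (p - (l.*2 + p - lam))./2.
by split; [lia|lia|apply: Or43; split; lia].
Qed.

End Param.

Lemma Pset_two (aj : int * rat) : Pset 2 aj ->
  [\/ aj = (0, 1 / 2%:R), aj = (1, 0) | aj = (1, 1)].
Proof.
move=> [[i hi] hb]; case: hi hb => -> /= hb.
- have i0 : i = 0 by lia.
  rewrite i0.
  by apply: Or31; rewrite mulr0.
- have i0 : i = 0 by lia.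
  rewrite i0.
  by apply: Or32; rewrite mulr0.
- have -> : i = 0 by lia.
  by apply: Or33; rewrite mulr0.
Qed.

Section Two.
Variables (R : realType) (k : closedFieldType).
Hypothesis hp : 2%N \in [pchar k].
Local Notation G := (hyperG R hp).
Local Notation X := (gX G).
Local Notation Y := (gY G).
Local Notation T := (gT G).

Lemma two_emat (a : int) (lam : nat) : (lam < 2)%N -> (2%:Z %| a + lam%:Z)%Z ->
  mu R k 2 a * hY R k 1 * hX R k 1 = emat G lam%:Z 0 1.
Proof.
move=> lam2 h.
have h' : (2%:Z %| a - (0.*2%:Z - lam%:Z))%Z by rewrite double0 sub0r opprK.
have := emat_mu hp G (leq0n lam) lam2 h'; rewrite /= => <-.
rewrite (muE R hp) -mulrA -[hY R k 1 * _]/(Y 1 * X 1) (mu_YX G).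
by rewrite -[hX R k 0]/(X 0) gX0 mul1r.
Qed.

Lemma bparam_two0 : bparam R hp (0, 1 / 2%:R) 0 0 0.
Proof.
split; split=> //.
exists 1%N; first exact: oner_neq0.
rewrite scale1r -(@two_emat 0 0) //.
Qed.

Lemma bparam_two1 : bparam R hp (1, 0) 1 0 1.
Proof.
split; split=> //.
exists 1%N; first exact: oner_neq0.
rewrite scale1r -(@two_emat 1 1) //.
Qed.

(** The generator is XY mu_1, which equals YX mu_1 + mu_1 because H acts as 1 on this weight. *)
Lemma bparam_two2 : bparam R hp (1, 1) 1 1 0.
Proof.
split; split=> //.
exists 1%N; first exact: oner_neq0.
rewrite scale1r.
have h' : (2%:Z %| 1 - (1.*2%:Z - 1%:Z))%Z by [].
have := emat_mu hp G (leqnn 1) (isT : 1 < 2)%N h'; rewrite subnn => <-.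
have hx : per 2 1 (xyk k 1 1 1) by apply: (xyk_per hp).
rewrite gX0 mulr1 -[2.-1]/1%N (XY1 G 0) mulrDl gX0 mulr1 !mu1_eq (T_mu G _ hx).
have -> : xyk k 1 1 1 1 = 1 by rewrite /xyk bk1.
rewrite scale1r -!mu1_eq -(mu_YX G) mulrA -(muE R hp).
by rewrite /B1.
Qed.

End Two.

Lemma Pset_bparam (R : realType) (k : closedFieldType) (p : nat) (hp : p \in [pchar k]) aj :
  Pset p aj -> exists lam l sg, bparam R hp aj lam l sg.
Proof.
have p_pr : prime p := pcharf_prime hp.
have [p2|p2] := eqVneq p 2%N.
  subst p => /Pset_two [] ->.
  - by exists 0%N, 0%N, 0%N; apply: bparam_two0.
  - by exists 1%N, 0%N, 1%N; apply: bparam_two1.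
  - by exists 1%N, 1%N, 0%N; apply: bparam_two2.
have podd : odd p by have [e|] := even_prime p_pr; first by rewrite e in p2.
case: aj => a j []; rewrite /PZ (negPf p2) => -[s sh /= ->] ha.
have [b eb] : exists b : nat, a = b%:Z by case: a ha => [b|b] // _; exists b.
subst a.
have bp : (b < p)%N by have := prime_gt0 p_pr; lia.
have [lam [l [sg [h1 h2 h3]]]] := Pset_odd_case hp podd bp sh.
by exists lam, l, sg; apply: bparam_odd.
Qed.

Lemma bparam_surj (R : realType) (k : closedFieldType) (p : nat) (hp : p \in [pchar k]) (lam l : nat) :
  (l <= lam)%N -> (lam < p)%N -> exists aj sg, Pset p aj /\ bparam R hp aj lam l sg.
Proof.
have p_pr : prime p := pcharf_prime hp.
have [p2|p2] := eqVneq p 2%N.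
  subst p; case: lam => [|[|//]]; case: l => [|[|//]] // _ _.
  - exists (0, 1 / 2%:R), 0%N; split; last exact: bparam_two0.
    by split=> //; exists 0; apply: Or31.
  - exists (1, 0), 1%N; split; last exact: bparam_two1.
    by split=> //; exists 0; apply: Or32.
  - exists (1, 1), 0%N; split; last exact: bparam_two2.
    by split=> //; exists 0; apply: Or33.
have podd : odd p by have [e|] := even_prime p_pr; first by rewrite e in p2.
move=> llam lamp; have [a [s [sg [ap sh hc]]]] := oddcase_surj hp podd llam lamp.
exists (a%:Z, s%:R), sg; split; last exact: bparam_odd.
by split=> /=; [rewrite /PZ (negPf p2); exists s|lia].
Qed.

(** * Evaluation of Z^(1) in the cases (A) and (C) *)

Section Zeval.
Variables (R : realType) (k : closedFieldType) (p : nat).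
Hypothesis hp : p \in [pchar k].
Let p_pr : prime p. Proof. exact: pcharf_prime hp. Qed.
Let p_gt1 : (1 < p)%N. Proof. exact: prime_gt1. Qed.
Let p_gt0 : (0 < p)%N. Proof. exact: prime_gt0. Qed.
Local Notation G := (hyperG R hp).
Local Notation X := (gX G).
Local Notation Y := (gY G).
Local Notation T := (gT G).

Lemma inFp_bcoef lam l j : inFp p (bcoef k p lam l j).
Proof.
rewrite /bcoef; apply: (inFpM hp); first exact: (inFp_int hp).
by apply: (inFpV hp); apply: (inFpM hp); exact: (inFp_int hp _%:Z).
Qed.

(** [coefB] is a choice. The expansion of e with shift 0 has coefficients in F_p, so the choice
    succeeds; comparing coordinates shows that any choice has these values from p - 1 - l on. *)
Lemma coefB_bparam aj lam l sg (n : nat) : bparam R hp aj lam l sg ->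
  B1 R k p 1 aj = n%:R *: emat G lam%:Z l (p.-1 - l) ->
  forall m : 'I_p, (p.-1 - l <= m)%N ->
  Fp_to k (@Defs.coefB R k p 1 aj m) = n%:R / (p.-1 - l)`!%:R * bcoef k p lam l m.
Proof.
move=> [[llam lamp _ _ hw] [hn _ _ _]] hB m hm.
pose d (j : nat) := n%:R / (p.-1 - l)`!%:R * bcoef k p lam l j.
have f0 : (p.-1 - l)`!%:R != 0 :> k by apply: (fact_small_neq0 hp); lia.
have hE : B1 R k p 1 aj = T (delta k p 1 aj.1) *
    \sum_(j < p | (p.-1 - l <= j)%N) d j *: (Y 1 ^+ j * X 1 ^+ j).
  have l0 : (l + 0 <= lam)%N by rewrite addn0.
  have := emat_expand hp G l0 lamp hw; rewrite subn0 => e.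
  rewrite hB -[emat _ _ _ _](scalerK f0) e scalerA scalerAr scaler_sumr; congr (_ * _).
  by apply: eq_bigr => j _; rewrite scalerA subn0.
have hd j : inFp p (d j).
  apply: (inFpM hp); last exact: inFp_bcoef.
  by apply: (inFpM hp); [exact: (inFp_int hp n%:Z)|apply: (inFpV hp); exact: (inFp_int hp _%:Z)].
have : B1 R k p 1 aj = mu R k p aj.1 *
     \sum_(m < p | (nB p 1%R aj <= m)%N) Fp_to k (@Defs.coefB R k p 1 aj m) *: (hY R k 1 ^+ m * hX R k 1 ^+ m).
  rewrite /Defs.coefB; case: xgetP => [c _ //|hc]; exfalso.
  apply: (hc [ffun j : 'I_p => sval (cid (hd j))]).
  rewrite /= (muE R hp) hn hE; congr (_ * _); apply: eq_bigr => j _.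
  by rewrite ffunE (svalP (cid (hd j))).
rewrite (muE R hp) hn {1}hE => /(congr1 (fun u => gcoord G u m m (aj.1 + (m.*2)%:Z))).
rewrite (coord_muYX G) //.
pose d' (j : nat) : k := if insub j is Some j' then Fp_to k (@Defs.coefB R k p 1 aj j') else 0.
rewrite (eq_bigr (fun j : 'I_p => d' j *: (Y 1 ^+ j * X 1 ^+ j))); last first.
  by move=> j _; rewrite /d' valK.
rewrite (coord_muYX G) // {1}/d' valK => /mulIf <- //.
by rewrite natrX expf_neq0 // (fact_small_neq0 hp).
Qed.

(** The c_m being proportional to [bcoef], the sum to the left of Fr'(z) is the expansion of e with
    its right factor shortened by [sg]; the power of X taken away stands to the right of Fr'(z). *)
Lemma Zmap_AC aj lam l sg z : bparam R hp aj lam l sg -> condAC p aj ->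
  exists2 c : k, c != 0 & Zmap p 1 z aj = c *: (emat G lam%:Z l (p.-1 - (l + sg)) * Fr' p z * X sg).
Proof.
move=> hb hAC; have := hb => -[[llam lamp h1 h2 hw] [hn hs _ [n n0 hB]]].
have f0 : (p.-1 - l)`!%:R != 0 :> k by apply: (fact_small_neq0 hp); lia.
have f1 : (p.-1 - l - sg)`!%:R != 0 :> k by apply: (fact_small_neq0 hp); lia.
have f2 : sg`!%:R != 0 :> k by apply: (fact_small_neq0 hp); lia.
exists (n%:R / (p.-1 - l)`!%:R * (p.-1 - l - sg)`!%:R * sg`!%:R).
  by rewrite !mulf_neq0 ?invr_neq0.
rewrite /Zmap -/(condAC p aj) hAC (hs hAC) hn (muE R hp).
have -> : (n%:R / (p.-1 - l)`!%:R * (p.-1 - l - sg)`!%:R * sg`!%:R) *: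
     (emat G lam%:Z l (p.-1 - (l + sg)) * Fr' p z * X sg) =
   (n%:R / (p.-1 - l)`!%:R) *: (((p.-1 - l - sg)`!%:R *: emat G lam%:Z l (p.-1 - l - sg)) *
     Fr' p z * X 1 ^+ sg).
  by rewrite gX_pow -!scalerAl -scalerAr !scalerA subnDA.
rewrite (emat_expand hp G h1 lamp hw) -!mulrA scalerAr; congr (_ * _).
rewrite mulr_suml scaler_sumr; apply: eq_bigr => j hj.
rewrite (coefB_bparam hb hB) // -!scalerAl scalerA; congr (_ *: _).
by rewrite !mulrA.
Qed.

End Zeval.

(** * The normal form of the elements of U_r *)

Section Span.
Variables (k : fieldType) (p : nat).
Hypothesis hp : p \in [pchar k].
Variables (A : algType k) (G : hyperlike p A) (r : nat).
Local Notation X := (gX G).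
Local Notation Y := (gY G).
Local Notation T := (gT G).
Local Notation q := (p ^ r)%N.

Definition pbw_span (u : A) : Prop := exists phi : nat -> nat -> int -> k,
  (forall m n, per p r (phi m n)) /\
  u = \sum_(m < q) \sum_(n < q) Y m * T (phi m n) * X n.

Lemma pbw_span0 : pbw_span 0.
Proof.
exists (fun _ _ _ => 0); split=> //.
by rewrite big1 // => m _; rewrite big1 // => n _; rewrite gT0 mulr0 mul0r.
Qed.

Lemma pbw_spanZD c u v : pbw_span u -> pbw_span v -> pbw_span (c *: u + v).
Proof.
move=> [phi [h1 ->]] [psi [h2 ->]].
exists (fun m n z => c * phi m n z + psi m n z); split=> [m n z|].
  by rewrite h1 h2.
rewrite scaler_sumr -big_split; apply: eq_bigr => m _ /=.
rewrite scaler_sumr -big_split; apply: eq_bigr => n _ /=.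
have hc : per p r (fun z => c * phi m n z) by move=> z; rewrite h1.
by rewrite (gTD G hc (h2 m n)) (gTZ G _ (h1 m n)) mulrDr mulrDl -scalerAr -scalerAl.
Qed.

Lemma pbw_spanD u v : pbw_span u -> pbw_span v -> pbw_span (u + v).
Proof. by move=> h1 h2; rewrite -[u]scale1r; apply: pbw_spanZD. Qed.

Lemma pbw_spanZ c u : pbw_span u -> pbw_span (c *: u).
Proof. by move=> h; rewrite -[_ *: _]addr0; apply: pbw_spanZD h pbw_span0. Qed.

Lemma pbw_span_sum (I : Type) (s : seq I) (P : pred I) (F : I -> A) :
  (forall i, P i -> pbw_span (F i)) -> pbw_span (\sum_(i <- s | P i) F i).
Proof.
by move=> h; elim/big_ind: _ => //; [exact: pbw_span0|exact: pbw_spanD].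
Qed.

Lemma pbw_span_base m n phi : (m < q)%N -> (n < q)%N -> per p r phi ->
  pbw_span (Y m * T phi * X n).
Proof.
move=> mq nq h; exists (fun i j z => if (i == m) && (j == n) then phi z else 0).
split=> [i j z|]; first by rewrite h.
rewrite (bigD1 (Ordinal mq)) //= (bigD1 (Ordinal nq)) //= !eqxx /=.
rewrite [X in _ = _ * _ + X + _]big1 ?addr0 => [|j nj]; last first.
  have /negPf -> : (j : nat) != n by apply: contra nj => /eqP e; apply/eqP/val_inj.
  by rewrite gT0 mulr0 mul0r.
rewrite [X in _ = _ + X]big1 ?addr0 // => i ni.
have /negPf -> : (i : nat) != m by apply: contra ni => /eqP e; apply/eqP/val_inj.
by rewrite big1 // => j _; rewrite gT0 mulr0 mul0r.
Qed.

Lemma pbw_span_Y a u : (a < q)%N -> pbw_span u -> pbw_span (Y a * u).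
Proof.
move=> aq [phi [h ->]]; rewrite mulr_sumr; apply: pbw_span_sum => m _.
rewrite mulr_sumr; apply: pbw_span_sum => n _.
rewrite !mulrA (gYY_small hp _ (r := r)) // -!scalerAl; case: ltnP => amq.
  exact/pbw_spanZ/pbw_span_base.
by rewrite scale0r; apply: pbw_span0.
Qed.

(** Straightening stays inside the range: the new middle factors have index i <= a < q and so are
    periodic modulo q, and a product of divided powers of X reaching q vanishes. *)
Lemma pbw_span_X a u : (a < q)%N -> pbw_span u -> pbw_span (X a * u).
Proof.
move=> aq [phi [h ->]]; rewrite mulr_sumr; apply: pbw_span_sum => m _.
rewrite mulr_sumr; apply: pbw_span_sum => n _.
rewrite !mulrA (XYTX hp _ _ _ _ (h m n)); apply: pbw_span_sum => i im.
have ia : (i <= a)%N by rewrite -ltnS.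
have aiq : (a - i < q)%N by apply: leq_ltn_trans (leq_subr _ _) aq.
rewrite (gXX_small hp _ (r := r)) // -scalerAr; case: ltnP => amq; last by rewrite scale0r; apply: pbw_span0.
apply/pbw_spanZ/pbw_span_base => //.
  exact: leq_ltn_trans (leq_subr _ _) (ltn_ord m).
move=> z; rewrite addrAC h (xyk_per hp) //.
exact: leq_ltn_trans ia aq.
Qed.

Lemma pbw_span1 : pbw_span 1.
Proof.
have q0 : (0 < q)%N by rewrite expn_gt0 prime_gt0 // (pcharf_prime hp).
have -> : 1 = Y 0 * T (fun=> 1) * X 0 by rewrite gX0 gY0 gT1 !mulr1.
exact: pbw_span_base.
Qed.

End Span.

(** * Induction over the digits *)

Section Multi.
Variables (R : realType) (k : closedFieldType) (p : nat).
Hypothesis hp : p \in [pchar k].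
Let p_pr : prime p. Proof. exact: pcharf_prime hp. Qed.
Let p_gt0 : (0 < p)%N. Proof. exact: prime_gt0. Qed.
Local Notation G := (hyperG R hp).
Local Notation X := (gX G).
Local Notation Y := (gY G).
Local Notation T := (gT G).

Lemma bin_small_neq0 n s : (s <= n)%N -> (n < p)%N -> 'C(n, s)%:R != 0 :> k.
Proof.
move=> sn np; have := fact_small_neq0 hp np; rewrite -(bin_fact sn) natrM.
by apply: contra => /eqP ->; rewrite mul0r.
Qed.

(** In the cases (A) and (C) e already stands to the left of Fr'. Otherwise the shift is 0 and e
    commutes with the relevant values of Fr' by [FF_emat]. Both cases then come down to
    [emat_esoc]. *)
Lemma Zmap_esoc aj lam l sg r lam' l' c : bparam R hp aj lam l sg -> (l' < p ^ r)%N ->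
  exists2 d : k, d != 0 & Zmap p 1 (c *: esoc G r lam' l') aj =
    (d * c) *: esoc G r.+1 (lam + lam' * p) (l + l' * p).
Proof.
move=> hb l'q.
have FFD (u v : hyper R k) : Fr' p (u + v) = Fr' p u + Fr' p v by exact: (FrD hp).
have FFZ c' (u : hyper R k) : Fr' p (c' *: u) = c' *: Fr' p u by exact: (FrZ hp).
have FFT s m n phi (h : per p s phi) :
  Fr' p (Y m * T phi * X n) = Y (m * p) * T (fdiv p phi) * X (n * p).
  exact: Fr_T.
have := hb => -[[llam lamp h1 h2 hw] [hn hs hs0 [n n0 hB]]].
have he := emat_esoc hp FFD FFZ FFT lam' llam lamp h1 h2 l'q.
have hbn : 'C(p.-1 - l, sg)%:R != 0 :> k by apply: bin_small_neq0; lia.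
have [hAC|hAC] := boolP (condAC p aj).
  have [d d0 ->] := Zmap_AC (c *: esoc G r lam' l') hb hAC.
  exists (d * 'C(p.-1 - l, sg)%:R); first by rewrite mulf_neq0.
  rewrite FFZ -scalerAr -scalerAl he !scalerA; congr (_ *: _); ring.
have sg0 : sg = 0%N by apply: hs0; apply: negbTE.
exists n%:R => //.
rewrite /Zmap -/(condAC p aj) (negPf hAC) hB FFZ -scalerAl -scalerAr scalerA mulrC.
congr (_ *: _); move: he; rewrite sg0 addn0 gX0 mulr1 bin0 scale1r => <-.
have -> : esoc G r lam' l' = X l' * Y (p ^ r).-1 * T (delta k p r (- lam'%:Z - 2)) * X ((p ^ r).-1 - l').
  by rewrite /esoc /fvec !mulrA.
exact: (FF_emat hp FFD FFZ FFT _ _ _ llam lamp (delta_per k p r _)).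
Qed.

Lemma esoc1 lam l : esoc G 1 lam l = emat G lam%:Z l (p.-1 - l).
Proof. by rewrite /esoc /fvec /emat /mu_ expn1. Qed.

Definition ones (s : seq (int * rat)) := zip (nseq (size s) (1 : 'F_2)) s.

Lemma Bmulti_cons aj aj' s :
  Bmulti R k p (ones (aj :: aj' :: s)) = Zmap p 1 (Bmulti R k p (ones (aj' :: s))) aj.
Proof. by []. Qed.

Lemma Bmulti_esoc s : (0 < size s)%N -> (forall aj, aj \in s -> Pset p aj) ->
  exists lam l, [/\ (lam < p ^ size s)%N, (l < p ^ size s)%N, 'C(lam, l)%:R != 0 :> k &
    exists2 c : k, c != 0 & Bmulti R k p (ones s) = c *: esoc G (size s) lam l].
Proof.
elim: s => // aj [_ _ hP|aj' s IHs _ hP].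
  have [|lam [l [sg hb]]] := Pset_bparam R hp (aj := aj); first by apply: hP; rewrite inE.
  have [[llam lamp _ _ _] [_ _ _ [n n0 hB]]] := hb.
  exists lam, l; rewrite /= expn1 esoc1; split => //.
  - exact: leq_ltn_trans lamp.
  - exact: bin_small_neq0.
  - by exists n%:R.
have [//||lam' [l' [lam'q l'q hC [c c0 hc]]]] := IHs.
  by move=> a ha; apply: hP; rewrite inE ha orbT.
have [|lam [l [sg hb]]] := Pset_bparam R hp (aj := aj); first by apply: hP; rewrite inE eqxx.
have [[llam lamp _ _ _] _] := hb.
have lp : (l < p)%N by apply: leq_ltn_trans lamp.
have [d d0 hd] := Zmap_esoc lam' c hb l'q.
exists (lam + lam' * p)%N, (l + l' * p)%N; split.
- by rewrite /= expnSr; apply: leq_trans (_ : lam'.+1 * p <= _)%N; [rewrite mulSn ltn_add2r|rewrite leq_pmul2r].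
- by rewrite /= expnSr; apply: leq_trans (_ : l'.+1 * p <= _)%N; [rewrite mulSn ltn_add2r|rewrite leq_pmul2r].
- by rewrite (bin_lucas hp) // mulf_neq0 // bin_small_neq0.
- by exists (d * c); rewrite ?mulf_neq0 // Bmulti_cons hc hd.
Qed.

(** By Lucas the binomial is nonzero in k exactly when each digit of l is at most the digit of lam
    in the same place, so an index can be chosen for each pair of digits independently. *)
Lemma esoc_Bmulti r lam l : (0 < r)%N -> (lam < p ^ r)%N -> (l < p ^ r)%N ->
  'C(lam, l)%:R != 0 :> k ->
  exists s, [/\ size s = r, (forall aj, aj \in s -> Pset p aj) &
    exists2 c : k, c != 0 & Bmulti R k p (ones s) = c *: esoc G r lam l].
Proof.
elim: r lam l => // -[_ lam l _|r IHr lam l _].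
  rewrite expn1 => lamp lp hC.
  have llam : (l <= lam)%N by rewrite leqNgt; apply: contra hC => h; rewrite bin_small.
  have [aj [sg [hP hb]]] := bparam_surj R hp llam lamp.
  have [_ [_ _ _ [n n0 hB]]] := hb.
  exists [:: aj]; split => //; first by move=> a; rewrite inE => /eqP ->.
  by exists n%:R; rewrite // esoc1.
move=> lamq lq; rewrite {1}(divn_eq lam p) {1}(divn_eq l p).
rewrite ![(_ * p + _)%N]addnC (bin_lucas hp) ?ltn_mod // mulf_eq0 negb_or => /andP[hC0 hC].
have llam : (l %% p <= lam %% p)%N by rewrite leqNgt; apply: contra hC0 => h; rewrite bin_small.
have lamp : (lam %% p < p)%N by rewrite ltn_mod.
have dq x : (x < p ^ r.+2)%N -> (x %/ p < p ^ r.+1)%N by rewrite ltn_divLR // -expnSr.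
have [s [ss hs [c c0 hc]]] := IHr _ _ isT (dq _ lamq) (dq _ lq) hC.
have [aj [sg [hP hb]]] := bparam_surj R hp llam lamp.
have [d d0 hd] := Zmap_esoc (lam %/ p) c hb (dq _ lq).
exists (aj :: s); split; first by rewrite /= ss.
  by move=> a; rewrite inE => /orP[/eqP ->|/hs].
exists (d * c); first by rewrite mulf_neq0.
case: s ss hs hc => // aj' s ss hs hc; rewrite Bmulti_cons hc hd.
by rewrite ![(_ %% p + _)%N]addnC -!divn_eq.
Qed.

End Multi.

(** * The socle of the Frobenius kernel *)

Section FrobeniusKernel.
Variables (R : realType) (k : closedFieldType) (p r : nat).
Hypothesis hp : p \in [pchar k].
Let p_pr : prime p. Proof. exact: pcharf_prime hp. Qed.
Let p_gt0 : (0 < p)%N. Proof. exact: prime_gt0. Qed.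
Local Notation hyp := (hyper R k).
Local Notation G := (hyperG R hp).
Local Notation X := (gX G).
Local Notation Y := (gY G).
Local Notation T := (gT G).
Local Notation q := (p ^ r)%N.
Local Notation Up := (@Urpred R k p r).

Lemma Ur_X n : (n < q)%N -> hX R k n \in Up.
Proof. by move=> nq; rewrite /Urpred inE => S [_]; apply; exists n => //; left. Qed.
Lemma Ur_Y n : (n < q)%N -> hY R k n \in Up.
Proof. by move=> nq; rewrite /Urpred inE => S [_]; apply; exists n => //; right. Qed.

(** The idempotent is an integer-valued polynomial of degree q - 1 in H, so [evp_subring] with the
    bound q obtains it from the X^(n), Y^(n) with n < q alone. The subring in question is the
    preimage of U_r in the Kostant form. *)
Lemma Ur_hdelta b : hdelta R k p r b \in Up.
Proof.
rewrite (hdelta_img R).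
pose S : {pred Usl2 R} := fun u => (u \in @UZpred R) && (Defs.img k u \in Up).
suff : evp (Uh R) (dpoly R p r b) \in S by case/andP.
apply: (@evp_subring R S q).
- split.
  + by rewrite unfold_in /= rpred1 img1 rpred1.
  + move=> u v /andP[u1 u2] /andP[v1 v2]; rewrite unfold_in rpredB //=.
    have -> : Defs.img k (u - v) = Defs.img k u - Defs.img k v.
      by apply/eqP; rewrite eq_sym subr_eq -imgD ?rpredB // subrK.
    by rewrite rpredB.
  + move=> u v /andP[u1 u2] /andP[v1 v2]; rewrite unfold_in rpredM //=.
    by rewrite imgM // rpredM.
- move=> n nq; split; apply/andP; split; rewrite ?bX_UZ ?bY_UZ // -?hXE -?hYE.
    exact: Ur_X.
  exact: Ur_Y.
- exact: intval_dpoly.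
- rewrite /dpoly; apply: leq_trans (size_comp_poly_leq _ _) _.
  rewrite size_XaddC muln1; have := size_bpoly R[i] q.-1.
  have : (0 < q)%N by rewrite expn_gt0 p_gt0.
  by case: (size _) => /= [|n] q0; rewrite prednK.
Qed.

Lemma Ur_T phi : per p r phi -> T phi \in Up.
Proof.
move=> h; rewrite -[T phi]/(hT R phi) (hT_sum R hp h); apply: rpred_sum => b _.
by apply/rpredZ/Ur_hdelta.
Qed.

Lemma Ur_span u : u \in Up -> pbw_span G r u.
Proof.
rewrite /Urpred inE => hu.
(* As for the Kostant form: the left multipliers that preserve the normal form are a subalgebra
   containing the generators. *)
pose S : set hyp := [set u | forall w, pbw_span G r w -> pbw_span G r (u * w)].
have hS : S u.
  apply: hu; split.
    split.
    - by rewrite inE => w; rewrite mul1r.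
    - move=> c a b; rewrite !inE => ha hb w hw; rewrite mulrDl -scalerAl.
      by apply: pbw_spanZD; [apply: ha|apply: hb].
    - by move=> a b; rewrite !inE => ha hb w hw; rewrite -mulrA; apply/ha/hb.
  move=> v [n nq [->|->]] w hw.
    by apply: (pbw_span_X hp (G := G)).
  by apply: (pbw_span_Y hp (G := G)).
by have := hS 1 (pbw_span1 hp G r); rewrite mulr1.
Qed.

Lemma esoc_Ur lam l : (l < q)%N -> esoc G r lam l \in Up.
Proof.
move=> lq; have q0 : (0 < q)%N by rewrite expn_gt0 p_gt0.
rewrite /esoc /fvec !rpredM //.
- exact: Ur_X.
- by apply: Ur_Y; rewrite prednK.
- exact/Ur_T/delta_per.
- by apply: Ur_X; lia.
Qed.

Lemma fvec_Ur lam l : fvec G r lam l \in Up.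
Proof.
have q0 : (0 < q)%N by rewrite expn_gt0 p_gt0.
rewrite /fvec !rpredM //.
- by apply: Ur_Y; rewrite prednK.
- exact/Ur_T/delta_per.
- by apply: Ur_X; lia.
Qed.

Let V (u : hyp) : Prop := u \in Up.
Let VT phi : per p r phi -> V (T phi). Proof. exact: Ur_T. Qed.
Let VX n : (n < q)%N -> V (X n). Proof. exact: Ur_X. Qed.
Let VY n : (n < q)%N -> V (Y n). Proof. exact: Ur_Y. Qed.
Let VM u v : V u -> V v -> V (u * v). Proof. exact: rpredM. Qed.
Let VZ c u : V u -> V (c *: u). Proof. exact: rpredZ. Qed.
Let Vspan u : V u -> exists phi : nat -> nat -> int -> k,
  (forall m n, per p r (phi m n)) /\
  u = \sum_(m < q) \sum_(n < q) Y m * T (phi m n) * X n.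
Proof. exact: Ur_span. Qed.

Local Notation UrT := (Ur R k p r).
Local Notation Vr := (UrT^o).

(** Applied below to elements of U_r only, so the default 0 does not intervene. *)
Definition toUr (u : hyp) : UrT := insubd (0 : UrT) u.
Lemma toUrK u : u \in Up -> Urval (toUr u) = u.
Proof. by move=> h; rewrite /toUr val_insubd h. Qed.

Lemma Ur_valM (u v : UrT) : Urval (u * v) = Urval u * Urval v.
Proof. by []. Qed.
Lemma Ur_valD (u v : UrT) : Urval (u + v) = Urval u + Urval v.
Proof. by []. Qed.
Lemma Ur_val0 : Urval (0 : UrT) = 0.
Proof. by []. Qed.

Lemma submodP (N : set Vr) : submodule N ->
  [/\ N 0, (forall u v : UrT, N u -> N v -> N (u + v)) & forall (a u : UrT), N u -> N (a * u)].
Proof.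
move=> [N0 NL]; rewrite inE in N0; split=> // [u v hu hv|a u hu].
  have := NL 1 u v; rewrite !inE scale1r; exact.
have := NL a u 0; rewrite !inE addr0; exact.
Qed.

Lemma submodI (N : set Vr) : N 0 -> (forall u v : UrT, N u -> N v -> N (u + v)) ->
  (forall (a u : UrT), N u -> N (a * u)) -> submodule N.
Proof.
move=> N0 ND NM; split; first by rewrite inE.
by move=> a u v; rewrite !inE => hu hv; apply: ND => //; apply: NM.
Qed.

Lemma sum_submodules_add (I : Type) (D : set I) (F : I -> set Vr) x y :
  sum_submodules D F x -> sum_submodules D F y -> sum_submodules D F (x + y).
Proof.
move=> [n [v [hv ->]]] [m [w [hw ->]]].
exists (n + m)%N, (fun i => match fintype.split i with inl j => v j | inr j => w j end); split.
  by move=> i; case: fintype.split => j; [apply: hv|apply: hw].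
rewrite big_split_ord /=; congr (_ + _); apply: eq_bigr => j _.
  by case: (split_ordP (lshift m j)) => j' /eqP; rewrite ?eq_lrshift // eq_lshift => /eqP <-.
by case: (split_ordP (rshift n j)) => j' /eqP; rewrite ?eq_rlshift // eq_rshift => /eqP <-.
Qed.

Lemma sum_submodules1 (I : Type) (D : set I) (F : I -> set Vr) d x :
  D d -> F d x -> sum_submodules D F x.
Proof. by move=> hd hx; exists 1%N, (fun=> x); split=> [i|]; [exists d|rewrite big_ord1]. Qed.

Lemma sum_submodules0 (I : Type) (D : set I) (F : I -> set Vr) : sum_submodules D F 0.
Proof. by exists 0%N, (fun=> 0); split=> [[]|] //; rewrite big_ord0. Qed.

Lemma sum_submodules_submod (I : Type) (D : set I) (F : I -> set Vr) :
  (forall d, D d -> submodule (F d)) -> submodule (sum_submodules D F).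
Proof.
move=> hF; apply: submodI.
- exact: sum_submodules0.
- by move=> u v; apply: sum_submodules_add.
- move=> a u [n [v [hv ->]]]; exists n, (fun i => a * v i); split; last by rewrite mulr_sumr.
  by move=> i; have [d Dd Fd] := hv i; exists d => //; case: (submodP (hF d Dd)) => _ _; apply.
Qed.

Definition cyc (B : hyp) : set Vr := [set u : Vr | exists v : UrT, Urval u = Urval v * B].

Lemma cyc_submod B : submodule (cyc B).
Proof.
apply: submodI => [|u v [a ha] [b hb]|a u [b hb]].
- by exists 0; rewrite Ur_val0 mul0r.
- by exists (a + b); rewrite !Ur_valD ha hb mulrDl.
- by exists (a * b); rewrite !Ur_valM hb mulrA.
Qed.

(** A nonzero element of a submodule is a multiple of f(lam, l); [fvec_simple] leads from it back to
    f(lam, l), hence to the generator. *)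
Lemma cyc_simple c lam l : (l < q)%N -> 'C(lam, l)%:R != 0 :> k -> c != 0 ->
  simple_submodule (cyc (c *: esoc G r lam l)).
Proof.
move=> lq hl c0; set B := c *: _.
have hB : B \in Up by apply/rpredZ/esoc_Ur.
have fB : (c * 'C(lam, l)%:R)^-1 *: Y l * B = fvec G r lam l.
  rewrite /B /esoc -scalerAl -scalerAr (YX_fvec hp) // !scalerA -mulrA mulVf ?scale1r //.
  by rewrite mulf_neq0.
have B0 : B != 0.
  apply/eqP => e; case/eqP: (fvec_neq0 G r lam l).
  by rewrite -fB e mulr0.
split; first exact: cyc_submod.
  move=> e; have : cyc B (toUr B) by exists 1; rewrite toUrK // mul1r.
  by rewrite e /= => e'; case/eqP: B0; rewrite -(toUrK hB) e'.
move=> N hN NB; have [N0 ND NM] := submodP hN.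
have [h|h] := pselect (forall w, N w -> w = 0).
  by left; apply/seteqP; split=> w /=; [apply: h|move=> ->].
right; apply/seteqP; split=> // w [v hv].
have [w1 [Nw1 w10]] : exists w1 : UrT, N w1 /\ w1 != 0.
  apply: contrapT => h'; apply: h => w1 Nw1; apply: contrapT => w10.
  by apply: h'; exists w1; split => //; apply/eqP.
have [v1 hv1] := NB _ Nw1.
have Bf : B = (c *: X l) * fvec G r lam l by rewrite /B /esoc -scalerAl.
have [||u' hu' e'] := fvec_simple hp VY VZ Vspan lq hl (u := Urval v1 * (c *: X l)).
- by apply: VM; [exact: UrvalP|apply/VZ/VX].
- rewrite -mulrA -Bf -hv1; apply: contra w10 => /eqP e.
  by apply/eqP/val_inj.
rewrite -mulrA -Bf -hv1 in e'.
suff -> : w = v * toUr (c *: X l * u') * w1 by apply: NM.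
have hcu : c *: X l * u' \in Up by apply: rpredM => //; apply/VZ/VX.
by apply: val_inj; rewrite /= hv toUrK // Bf -e' !mulrA.
Qed.

Hypothesis hr : (0 < r)%N.

Local Notation D := [set aj : r.-tuple (int * rat) | forall i : 'I_r, Pset p (tnth aj i)].
Local Notation Bt aj := (Beps R k p (nseq_tuple r (1 : 'F_2)) aj).
Definition socsum : set Vr := sum_submodules D (fun aj => cyc (Bt aj)).

Lemma Beps_esoc (aj : r.-tuple (int * rat)) : D aj -> exists lam l,
  [/\ (lam < q)%N, (l < q)%N, 'C(lam, l)%:R != 0 :> k &
    exists2 c : k, c != 0 & Bt aj = c *: esoc G r lam l].
Proof.
move=> hD; have := @Bmulti_esoc R k p hp aj; rewrite size_tuple => /(_ hr) [|lam [l [h1 h2 h3 [c c0 h4]]]].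
  by move=> x /tnthP[i ->].
exists lam, l; split=> //; exists c => //.
by rewrite -h4 /Beps /ones /= size_tuple.
Qed.

Lemma esoc_Beps lam l : (lam < q)%N -> (l < q)%N -> 'C(lam, l)%:R != 0 :> k ->
  exists2 aj : r.-tuple (int * rat), D aj &
    exists2 c : k, c != 0 & Bt aj = c *: esoc G r lam l.
Proof.
move=> h1 h2 h3; have [s [ss hs [c c0 hc]]] := esoc_Bmulti R hp hr h1 h2 h3.
have hs' : size s == r by apply/eqP.
exists (Tuple hs'); first by move=> i /=; apply: hs; apply: mem_tnth.
exists c => //; rewrite -hc /Beps /ones /=; congr (Bmulti _ _ _ (zip (nseq _ _) _)).
by rewrite ss.
Qed.

Lemma socsum_fvec lam l (u : UrT) : (lam < q)%N -> (l < q)%N -> 'C(lam, l)%:R != 0 :> k ->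
  Urval u = fvec G r lam l -> socsum u.
Proof.
move=> h1 h2 h3 hu; have [aj Daj [c c0 hB]] := esoc_Beps h1 h2 h3.
apply: (sum_submodules1 Daj); exists (toUr ((c * 'C(lam, l)%:R)^-1 *: Y l)).
rewrite toUrK; last by apply/VZ/VY.
rewrite hu hB /esoc -scalerAl -scalerAr (YX_fvec hp) // !scalerA -mulrA mulVf ?scale1r //.
by rewrite mulf_neq0.
Qed.

Lemma socsum_submod : submodule socsum.
Proof. by apply: sum_submodules_submod => aj _; apply: cyc_submod. Qed.

Lemma simple_socsum (N : set Vr) : simple_submodule N -> N `<=` socsum.
Proof.
move=> [hN Nn0 Nsimple]; have [N0 ND NM] := submodP hN.
have [S0 SD SM] := submodP socsum_submod.
(* The submodule seen inside the hyperalgebra, where the results on lowest weight vectors apply. *)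
pose M (x : hyp) := exists u : UrT, N u /\ Urval u = x.
have MV x : M x -> V x by move=> [u [_ <-]]; exact: UrvalP.
have MM u x : V u -> M x -> M (u * x).
  move=> hu [v [Nv <-]]; exists (toUr u * v); split; first exact: NM.
  by rewrite Ur_valM toUrK.
have Ncyc (w : UrT) : N w -> w != 0 -> forall v, N v -> exists u : UrT, v = u * w.
  move=> Nw w0.
  have hcs : submodule [set v : Vr | exists u : UrT, v = u * w].
    apply: submodI => [|u v [a ->] [b ->]|a u [b ->]].
    - by exists 0; rewrite mul0r.
    - by exists (a + b); rewrite mulrDl.
    - by exists (a * b); rewrite mulrA.
  have [|e|e] := Nsimple _ hcs.
  - by move=> v [u ->]; apply: NM.
  - have : [set v : Vr | exists u : UrT, v = u * w] w by exists 1; rewrite mul1r.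
    by rewrite e /= => e'; case/eqP: w0.
  - by move=> v; rewrite -e.
have Mcyc v w : M v -> M w -> w != 0 -> exists2 u, V u & v = u * w.
  move=> [v' [Nv' <-]] [w' [Nw' <-]] w0.
  have [|u ->] := Ncyc w' Nw' _ v' Nv'; first by apply: contra w0 => /eqP ->.
  by exists (Urval u); [exact: UrvalP|].
have [v0 [Nv0 v00]] : exists v0 : UrT, N v0 /\ v0 != 0.
  apply: contrapT => h'; apply: Nn0; apply/seteqP; split=> w /=; last by move=> ->.
  move=> Nw; apply: contrapT => w0; apply: h'; exists w; split=> //.
  exact/eqP.
have Mv0 : M (Urval v0) by exists v0.
have v00' : Urval v0 != 0 by apply: contra v00 => /eqP e; apply/eqP/val_inj.
have [lam [v [lamq Mv vn hv]]] := simple_lowest hp VT VY MM Mv0 v00'.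
have [c [hc ev]] := simple_fvec hp VX Vspan MV MM Mcyc lamq Mv vn hv.
have [v' [Nv' ev']] := Mv.
(* Being nonzero, v' generates the simple module, so its membership suffices. *)
have Sv' : socsum v'.
  have -> : v' = \sum_(l < q) toUr (c l *: fvec G r lam l).
    apply: val_inj; rewrite /= ev' ev.
    have hh n : Urval (\sum_(l < n) toUr (c l *: fvec G r lam l)) = \sum_(l < n) c l *: fvec G r lam l.
      elim: n => [|n IHn]; first by rewrite !big_ord0.
      by rewrite !big_ord_recr Ur_valD IHn /= toUrK // rpredZ // fvec_Ur.
    by rewrite hh.
  elim/big_ind: _ => // l _.
  have [c0|cn0] := eqVneq (c l) 0.
    have -> : toUr (c l *: fvec G r lam l) = 0 :> UrT; last by [].
    by apply: val_inj; rewrite /= toUrK c0 scale0r // rpred0.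
  have -> : toUr (c l *: fvec G r lam l) = toUr (c l *: 1) * toUr (fvec G r lam l).
    apply: val_inj; rewrite /= !toUrK ?rpredZ ?fvec_Ur ?rpred1 //.
    by rewrite -scalerAl mul1r.
  apply: SM; apply: (@socsum_fvec lam l) => //.
    exact: hc.
  by rewrite toUrK ?fvec_Ur.
have v'0 : v' != 0 by apply: contra vn => /eqP e; rewrite -ev' e.
by move=> x Nx; have [u ->] := Ncyc v' Nv' v'0 x Nx; apply: SM.
Qed.

Lemma socsum_socle : is_socle socsum.
Proof.
have [S0 SD SM] := submodP socsum_submod.
split; last first.
  move=> M [_ ->] x [n [v [hv ->]]].
  elim/big_ind: _ => // i _; have [N [sN _] Nv] := hv i.
  exact: simple_socsum sN _ Nv.
split; first exact: socsum_submod.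
apply/seteqP; split=> x [n [v [hv ->]]].
  exists n, v; split=> // i; have [aj Daj Fv] := hv i.
  exists (cyc (Bt aj)) => //; split; last first.
    by move=> y hy; apply: (sum_submodules1 Daj).
  have [lam [l [h1 h2 h3 [c c0 ->]]]] := Beps_esoc Daj.
  exact: cyc_simple.
elim/big_ind: _ => // i _; have [N [_ NS] Nv] := hv i.
exact: NS.
Qed.

End FrobeniusKernel.

Theorem mainTheorem4 (R : realType) (k : closedFieldType) (p r : nat)
  (hp : p \in [pchar k]) (hr : (0 < r)%N) :
  is_socle
    (sum_submodules
       [set aj : r.-tuple (int * rat) | forall i : 'I_r, Pset p (tnth aj i)]
       (fun aj => [set u : (Ur R k p r)^o | exists v : Ur R k p r,
          Urval u = Urval v * Beps R k p (nseq_tuple r (1 : 'F_2)) aj])).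
Proof. exact: (socsum_socle R hp hr). Qed.
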